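(* Let $g\in H(\mathbb{D})$ and let $p,q$ be real numbers with $1\le p<q<\infty$. (i) Suppose that $\left(\frac1p-\frac1q\right)\le1$ and $g\in\Lambda_{\frac1p-\frac1q}$. Then $H^p\subseteq[V_g,H^q]=[T_g,H^q]$ with a continuous inclusion. (ii) Suppose that $\left(\frac1p-\frac1q\right)<1$ and $g\in\lambda_{\frac1p-\frac1q}$. Then $H^p$ is a proper subspace of $[V_g,H^q]=[T_g,H^q]$.
   Context: $\mathbb{D}=\{z\in\mathbb{C}:|z|<1\}$; $H(\mathbb{D})$ is the Fréchet space of all analytic functions on $\mathbb{D}$ with the topology of uniform convergence on compact sets; $H^p$ is the classical Hardy space on $\mathbb{D}$ with its usual norm. For $0<\alpha\le1$ the Lipschitz spaces are $\Lambda_\alpha:=\{g\in H(\mathbb{D}):\sup_{z\in\mathbb{D}}(1-|z|)^{1-\alpha}|g'(z)|<\infty\}$ and $\lambda_\alpha:=\{g\in H(\mathbb{D}):\lim_{|z|\to1^-}(1-|z|)^{1-\alpha}|g'(z)|=0\}$. For $g,f\in H(\mathbb{D})$, $(V_gf)(z):=\int_0^z f(\xi)g'(\xi)\,d\xi$ for $z\in\mathbb{D}$, and $(T_gf)(z):=\frac1z\int_0^z f(\xi)g'(\xi)\,d\xi$ for $z\in\mathbb{D}\setminus\{0\}$, $(T_gf)(0):=f(0)g'(0)$. For $X$ a Banach space continuously included in $H(\mathbb{D})$ and $T\colon H(\mathbb{D})\to H(\mathbb{D})$ continuous linear with $T(X)\subseteq X$, the optimal domain is $[T,X]:=\{f\in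 H(\mathbb{D}):Tf\in X\}$ with (semi-)norm $\|f\|_{[T,X]}:=\|Tf\|_X$. *)

(* Defs.v *)
From mathcomp Require Import all_boot all_order all_algebra.
From mathcomp Require Import all_classical all_reals all_analysis.
From mathcomp Require Import complex.

Set Implicit Arguments.
Unset Strict Implicit.
Unset Printing Implicit Defensive.

Import Order.TTheory GRing.Theory Num.Theory.
Import numFieldNormedType.Exports.

Local Open Scope classical_set_scope.
Local Open Scope ring_scope.
Local Open Scope complex_scope.

(* Functions on the unit disc are represented by total functions on [R[i]];
   nothing below depends on their values outside the disc. The norm of [R[i]]
   takes its values in [R[i]], so the real modulus [normc] is used. *)

Notation normc := ComplexField.Normc.normc.

Definition unit_disc (R : realType) : set R[i] := [set z | normc z < 1].

(* The topology of [R[i]] is found through its [numFieldType] structure, so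
   that derivatives below are complex derivatives. *)
Definition cfield (R : realType) : numFieldType := R[i].

Definition analytic_on_disc (R : realType) (f : R[i] -> R[i]) : Prop :=
  forall z : R[i], unit_disc z ->
    derivable (f : (cfield R)^o -> (cfield R)^o) z 1.

Definition cderiv (R : realType) (f : R[i] -> R[i]) : R[i] -> R[i] :=
  derive1 (f : cfield R -> (cfield R)^o).

(** Hardy spaces *)

Definition circle_pt (R : realType) (r t : R) : R[i] :=
  (r * cos t) +i* (r * sin t).

Definition circle_mean (R : realType) (p : R) (f : R[i] -> R[i]) (r : R) :
    \bar R :=
  (((2 * pi)^-1)%:E *
   \int[lebesgue_measure]_(t in `[0%R, (2 * pi)%R])
     (normc (f (circle_pt r t)) `^ p)%:E)%E.

Definition hardy_norm (R : realType) (p : R) (f : R[i] -> R[i]) : \bar R :=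
  ereal_sup [set poweR (circle_mean p f r) p^-1 | r in `[0%R, 1%R[].

Definition hardy (R : realType) (p : R) : set (R[i] -> R[i]) :=
  [set f | analytic_on_disc f /\ (hardy_norm p f < +oo)%E].

(** Lipschitz spaces *)

Definition lipschitz_weight (R : realType) (a : R) (g : R[i] -> R[i])
    (z : R[i]) : R :=
  (1 - normc z) `^ (1 - a) * normc (cderiv g z).

Definition lipschitz_space (R : realType) (a : R) : set (R[i] -> R[i]) :=
  [set g | analytic_on_disc g /\
    (ereal_sup [set (lipschitz_weight a g z)%:E | z in @unit_disc R] < +oo)%E].

Definition little_lipschitz_space (R : realType) (a : R) : set (R[i] -> R[i]) :=
  [set g | analytic_on_disc g /\
    forall e : R, 0 < e -> exists2 d : R, 0 < d &
      forall z : R[i], 1 - d < normc z < 1 -> lipschitz_weight a g z < e].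

(** Integral operators *)

Definition cintegral (R : realType) (a b : R) (h : R -> R[i]) : R[i] :=
  (\int[lebesgue_measure]_(t in `[a, b]) complex.Re (h t)) +i*
  (\int[lebesgue_measure]_(t in `[a, b]) complex.Im (h t)).

(* The integral from 0 to [z] is taken along the segment [t |-> t z]. *)
Definition volterra_op (R : realType) (g f : R[i] -> R[i]) (z : R[i]) : R[i] :=
  cintegral 0 1 (fun t : R => f (t%:C * z) * cderiv g (t%:C * z) * z).

Definition cesaro_op (R : realType) (g f : R[i] -> R[i]) (z : R[i]) : R[i] :=
  if z == 0 then f 0 * cderiv g 0 else z^-1 * volterra_op g f z.

(** Optimal domains *)

Definition optimal_domain (R : realType)
    (T : (R[i] -> R[i]) -> (R[i] -> R[i])) (X : set (R[i] -> R[i])) :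
    set (R[i] -> R[i]) :=
  [set f | analytic_on_disc f /\ X (T f)].

Definition optimal_norm (R : realType)
    (T : (R[i] -> R[i]) -> (R[i] -> R[i])) (normX : (R[i] -> R[i]) -> \bar R)
    (f : R[i] -> R[i]) : \bar R :=
  normX (T f).

Definition continuous_inclusion (R : realType)
    (X : set (R[i] -> R[i])) (normX : (R[i] -> R[i]) -> \bar R)
    (Y : set (R[i] -> R[i])) (normY : (R[i] -> R[i]) -> \bar R) : Prop :=
  X `<=` Y /\
  forall f0, X f0 -> forall e : R, 0 < e -> exists2 d : R, 0 < d &
    forall f, X f -> (normX (f \- f0)%R < d%:E)%E -> (normY (f \- f0)%R < e%:E)%E.

Definition linear_subspace (R : realType) (X : set (R[i] -> R[i])) : Prop :=
  X (fun=> 0) /\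
  forall (c : R[i]) f h, X f -> X h -> X (fun z => c * f z + h z).

Definition proper_subspace (R : realType) (X Y : set (R[i] -> R[i])) : Prop :=
  linear_subspace X /\ X `<` Y.

(* Main.v *)
(* Write [al = 1/p - 1/q] and let [f] have Hardy norm at most [1], the general case following by
   scaling. On a radius, [|T_g f|] is at most a constant times the integral of
   [|f(s e^it)| (1 - s)^(al - 1)] over [s]. Put [u = (|f|^2 + 1)^(p/4)]. Three facts bound this
   integral. Poisson's formula gives [u(s e^it)^2 <= K / (1 - s)]. The function [u^2] is subharmonic
   with Laplacian at least [4 |d_s u|^2], so Green's formula shows that
   [G(t) = int (d_s u)^2 s (1 - s) ds] is integrable in [t], with a bound depending only on [p].
   Finally, splitting the radial integral at [1 - s = 1 / (2 (1 + G(t)))], using the growth bound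
   below that point and [G] above it, yields [|T_g f(e^it)| <= C (1 + G(t))^(1/q)]; this is
   Hedberg's argument with the energy [G] in place of a maximal function, and it works for [p = 1].

   Strictness: for a large integer [m] the gap series [f(z) = sum_k 2^k z^(4^(m k))] satisfies
   [|f(z)| <= 4 (1 - |z|)^(-1/m)], so [V_g f] is bounded as soon as [1/m < al], whereas its unbounded
   Taylor coefficients exclude it from every Hardy space with [p >= 1].

   Complex derivability alone is assumed of analytic functions, so Cauchy's formula is obtained from
   a Goursat type bisection argument. *)

From HB Require Import structures.
Require Import Defs.
From mathcomp Require Import all_boot all_order all_algebra.
From mathcomp Require Import all_classical all_reals all_analysis.
From mathcomp Require Import complex.
From mathcomp Require Import ring lra.

Set Implicit Arguments.
Unset Strict Implicit.
Unset Printing Implicit Defensive.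

Import Order.TTheory GRing.Theory Num.Theory.
Import numFieldNormedType.Exports.

Local Open Scope classical_set_scope.
Local Open Scope ring_scope.

(** * Integrals of continuous functions and bisection of rectangles *)

Section intg.
Context {R : realType}.
Implicit Types (h f : R -> R) (a b c m : R).
Notation mu := (@lebesgue_measure R).

(** One form of Green's formula carries both halves of the proof: an inequality in which only a
    continuous minorant of the curl is integrated. It yields Cauchy's formula while the derivative
    is not yet known to be continuous, and later the energy bound, where a lower estimate of the
    Laplacian is all that is at hand. The 1 in [u] keeps [|f|^2 + 1] away from 0, so that its real
    powers are differentiable at the zeros of [f] for every [p]; since [u^(2/p) >= |f|], nothing is
    lost by it. All integrals are taken on circles strictly inside the disc, and the constants are
    fixed before [f] and the radius, so boundary values of [f] never enter. *)

Definition intg h a b : R := (\int[mu]_(t in `[a, b]) h t)%R.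

Lemma intgE h a b : (\int[mu]_(t in `[a, b]) h t)%R = intg h a b.
Proof. by []. Qed.

(** Two-sided continuity, even at the endpoints: the integrands below extend past their segments of
    integration, and pointwise continuity restricts and combines without side conditions. *)
Definition cont_on h a b := forall x, a <= x <= b -> {for x, continuous h}.

Lemma cont_on_within h a b : cont_on h a b -> {within `[a, b], continuous h}.
Proof.
move=> hc; apply/continuous_in_subspaceT => x; rewrite inE /= in_itv /= => xab.
exact: hc.
Qed.

Lemma cont_on_sub h a b a' b' : a <= a' -> b' <= b ->
  cont_on h a b -> cont_on h a' b'.
Proof. by move=> aa bb hc x xab; apply: hc; lra. Qed.

Lemma cont_on_integrable h a b :
  cont_on h a b -> mu.-integrable `[a, b] (EFin \o h).
Proof.
move=> hc; apply: continuous_compact_integrable; first exact: segment_compact.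
exact: cont_on_within.
Qed.

Lemma cont_onD h f a b : cont_on h a b -> cont_on f a b ->
  cont_on (fun x => h x + f x) a b.
Proof. by move=> hc fc x xab; apply: cvgD; [exact: hc|exact: fc]. Qed.

Lemma cont_onN h a b : cont_on h a b -> cont_on (fun x => - h x) a b.
Proof. by move=> hc x xab; apply: cvgN; exact: hc. Qed.

Lemma cont_onB h f a b : cont_on h a b -> cont_on f a b ->
  cont_on (fun x => h x - f x) a b.
Proof. by move=> hc fc x xab; apply: cvgB; [exact: hc|exact: fc]. Qed.

Lemma cont_onM h f a b : cont_on h a b -> cont_on f a b ->
  cont_on (fun x => h x * f x) a b.
Proof. by move=> hc fc x xab; apply: cvgM; [exact: hc|exact: fc]. Qed.

Lemma cont_on_cst k a b : cont_on (fun=> k) a b.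
Proof. by move=> x _; apply: cvg_cst. Qed.

Lemma cont_on_id a b : cont_on id a b.
Proof. by move=> x _; exact: cvg_id. Qed.

Lemma cont_on_norm h a b : cont_on h a b -> cont_on (fun x => `|h x|) a b.
Proof. by move=> hc x xab; apply: cvg_norm; exact: hc. Qed.

Lemma eq_intg h f a b : (forall x, a <= x <= b -> h x = f x) ->
  intg h a b = intg f a b.
Proof.
by move=> hf; apply: eq_Rintegral => x; rewrite inE /= in_itv /= => /hf.
Qed.

Lemma intg_cst k a b : a <= b -> intg (fun=> k) a b = k * (b - a).
Proof.
move=> ab; rewrite /intg Rintegral_cst//= lebesgue_measure_itv /= lte_fin.
by case: ltP => ab'; rewrite //= (_ : b = a) ?subrr//; lra.
Qed.

Lemma intgD h f a b : cont_on h a b -> cont_on f a b ->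
  intg (fun x => h x + f x) a b = intg h a b + intg f a b.
Proof. by move=> hc fc; apply: RintegralD => //; exact: cont_on_integrable. Qed.

Lemma intgB h f a b : cont_on h a b -> cont_on f a b ->
  intg (fun x => h x - f x) a b = intg h a b - intg f a b.
Proof. by move=> hc fc; apply: RintegralB => //; exact: cont_on_integrable. Qed.

Lemma intgZ k h a b : cont_on h a b ->
  intg (fun x => k * h x) a b = k * intg h a b.
Proof. by move=> hc; apply: RintegralZl => //; exact: cont_on_integrable. Qed.

Lemma intgN h a b : cont_on h a b -> intg (fun x => - h x) a b = - intg h a b.
Proof.
move=> hc; rewrite -mulN1r -intgZ//; apply: eq_intg => x _; by rewrite mulN1r.
Qed.

Lemma le_intg h f a b : cont_on h a b -> cont_on f a b ->
  (forall x, a <= x <= b -> h x <= f x) -> intg h a b <= intg f a b.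
Proof.
move=> hc fc hf; apply: le_Rintegral => //; try exact: cont_on_integrable.
Qed.

Lemma intg_ge0 h a b : (forall x, a <= x <= b -> 0 <= h x) -> 0 <= intg h a b.
Proof. by move=> h0; apply: Rintegral_ge0 => x /=; rewrite in_itv; exact: h0. Qed.

Lemma le_norm_intg h a b : cont_on h a b ->
  `|intg h a b| <= intg (fun x => `|h x|) a b.
Proof. by move=> hc; apply: le_normr_Rintegral => //; exact: cont_on_integrable. Qed.

Lemma intg_bound h a b M : a <= b -> cont_on h a b ->
  (forall x, a <= x <= b -> `|h x| <= M) -> `|intg h a b| <= M * (b - a).
Proof.
move=> ab hc hM; apply: le_trans (le_norm_intg hc) _.
rewrite -intg_cst//; apply: le_intg => //; first exact: cont_on_norm.
exact: cont_on_cst.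
Qed.

Lemma intg_ub h a b M : a <= b -> cont_on h a b ->
  (forall x, a <= x <= b -> h x <= M) -> intg h a b <= M * (b - a).
Proof.
by move=> ab hc hM; rewrite -intg_cst//; apply: le_intg => //; exact: cont_on_cst.
Qed.

Lemma intg_split h a m b : a <= m <= b -> cont_on h a b ->
  intg h a b = intg h a m + intg h m b.
Proof.
move=> /andP[am mb] hc; have hi := cont_on_integrable hc.
rewrite /intg -[X in _ = _ + X]Rintegral_itv_obnd_cbnd.
  by rewrite -(@Rintegral_itvB _ h (BLeft a) (BRight b) m)// addrC subrK.
apply: integrableS hi => //; apply: subset_itvr.
by rewrite bnd_simp.
Qed.

Lemma intg_le_sub h a b a' b' : a <= a' -> a' <= b' -> b' <= b ->
  cont_on h a b -> (forall x, a <= x <= b -> 0 <= h x) ->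
  intg h a' b' <= intg h a b.
Proof.
move=> aa ab bb hc h0; rewrite (@intg_split _ a a' b)//; last lra.
rewrite (@intg_split _ a' b' b); last 2 first.
- lra.
- exact: cont_on_sub hc.
rewrite addrC -addrA lerDl addr_ge0//; apply: intg_ge0 => x xab; apply: h0; lra.
Qed.

Lemma intg_FTC2 h H a b : a <= b -> cont_on h a b ->
  (forall x, a <= x <= b -> is_derive x 1 H (h x)) -> intg h a b = H b - H a.
Proof.
rewrite le_eqVlt => /predU1P[<- _ _|ab hc dH].
  by rewrite subrr /intg set_itv1 Rintegral_set1.
have Hc x : a <= x <= b -> {for x, continuous H}.
  by move=> /dH[dHx _]; apply/differentiable_continuous/derivable1_diffP.
rewrite /intg /Rintegral (@continuous_FTC2 _ h H)//.
- exact: cont_on_within.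
- split.
  + by move=> x; rewrite in_itv/= => xab; case: (dH x _) => //; lra.
  + by apply: cvg_at_right_filter; apply: Hc; lra.
  + by apply: cvg_at_left_filter; apply: Hc; lra.
- move=> x; rewrite in_itv/= => xab; rewrite derive1E.
  by case: (dH x _) => //; lra.
Qed.

(** Compactness of the segment turns joint continuity at the points [(x, y0)] into one bound on
    [|psi x y0 - psi x y|], uniform in [x], for [y] near [y0]. The 1 added to [b - a] covers
    [a = b]. *)
Lemma cont_on_param_intg (psi : R -> R -> R) a b y0 :
  (forall x, a <= x <= b ->
     {for (x, y0), continuous (fun p : R * R => psi p.1 p.2)}) ->
  (forall y, cont_on (fun x => psi x y) a b) -> a <= b ->
  {for y0, continuous (fun y => intg (psi ^~ y) a b)}.
Proof.
move=> psic psix ab.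
apply/cvgrPdist_le => e e0.
have e1 : 0 < e / (b - a + 1) by rewrite divr_gt0//; lra.
have cK : compact `[a, b] by exact: segment_compact.
have : \forall y \near nbhs y0, `[a, b] `<=`
    (fun x => `|psi x y0 - psi x y| <= e / (b - a + 1)).
  apply: (iffLR (compact_near_coveringP _) cK _ (nbhs y0)
    (fun y x => `|psi x y0 - psi x y| <= e / (b - a + 1))).
  move=> x; rewrite /= in_itv /= => xab.
  have /cvgrPdist_le /(_ (e / (b - a + 1) / 2)) := psic x xab.
  move=> /(_ ltac:(by rewrite divr_gt0))[[A B] /= [Ax By] AB].
  exists (A, B) => //= -[x' y'] /= [Ax' By'].
  have := AB (x', y') (conj Ax' By'); rewrite /=.
  have := AB (x', y0) (conj Ax' (nbhs_singleton By)); rewrite /= => h1 h2.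
  rewrite (_ : psi x' y0 - psi x' y' =
    (psi x y0 - psi x' y') - (psi x y0 - psi x' y0)); last by lra.
  by rewrite (le_trans (ler_normB _ _))//; lra.
apply: filterS => y Ky; rewrite -intgB//.
apply: (@le_trans _ _ (e / (b - a + 1) * (b - a))).
  apply: intg_bound => //; exact: cont_onB.
rewrite -mulrA ler_piMr ?(ltW e0)// mulrC ler_pdivrMr; lra.
Qed.

(** The failure of [T] passes from a rectangle to one of its quarters, so a failure on the whole
    rectangle produces nested failures that shrink to a point, where the local hypothesis refutes
    them. That hypothesis only concerns small rectangles containing the point, which is what a
    first-order expansion at the point controls. *)
Lemma rect_bisect (T : R -> R -> R -> R -> Prop) a b c d : a <= b -> c <= d ->
  (forall a' b' c' d' m n, a <= a' -> b' <= b -> c <= c' -> d' <= d ->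
    a' <= m <= b' -> c' <= n <= d' -> m = (a' + b') / 2 -> n = (c' + d') / 2 ->
    T a' m c' n -> T a' m n d' -> T m b' c' n -> T m b' n d' ->
    T a' b' c' d') ->
  (forall x y, a <= x <= b -> c <= y <= d -> exists2 e, 0 < e &
    forall a' b' c' d', a <= a' -> b' <= b -> c <= c' -> d' <= d ->
      a' <= x <= b' -> c' <= y <= d' -> b' - a' < e -> d' - c' < e ->
      T a' b' c' d') ->
  T a b c d.
Proof.
move=> ab cd split loc; apply: contrapT => nT.
pose ok (q : R * R * (R * R)) := [/\ a <= q.1.1, q.1.2 <= b, q.1.1 <= q.1.2 &
  [/\ c <= q.2.1, q.2.2 <= d, q.2.1 <= q.2.2 &
  ~ T q.1.1 q.1.2 q.2.1 q.2.2]].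
pose sub (q q' : R * R * (R * R)) :=
  [/\ q.1.1 <= q'.1.1, q'.1.2 <= q.1.2, q'.1.2 - q'.1.1 = (q.1.2 - q.1.1) / 2 &
  [/\ q.2.1 <= q'.2.1, q'.2.2 <= q.2.2 & q'.2.2 - q'.2.1 = (q.2.2 - q.2.1) / 2]].
have next q : exists q', ok q -> ok q' /\ sub q q'.
  have [[] | nok] := pselect (ok q); last by exists q.
  case: q => [[a' b'] [c' d']] /= aa bb ab' [cc dd cd' nT'].
  pose m := (a' + b') / 2; pose n := (c' + d') / 2.
  have [t1|t1] := pselect (T a' m c' n); last first.
    by exists ((a', m), (c', n)); split; split => //=; try split => //=; rewrite /m /n; clear -aa bb ab' cc dd cd'; lra.
  have [t2|t2] := pselect (T a' m n d'); last first.
    by exists ((a', m), (n, d')); split; split => //=; try split => //=; rewrite /m /n; clear -aa bb ab' cc dd cd'; lra.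
  have [t3|t3] := pselect (T m b' c' n); last first.
    by exists ((m, b'), (c', n)); split; split => //=; try split => //=; rewrite /m /n; clear -aa bb ab' cc dd cd'; lra.
  have [t4|t4] := pselect (T m b' n d'); last first.
    by exists ((m, b'), (n, d')); split; split => //=; try split => //=; rewrite /m /n; clear -aa bb ab' cc dd cd'; lra.
  by case: nT'; apply: (split _ _ _ _ m n); rewrite /m /n; (done || clear -aa bb ab' cc dd cd'; lra).
have [nx nxP] := choice next.
pose s k := iter k nx ((a, b), (c, d)).
have sok k : ok (s k).
  by elim: k => [|k IH] /=; [split => //=; split|case: (nxP _ IH)].
have ssub k : sub (s k) (s k.+1) by case: (nxP _ (sok k)).
have width k : (s k).1.2 - (s k).1.1 = (b - a) / 2 ^+ k /\
   (s k).2.2 - (s k).2.1 = (d - c) / 2 ^+ k.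
  elim: k => [|k [IH1 IH2]]; first by rewrite expr0 !divr1.
  have [_ _ -> [_ _ ->]] := ssub k; rewrite IH1 IH2 exprS invfM.
  by split; rewrite [RHS]mulrA [RHS]mulrAC.
have mono k l : (k <= l)%N -> [/\ (s k).1.1 <= (s l).1.1, (s l).1.2 <= (s k).1.2,
    (s k).2.1 <= (s l).2.1 & (s l).2.2 <= (s k).2.2].
  elim: l => [|l IH]; first by rewrite leqn0 => /eqP ->.
  rewrite leq_eqVlt => /predU1P[->//|]; rewrite ltnS => /IH[h1 h2 h3 h4].
  have [h5 h6 _ [h7 h8 _]] := ssub l; split.
  - exact: le_trans h5.
  - exact: le_trans h2.
  - exact: le_trans h7.
  - exact: le_trans h4.
(* Nested segments have a common point, namely the supremum of the left endpoints. *)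
have nest (lo hi : nat -> R) : (forall k l, (k <= l)%N -> lo k <= lo l /\ hi l <= hi k) ->
    (forall k, lo k <= hi k) -> exists x, forall k, lo k <= x <= hi k.
  move=> lohi lh; exists (sup (range lo)) => k.
  have lohi' i j : lo i <= hi j.
    have [ij|/ltnW ji] := leqP i j.
      by have [? _] := lohi _ _ ij; have := lh j; lra.
    by have [_ ?] := lohi _ _ ji; have := lh i; lra.
  apply/andP; split.
    apply: ub_le_sup; last by exists k.
    by exists (hi 0%N) => _ [i _ <-].
  by apply: ge_sup; [exists (lo 0%N), 0%N|move=> _ [i _ <-]].
have [x xP] := nest (fun k => (s k).1.1) (fun k => (s k).1.2)
  ltac:(by move=> k l /mono[]) ltac:(by move=> k; case: (sok k)).
have [y yP] := nest (fun k => (s k).2.1) (fun k => (s k).2.2)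
  ltac:(by move=> k l /mono[]) ltac:(by move=> k; case: (sok k) => _ _ _ []).
have [e e0 eP] := loc x y (xP 0%N) (yP 0%N).
have small w : 0 <= w -> \forall k \near \oo, w / 2 ^+ k < e.
  move=> w0; near=> k.
  rewrite ltr_pdivrMr ?exprn_gt0// mulrC -ltr_pdivrMr//.
  apply: lt_trans (_ : k%:R < _); last by rewrite -natrX ltr_nat ltn_expl.
  by near: k; exact: nbhs_infty_gtr.
have [k [k1 k2]] : exists k, (b - a) / 2 ^+ k < e /\ (d - c) / 2 ^+ k < e.
  near \oo => k; exists k; split; near: k; apply: small; lra.
have [h1 h2 h3 [h4 h5 h6]] := sok k; apply.
by have [w1 w2] := width k; apply: eP => //; rewrite ?w1 ?w2.
Unshelve. all: by end_near. Qed.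

End intg.

#[global] Opaque intg.

(** * Partial derivatives and Green's inequality *)

Section fd.
Context {R : realType}.
Implicit Types (F G : R -> R -> R) (x y : R).

(** Frechet differentiability at a single point. Continuity of the partial derivatives is not part
    of it: for a merely derivable complex function it is not yet known. *)
Definition fd F x y (Fx Fy : R) : Prop :=
  is_diff ((x, y) : R * R) (fun p : R * R => F p.1 p.2 : R)
    (fun h => Fx * h.1 + Fy * h.2).

Lemma fd_eq F x y Fx Fy Fx' Fy' :
  fd F x y Fx Fy -> Fx = Fx' -> Fy = Fy' -> fd F x y Fx' Fy'.
Proof. by move=> ? <- <-. Qed.

Lemma fd_cst k x y : fd (fun _ _ => k) x y 0 0.
Proof.
apply: (is_diff_eq (is_diff_cst k (x, y))).
by apply/funext => h /=; rewrite !mul0r addr0.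
Qed.

Let is_diff_real (f : R -> R) x fx : is_derive x 1 f fx ->
  is_diff x f (fun h => fx * h).
Proof.
move=> df; have dfx : differentiable f x.
  by apply/derivable1_diffP; case: df.
apply: DiffDef => //=; apply/funext => h; rewrite diff1E//.
by rewrite derive1E; case: df => _ ->; rewrite mulrC.
Qed.

Lemma fd_fst (f : R -> R) x y fx : is_derive x 1 f fx ->
  fd (fun s _ => f s) x y fx 0.
Proof.
move=> /is_diff_real dd.
have d1 : is_diff ((x, y) : R * R) (fst : R * R -> R) (fst : R * R -> R).
  apply: DiffDef; first by apply: linear_differentiable => ?; exact: cvg_fst.
  by apply: diff_lin => ?; exact: cvg_fst.
apply: (is_diff_eq (@is_diff_comp _ _ _ _ _ _ _ _ (x, y) d1 dd)).
by apply/funext => h /=; rewrite mul0r addr0.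
Qed.

Lemma fd_snd (f : R -> R) x y fy : is_derive y 1 f fy ->
  fd (fun _ t => f t) x y 0 fy.
Proof.
move=> /is_diff_real dd.
have d1 : is_diff ((x, y) : R * R) (snd : R * R -> R) (snd : R * R -> R).
  apply: DiffDef; first by apply: linear_differentiable => ?; exact: cvg_snd.
  by apply: diff_lin => ?; exact: cvg_snd.
apply: (is_diff_eq (@is_diff_comp _ _ _ _ _ _ _ _ (x, y) d1 dd)).
by apply/funext => h /=; rewrite mul0r add0r.
Qed.

Lemma fdD F G x y Fx Fy Gx Gy : fd F x y Fx Fy -> fd G x y Gx Gy ->
  fd (fun s t => F s t + G s t) x y (Fx + Gx) (Fy + Gy).
Proof.
move=> dF dG; apply: (is_diff_eq (is_diffD dF dG)).
by apply/funext => h; rewrite !fctE /=; ring.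
Qed.

Lemma fdM F G x y Fx Fy Gx Gy : fd F x y Fx Fy -> fd G x y Gx Gy ->
  fd (fun s t => F s t * G s t) x y (Fx * G x y + F x y * Gx)
    (Fy * G x y + F x y * Gy).
Proof.
move=> dF dG; apply: (is_diff_eq (is_diffM dF dG)).
by apply/funext => h; rewrite !fctE /= /GRing.scale /=; ring.
Qed.

Lemma fd_comp (f : R -> R) F x y fx Fx Fy : fd F x y Fx Fy ->
  is_derive (F x y) 1 f fx ->
  fd (fun s t => f (F s t)) x y (fx * Fx) (fx * Fy).
Proof.
move=> dF /is_diff_real dd.
apply: (is_diff_eq (@is_diff_comp _ _ _ _ _ _ _ _ (x, y) dF dd)).
by apply/funext => h; rewrite !fctE /=; ring.
Qed.

Lemma fd_cont F x y Fx Fy : fd F x y Fx Fy ->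
  {for (x, y), continuous (fun p : R * R => F p.1 p.2)}.
Proof. by case=> dF _; exact: differentiable_continuous. Qed.

Lemma continuous2_fst F x y :
  {for (x, y), continuous (fun p : R * R => F p.1 p.2)} -> {for x, continuous (F ^~ y)}.
Proof.
move=> Fc.
apply: (@continuous_comp _ _ _ (fun s : R => (s, y)) (fun p => F p.1 p.2)) => //.
by apply: (cvg_pair (@cvg_id _ _) (@cvg_cst _ _ _ _ _)).
Qed.

Lemma fd_cont_fst F x y Fx Fy : fd F x y Fx Fy -> {for x, continuous (F ^~ y)}.
Proof. by move=> /fd_cont; exact: continuous2_fst. Qed.

Lemma fd_cont_snd F x y Fx Fy : fd F x y Fx Fy -> {for y, continuous (F x)}.
Proof.
move=> /fd_cont Fc.
apply: (@continuous_comp _ _ _ (fun s : R => (x, s)) (fun p => F p.1 p.2)) => //.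
by apply: (cvg_pair (@cvg_cst _ _ _ _ _) (@cvg_id _ _)).
Qed.

Lemma fdP F x y Fx Fy : fd F x y Fx Fy <->
  forall e, 0 < e -> exists2 d, 0 < d & forall h k, `|h| < d -> `|k| < d ->
  `|F (x + h) (y + k) - F x y - (Fx * h + Fy * k)| <= e * (`|h| + `|k|).
Proof.
split.
  move=> [dF dE] e e0.
  have := diff_locally dF; rewrite dE => /eqaddoP /(_ e e0).
  move=> /nbhs_norm0P[d /= d0 H]; exists d => // h k hd kd.
  have := H (h, k); rewrite /= prod_normE /= gt_max hd kd => /(_ isT).
  rewrite !fctE /= opprD [h + x]addrC [k + y]addrC addrA => /le_trans; apply.
  rewrite ler_wpM2l ?(ltW e0)//.
  by rewrite ge_max; apply/andP; split; rewrite ?lerDl ?lerDr.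
move=> H.
pose df (h : R * R) : R := Fx * h.1 + Fy * h.2.
have dfl : linear df by move=> a u v; rewrite /df /= /GRing.scale /=; ring.
pose dfL := GRing.isLinear.Build _ _ _ _ _ dfl.
pose dfM : {linear (R * R)%type -> R} := HB.pack df dfL.
have dfc : continuous dfM.
  move=> p; rewrite /= /df.
  by apply: cvgD; apply: cvgM; [exact: cvg_cst|exact: cvg_fst|exact: cvg_cst|
    exact: cvg_snd].
have dE : (fun p : R * R => F p.1 p.2 : R) \o shift (x, y) =
    cst (F x y) + dfM +o_ (0 : R * R) id.
  apply/eqaddoP => e e0.
  (* The norm of a pair is the maximum, and [|h| + |k|] is at most twice that, hence the half. *)
  have [d d0 Hd] := H (e / 2) (ltac:(by rewrite divr_gt0)).
  apply: filterS (@nbhs0_lt R (R * R)%type d d0) => -[h k].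
  rewrite /= prod_normE /= gt_max => /andP[hd kd].
  have := Hd h k hd kd; rewrite !fctE /= [h + x]addrC [k + y]addrC.
  rewrite -addrA -opprD => /le_trans; apply.
  rewrite -mulrA ler_wpM2l ?(ltW e0)//.
  have h1 : `|h| <= Num.max `|h| `|k| by rewrite le_max lexx.
  have h2 : `|k| <= Num.max `|h| `|k| by rewrite le_max lexx orbT.
  lra.
have dU := diff_unique dfc dE.
apply: DiffDef; last by rewrite /= dU.
by apply/diff_locallyP; rewrite dU.
Qed.

End fd.

(** * Green's inequality by bisection *)

Section green.
Context {R : realType}.
Implicit Types (P Q psi : R -> R -> R) (x y : R).

Lemma continuous2P psi x y :
  {for (x, y), continuous (fun p : R * R => psi p.1 p.2)} ->
  forall e, 0 < e -> exists2 d, 0 < d & forall x' y', `|x' - x| < d ->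
    `|y' - y| < d -> `|psi x' y' - psi x y| <= e.
Proof.
move=> /cvgrPdist_le /= H e e0; have [[A B] /= [Ax By] AB] := H e e0.
move/nbhs_normP : Ax => [d1 /= d10 A1]; move/nbhs_normP : By => [d2 /= d20 B1].
exists (Num.min d1 d2); first by rewrite lt_min d10 d20.
move=> x' y'; rewrite !lt_min => /andP[h1 _] /andP[_ h2].
rewrite distrC; apply: (AB (x', y')); split => /=.
  by apply: A1; rewrite /ball_ /= distrC.
by apply: B1; rewrite /ball_ /= distrC.
Qed.

(** The boundary is run counterclockwise. [P] and [Q] are only differentiable at each point; [psi]
    carries the continuity that gives the double integral a meaning. *)
Lemma green_le P Q psi a b c d : a <= b -> c <= d ->
  (forall x y, a <= x <= b ->
    {for (x, y), continuous (fun p : R * R => psi p.1 p.2)}) ->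
  (forall x y, a <= x <= b -> c <= y <= d -> exists Px Py Qx Qy,
    [/\ fd P x y Px Py, fd Q x y Qx Qy & psi x y <= Qx - Py]) ->
  intg (fun y => intg (psi ^~ y) a b) c d <=
  intg (fun x => P x c - P x d) a b + intg (fun y => Q b y - Q a y) c d.
Proof.
move=> ab cd psic H.
have cPx y : c <= y <= d -> cont_on (P ^~ y) a b.
  by move=> yy x xx; have [? [? [? [? [/fd_cont_fst]]]]] := H x y xx yy.
have cQy x : a <= x <= b -> cont_on (Q x) c d.
  by move=> xx y yy; have [? [? [? [? [_ /fd_cont_snd]]]]] := H x y xx yy.
have cpx y : cont_on (psi ^~ y) a b.
  by move=> x xx; apply: continuous2_fst; exact: psic.
have cIp a' b' : a <= a' -> a' <= b' -> b' <= b ->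
    cont_on (fun y => intg (psi ^~ y) a' b') c d.
  move=> aa ab' bb y yy; apply: cont_on_param_intg => // [x xx|y'].
    by apply: psic => //; lra.
  exact: cont_on_sub (cpx y').
(* The defect [E] of the inequality is additive under bisection and the squared semi-perimeter is
   superadditive, so a local bound [E >= - e (semi-perimeter)^2] is enough. *)
pose E a' b' c' d' := intg (fun x => P x c' - P x d') a' b' +
  intg (fun y => Q b' y - Q a' y) c' d' -
  intg (fun y => intg (psi ^~ y) a' b') c' d'.
have cP c' d' a' b' : c <= c' <= d -> c <= d' <= d -> a <= a' -> b' <= b ->
    cont_on (fun x => P x c' - P x d') a' b'.
  by move=> hc hd ha hb; apply: (cont_on_sub ha hb); apply: cont_onB; exact: cPx.
have cQ a' b' c' d' : a <= a' <= b -> a <= b' <= b -> c <= c' -> d' <= d ->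
    cont_on (fun y => Q b' y - Q a' y) c' d'.
  by move=> ha hb hc hd; apply: (cont_on_sub hc hd); apply: cont_onB; exact: cQy.
have cI a' b' c' d' : a <= a' -> a' <= b' -> b' <= b -> c <= c' -> d' <= d ->
    cont_on (fun y => intg (psi ^~ y) a' b') c' d'.
  by move=> ha hab hb hc hd; apply: (cont_on_sub hc hd); exact: cIp.
have Ex a' m b' c' d' : a <= a' -> a' <= m <= b' -> b' <= b ->
    c <= c' -> c' <= d' -> d' <= d -> E a' b' c' d' = E a' m c' d' + E m b' c' d'.
  move=> aa am bb cc cd' dd; have mm : a <= m <= b by lra.
  rewrite /E (@intg_split _ _ a' m b' am); last by apply: cP => //; clear -cc cd' dd; lra.
  have -> : intg (fun y => Q b' y - Q a' y) c' d' =
     intg (fun y => Q m y - Q a' y) c' d' + intg (fun y => Q b' y - Q m y) c' d'.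
    rewrite -intgD; [|by apply: cQ => //; clear -aa am bb; lra..].
    by apply: eq_intg => y _; clear; lra.
  have -> : intg (fun y => intg (psi^~ y) a' b') c' d' =
      intg (fun y => intg (psi^~ y) a' m) c' d' + intg (fun y => intg (psi^~ y) m b') c' d'.
    rewrite -intgD; [|by apply: cI => //; clear -aa am bb; lra..].
    by apply: eq_intg => y _; apply: intg_split => //; exact: cont_on_sub (cpx y).
  by rewrite addrACA opprD [LHS]addrACA.
have Ey a' b' c' n d' : a <= a' -> a' <= b' -> b' <= b ->
    c <= c' -> c' <= n <= d' -> d' <= d -> E a' b' c' d' = E a' b' c' n + E a' b' n d'.
  move=> aa ab' bb cc cn dd; have nn : c <= n <= d by lra.
  rewrite /E (@intg_split _ _ c' n d' cn); last by apply: cQ => //; clear -aa ab' bb; lra.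
  rewrite (@intg_split _ (fun y => intg (psi^~ y) a' b') c' n d' cn); last exact: cI.
  have -> : intg (fun x => P x c' - P x d') a' b' =
     intg (fun x => P x c' - P x n) a' b' + intg (fun x => P x n - P x d') a' b'.
    rewrite -intgD; [|by apply: cP => //; clear -cc cn dd; lra..].
    by apply: eq_intg => y _; clear; lra.
  by rewrite addrACA opprD [LHS]addrACA.
pose s := (b - a + (d - c)) ^+ 2; have s0 : 0 <= s by exact: sqr_ge0.
suff EE e : 0 < e -> - (e * s) <= E a b c d.
  have : 0 <= E a b c d; last by rewrite /E subr_ge0.
  apply/ler_addgt0Pr => e e0.
  have := EE (e / (s + 1)) (ltac:(by rewrite divr_gt0//; lra)).
  have : e / (s + 1) * s <= e by rewrite mulrAC ler_pdivrMr; [nra|lra].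
  move: (E a b c d) => A; lra.
move=> e0; pose T a' b' c' d' := - (e * (b' - a' + (d' - c')) ^+ 2) <= E a' b' c' d'.
change (T a b c d).
apply: (@rect_bisect _ T a b c d ab cd) => [a' b' c' d' m n aa bb cc dd am cn mE nE|x y xx yy].
  have mm : a' <= m by case/andP: am.
  have eqE : E a' b' c' d' = E a' m c' n + E a' m n d' + (E m b' c' n + E m b' n d').
    by rewrite (Ex a' m b' c' d') 1?(Ey a' m c' n d') 1?(Ey m b' c' n d')//; lra.
  rewrite /T eqE {eqE} => h1 h2 h3 h4.
  move: h1 h2 h3 h4; rewrite mE nE.
  have q1 : (a' + b') / 2 - a' = (b' - a') / 2 by field.
  have q2 : b' - (a' + b') / 2 = (b' - a') / 2 by field.
  have q3 : (c' + d') / 2 - c' = (d' - c') / 2 by field.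
  have q4 : d' - (c' + d') / 2 = (d' - c') / 2 by field.
  rewrite q1 q2 q3 q4 -mulrDl.
  have -> : e * ((b' - a' + (d' - c')) / 2) ^+ 2 = e * (b' - a' + (d' - c')) ^+ 2 / 4.
    by field.
  move: (e * _) (E _ _ _ _) (E _ _ _ _) (E _ _ _ _) (E _ _ _ _) => {}Z E1 E2 E3 E4.
  clear; lra.
have [Px [Py [Qx [Qy [/fdP dP /fdP dQ le]]]]] := H x y xx yy.
(* On a rectangle of sides [w] and [k] around the point, two opposite sides together err by at most
   [e / 4 * (w + k)] per unit length, and [psi] by [e / 8] per unit area; the total stays below
   [e * (w + k) ^ 2]. *)
have e8 : 0 < e / 8 by rewrite divr_gt0.
have [d1 d10 {}dP] := dP _ e8; have [d2 d20 {}dQ] := dQ _ e8.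
have [d3 d30 dpsi] := continuous2P (psic x y xx) e8.
exists (Num.min d1 (Num.min d2 d3)); first by rewrite !lt_min d10 d20 d30.
move=> a' b' c' d' aa bb cc dd xx' yy'; rewrite !lt_min.
move=> /and3P[w1 w2 w3] /and3P[k1 k2 k3].
have [w wE] : exists w, w = b' - a' by exists (b' - a').
have [k kE] : exists k, k = d' - c' by exists (d' - c').
rewrite -!wE in w1 w2 w3; rewrite -!kE in k1 k2 k3.
have w0 : 0 <= w by clear -wE xx'; lra.
have k0 : 0 <= k by clear -kE yy'; lra.
have inx x' : a' <= x' <= b' -> `|x' - x| <= w.
  by move=> h; rewrite ler_norml; clear -h wE xx'; lra.
have iny y' : c' <= y' <= d' -> `|y' - y| <= k.
  by move=> h; rewrite ler_norml; clear -h kE yy'; lra.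
have approx F Fx Fy d0 : w < d0 -> k < d0 ->
    (forall u v, `|u| < d0 -> `|v| < d0 ->
      `|F (x + u) (y + v) - F x y - (Fx * u + Fy * v)| <= e / 8 * (`|u| + `|v|)) ->
    forall x' y', a' <= x' <= b' -> c' <= y' <= d' ->
    `|F x' y' - F x y - (Fx * (x' - x) + Fy * (y' - y))| <= e / 8 * (w + k).
  move=> wd kd HF x' y' /inx xw /iny yk.
  have := HF (x' - x) (y' - y) (le_lt_trans xw wd) (le_lt_trans yk kd).
  rewrite ![_ + (_ - _)]addrC !subrK => /le_trans; apply.
  by rewrite ler_wpM2l ?(ltW e8)// lerD.
have {}dP := approx _ _ _ _ w1 k1 dP; have {}dQ := approx _ _ _ _ w2 k2 dQ.
have {}dpsi x' y' : a' <= x' <= b' -> c' <= y' <= d' ->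
    `|psi x' y' - psi x y| <= e / 8.
  by move=> /inx xw /iny yk; apply: dpsi; [exact: le_lt_trans xw w3|exact: le_lt_trans yk k3].
have [ab' cd'] : a' <= b' /\ c' <= d' by clear -xx' yy'; split; lra.
have cc' : c' <= c' <= d' by rewrite lexx.
have dd' : c' <= d' <= d' by rewrite lexx andbT.
have aa' : a' <= a' <= b' by rewrite lexx.
have bb' : a' <= b' <= b' by rewrite lexx andbT.
have ca : a <= a' <= b by rewrite aa (le_trans ab').
have cb : a <= b' <= b by rewrite bb (le_trans aa).
have ccc : c <= c' <= d by rewrite cc (le_trans cd').
have ccd : c <= d' <= d by rewrite dd (le_trans cc).
have IP : (- Py * k - e / 4 * (w + k)) * (b' - a') <= intg (fun x => P x c' - P x d') a' b'.
  rewrite -lerN2 -intgN; last exact: cP.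
  rewrite -mulNr; apply: (intg_ub ab'); first exact/cont_onN/cP.
  move=> x' hx; have := dP x' c' hx cc'; have := dP x' d' hx dd'.
  by rewrite kE !ler_norml; clear; nra.
have IQ : (Qx * w - e / 4 * (w + k)) * (d' - c') <= intg (fun y => Q b' y - Q a' y) c' d'.
  rewrite -lerN2 -intgN; last exact: cQ.
  rewrite -mulNr; apply: (intg_ub cd'); first exact/cont_onN/cQ.
  move=> y' hy; have := dQ a' y' aa' hy; have := dQ b' y' bb' hy.
  by rewrite wE !ler_norml; clear; nra.
have II : intg (fun y => intg (psi^~ y) a' b') c' d' <= (psi x y + e / 8) * (b' - a') * (d' - c').
  apply: (intg_ub cd'); first exact: cI.
  move=> y' hy; apply: (intg_ub ab'); first exact: cont_on_sub (cpx y').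
  by move=> x' hx; have := dpsi x' y' hx hy; rewrite ler_norml; clear; lra.
move: IP IQ II; rewrite /T /E -wE -kE.
move: (intg _ _ _) (intg _ _ _) (intg _ _ _) => I1 I2 I3.
have wk : 0 <= w * k by rewrite mulr_ge0.
have : psi x y * (w * k) <= (Qx - Py) * (w * k) by rewrite ler_wpM2r.
move: w0 k0 wk e0; clear=> w0 k0 wk e0.
have e8wk : 0 <= e * (w * k) by rewrite mulr_ge0// ltW.
have eww : 0 <= e * w ^+ 2 by rewrite mulr_ge0 ?sqr_ge0// ltW.
have ekk : 0 <= e * k ^+ 2 by rewrite mulr_ge0 ?sqr_ge0// ltW.
nra.
Qed.

(** For a closed form, [green_le] with [psi = 0] applies both to [(P, Q)] and to [(-P, -Q)]. *)
Lemma green_eq P Q a b c d : a <= b -> c <= d ->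
  (forall x y, a <= x <= b -> c <= y <= d -> exists Px D Qy,
    fd P x y Px D /\ fd Q x y D Qy) ->
  intg (fun x => P x c - P x d) a b + intg (fun y => Q b y - Q a y) c d = 0.
Proof.
move=> ab cd H.
have i0 u v (z : R -> R) : intg (fun=> (0 : R)) u v = 0.
  by rewrite -intgE /Rintegral integral0.
have cP y : c <= y <= d -> cont_on (P ^~ y) a b.
  by move=> yy x xx; have [? [? [? [/fd_cont_fst]]]] := H x y xx yy.
have cQ x : a <= x <= b -> cont_on (Q x) c d.
  by move=> xx y yy; have [? [? [? [_ /fd_cont_snd]]]] := H x y xx yy.
have i00 : intg (fun y => intg ((fun _ _ => (0 : R)) ^~ y) a b) c d = 0.
  by rewrite -[RHS](i0 c d id); apply: eq_intg => y _; rewrite /= (i0 a b id).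
apply/eqP; rewrite eq_le -oppr_ge0; apply/andP; split.
  rewrite opprD -!intgN; [|by apply: cont_onB; [apply: cQ|apply: cQ]; lra|
    by apply: cont_onB; [apply: cP|apply: cP]; lra].
  have := @green_le (fun x y => - 1 * P x y) (fun x y => - 1 * Q x y) (fun _ _ => 0) a b c d ab cd.
  rewrite i00.
  have -> : intg (fun x => -1 * P x c - -1 * P x d) a b = intg (fun x => - (P x c - P x d)) a b.
    by apply: eq_intg => x _; lra.
  have -> : intg (fun y => -1 * Q b y - -1 * Q a y) c d = intg (fun y => - (Q b y - Q a y)) c d.
    by apply: eq_intg => x _; lra.
  apply => [x y _|x y xx yy]; first exact: cvg_cst.
  have [Px [D [Qy [dP dQ]]]] := H x y xx yy.
  exists (- Px), (- D), (- D), (- Qy); split; last by lra.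
    by apply: fd_eq (fdM (fd_cst (-1) x y) dP) _ _; lra.
  by apply: fd_eq (fdM (fd_cst (-1) x y) dQ) _ _; lra.
have := @green_le P Q (fun _ _ => 0) a b c d ab cd; rewrite i00; apply.
  by move=> x y _; exact: cvg_cst.
move=> x y xx yy; have [Px [D [Qy [dP dQ]]]] := H x y xx yy.
by exists Px, D, D, Qy; split => //; lra.
Qed.

End green.

(** * Complex derivatives *)

Section complex_derivative.
Local Open Scope complex_scope.
Context {R : realType}.
Implicit Types (f g : R[i] -> R[i]) (z w d h : R[i]).

Lemma normc_ge0 z : 0 <= normc z.
Proof. by case: z => a b; exact: sqrtr_ge0. Qed.

Lemma normc_real (x : R) : normc x%:C = `|x|.
Proof. by rewrite /= expr0n /= addr0 sqrtr_sqr. Qed.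

Lemma normcD z w : normc (z + w) <= normc z + normc w.
Proof. exact: (@le_normcD R). Qed.

Lemma normcB z w : normc (z - w) <= normc z + normc w.
Proof. by rewrite (le_trans (normcD _ _))// normcN. Qed.

Lemma normc_triangle z w : normc z - normc w <= normc (z - w).
Proof. by rewrite lerBlDr -{1}(subrK w z) normcD. Qed.

Lemma ler_Re_normc z : `|complex.Re z| <= normc z.
Proof. by case: z => a b /=; rewrite -(sqrtr_sqr a) ler_wsqrtr// lerDl sqr_ge0. Qed.

Lemma ler_Im_normc z : `|complex.Im z| <= normc z.
Proof. by case: z => a b /=; rewrite -(sqrtr_sqr b) ler_wsqrtr// lerDr sqr_ge0. Qed.

Lemma normc_le_ReIm z : normc z <= `|complex.Re z| + `|complex.Im z|.
Proof.
case: z => a b /=; rewrite -[leRHS]ger0_norm ?addr_ge0// -sqrtr_sqr.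
rewrite ler_wsqrtr// sqrrD !real_normK ?num_real// -addrA lerD2l lerDr.
by rewrite mulrn_wge0// mulr_ge0.
Qed.

Lemma sqr_normc_ReIm z : normc z ^+ 2 = complex.Re z ^+ 2 + complex.Im z ^+ 2.
Proof. by case: z => a b /=; rewrite sqr_sqrtr// addr_ge0 ?sqr_ge0. Qed.

Lemma normc_eq0 z : (normc z == 0) = (z == 0).
Proof.
by apply/eqP/eqP => [/ComplexField.Normc.eq0_normc//|->]; exact: ComplexField.Normc.normc0.
Qed.

Lemma normc_gt0 z : (0 < normc z) = (z != 0).
Proof. by rewrite lt_def normc_ge0 normc_eq0 andbT. Qed.

(** Written with the real modulus and without a quotient, so that [h = 0] is allowed and remainders
    are estimated in [R]. [cdiff_derivable] and [derivable_cdiff] tie it to the derivability in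
    [analytic_on_disc]. *)
Definition cdiff f z d := forall e : R, 0 < e -> exists2 del : R, 0 < del &
  forall h, normc h < del -> normc (f (z + h) - f z - d * h) <= e * normc h.

Lemma cdiff_near f g z d (del : R) : 0 < del ->
  (forall h, normc h < del -> f (z + h) = g (z + h)) -> cdiff f z d -> cdiff g z d.
Proof.
move=> del0 fg df e /df[e' e'0 H]; exists (Num.min del e').
  by rewrite lt_min del0.
move=> h; rewrite lt_min => /andP[h1 h2].
by rewrite -fg// -[in g z](addr0 z) -fg ?addr0 ?H// ComplexField.Normc.normc0.
Qed.

Lemma real_complex_lt0 (e : R[i]) : 0 < e -> exists2 x : R, 0 < x & e = x%:C.
Proof.
case: e => a b; rewrite ltcE /= => /andP[/eqP -> a0]; by exists a.
Qed.

Lemma cdiff_derivable f z d : cdiff f z d ->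
  derivable (f : (cfield R)^o -> (cfield R)^o) z 1 /\ cderiv f z = d.
Proof.
move=> df.
pose F : (cfield R)^o -> (cfield R)^o := f; pose Z : (cfield R)^o := z.
have cv : (fun h : cfield R => h^-1 *: ((F \o shift Z) (h *: 1) - F Z))
    @ (0 : cfield R)^' --> (d : (cfield R)^o).
  apply/cvgrPdist_le => eC eC0.
  have [e e0 ->] : exists2 x : R, 0 < x & eC = x%:C by exact: real_complex_lt0.
  have [del del0 H] := df e e0.
  have delC : 0 < del%:C :> cfield R by rewrite ltcR.
  have := @dnbhs0_lt _ (cfield R)^o _ delC.
  have := @nbhs_dnbhs_neq (cfield R)^o 0.
  apply: filterS2 => h h0 hd.
  have {}hd : normc h < del by rewrite -ltcR.
  rewrite /= /GRing.scale /= mulr1 [h + z]addrC distrC.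
  have -> : h^-1 * (f (z + h) - f z) - d = h^-1 * (f (z + h) - f z - d * h).
    by rewrite [RHS]mulrBr [X in _ = _ - X]mulrCA mulVf// mulr1.
  have nh : 0 < normc h by rewrite normc_gt0.
  rewrite -[leLHS]/((normc _)%:C) lecR ComplexField.Normc.normcM.
  by rewrite ComplexField.Normc.normcV mulrC ler_pdivrMr// H.
split; first by apply/cvg_ex; exists d.
by rewrite /cderiv derive1E; apply: cvg_lim cv.
Qed.

Lemma derivable_cdiff f z :
  derivable (f : (cfield R)^o -> (cfield R)^o) z 1 -> cdiff f z (cderiv f z).
Proof.
move=> df e e0.
pose F : (cfield R)^o -> (cfield R)^o := f; pose Z : (cfield R)^o := z.
have : (fun h : cfield R => h^-1 *: ((F \o shift Z) (h *: 1) - F Z))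
    @ (0 : cfield R)^' --> (cderiv f z : (cfield R)^o).
  by rewrite /cderiv derive1E; exact: df.
have eC : 0 < e%:C :> cfield R by rewrite ltcR.
move=> /cvgrPdist_le/(_ _ eC); rewrite near_withinE => /nbhs_norm0P[delC /= delC0 H].
have [del del0 E] : exists2 x : R, 0 < x & delC = x%:C by exact: real_complex_lt0.
exists del => // h hd.
have [->|h0] := eqVneq h 0.
  by rewrite addr0 subrr mulr0 subrr ComplexField.Normc.normc0 mulr0.
have /H /(_ h0) : `|h : (cfield R)^o| < delC by rewrite E -[ltLHS]/((normc _)%:C) ltcR.
rewrite /= /GRing.scale /= mulr1 [h + z]addrC distrC.
have -> : h^-1 * (f (z + h) - f z) - cderiv f z =
    h^-1 * (f (z + h) - f z - cderiv f z * h).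
  by rewrite [RHS]mulrBr [X in _ = _ - X]mulrCA mulVf// mulr1.
have nh : 0 < normc h by rewrite normc_gt0.
rewrite -[leLHS]/((normc _)%:C) lecR ComplexField.Normc.normcM.
by rewrite ComplexField.Normc.normcV mulrC ler_pdivrMr.
Qed.

Lemma analytic_cdiff f z : analytic_on_disc f -> normc z < 1 -> cdiff f z (cderiv f z).
Proof. by move=> fa z1; apply/derivable_cdiff/fa. Qed.

Lemma cdiff_analytic f (f' : R[i] -> R[i]) :
  (forall z, normc z < 1 -> cdiff f z (f' z)) -> analytic_on_disc f.
Proof. by move=> H z /H/cdiff_derivable[]. Qed.

Lemma cderivE f z d : cdiff f z d -> cderiv f z = d.
Proof. by move=> /cdiff_derivable[]. Qed.

Lemma cdiff_cont f z d : cdiff f z d -> forall e : R, 0 < e -> exists2 del : R, 0 < del &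
  forall h, normc h < del -> normc (f (z + h) - f z) <= e.
Proof.
move=> /(_ 1 ltr01)[del del0 H] e e0.
have d1 : 0 < normc d + 1 by rewrite ltr_wpDl// normc_ge0.
exists (Num.min del (e / (normc d + 1))); first by rewrite lt_min del0 divr_gt0.
move=> h; rewrite lt_min ltr_pdivlMr// => /andP[/H h1 h2].
rewrite -[f _ - f z](subrK (d * h)) (le_trans (normcD _ _))//.
rewrite ComplexField.Normc.normcM; lra.
Qed.

Lemma cdiff_cst k z : cdiff (fun=> k) z 0.
Proof.
move=> e e0; exists 1 => // h _.
by rewrite subrr mul0r subrr ComplexField.Normc.normc0 mulr_ge0 ?normc_ge0// ltW.
Qed.

Lemma cdiff_id z : cdiff id z 1.
Proof.
move=> e e0; exists 1 => // h _.
by rewrite /= mul1r [z + h]addrC addrK subrr ComplexField.Normc.normc0 mulr_ge0 ?normc_ge0// ltW.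
Qed.

Lemma cdiffD f g z df dg : cdiff f z df -> cdiff g z dg ->
  cdiff (fun w => f w + g w) z (df + dg).
Proof.
move=> Hf Hg e e0; have e2 : 0 < e / 2 by rewrite divr_gt0.
have [d1 d10 {}Hf] := Hf _ e2; have [d2 d20 {}Hg] := Hg _ e2.
exists (Num.min d1 d2); first by rewrite lt_min d10.
move=> h; rewrite lt_min => /andP[/Hf h1 /Hg h2].
have -> : f (z + h) + g (z + h) - (f z + g z) - (df + dg) * h =
  (f (z + h) - f z - df * h) + (g (z + h) - g z - dg * h) by ring.
by rewrite (le_trans (normcD _ _))//; lra.
Qed.

Lemma cdiffM f g z df dg : cdiff f z df -> cdiff g z dg ->
  cdiff (fun w => f w * g w) z (df * g z + f z * dg).
Proof.
move=> Hf Hg e e0.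
set A := normc (f z) + 1; set B := normc (g z) + 1; set D := normc df + 1.
have A0 : 0 < A by rewrite ltr_wpDl// normc_ge0.
have B0 : 0 < B by rewrite ltr_wpDl// normc_ge0.
have D0 : 0 < D by rewrite ltr_wpDl// normc_ge0.
have [d1 d10 Hf1] := Hf (e / 3 / B) (ltac:(by rewrite !divr_gt0)).
have [d2 d20 Hg1] := Hg (e / 3 / A) (ltac:(by rewrite !divr_gt0)).
have [d3 d30 Hg2] := cdiff_cont Hg (e := e / 3 / D) (ltac:(by rewrite !divr_gt0)).
have [d4 d40 Hf2] := Hf 1 ltr01.
exists (Num.min (Num.min d1 d2) (Num.min d3 d4)); first by rewrite !lt_min d10 d20 d30.
move=> h; rewrite !lt_min => /andP[/andP[/Hf1 h1 /Hg1 h2] /andP[/Hg2 h3 /Hf2 h4]].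
have -> : f (z + h) * g (z + h) - f z * g z - (df * g z + f z * dg) * h =
  (f (z + h) - f z - df * h) * g z + f z * (g (z + h) - g z - dg * h) +
  (f (z + h) - f z) * (g (z + h) - g z) by ring.
have h5 : normc (f (z + h) - f z) <= D * normc h.
  rewrite -[f (z + h) - f z](subrK (df * h)) (le_trans (normcD _ _))//.
  by rewrite ComplexField.Normc.normcM /D; lra.
rewrite (le_trans (normcD _ _))// -[e](_ : e / 3 + e / 3 + e / 3 = e); last by lra.
rewrite [leRHS]mulrDl lerD//.
  rewrite [leRHS]mulrDl (le_trans (normcD _ _))// !ComplexField.Normc.normcM lerD//.
    apply: (@le_trans _ _ (e / 3 / B * normc h * B)).
      by rewrite ler_pM ?normc_ge0// /B lerDl.
    by rewrite mulrAC divfK// gt_eqF.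
  apply: (@le_trans _ _ (A * (e / 3 / A * normc h))).
    by rewrite ler_pM ?normc_ge0// /A lerDl.
  by rewrite mulrA (mulrC A) divfK ?gt_eqF.
rewrite ComplexField.Normc.normcM.
apply: (@le_trans _ _ (D * normc h * (e / 3 / D))).
  by rewrite ler_pM ?normc_ge0.
by rewrite mulrC mulrA divfK ?gt_eqF.
Qed.

Lemma cdiff_geom (c z : R[i]) : 1 - c * z != 0 ->
  cdiff (fun w => (1 - c * w)^-1) z (c / (1 - c * z) ^+ 2).
Proof.
move=> nz e e0; set m := normc (1 - c * z).
have m0 : 0 < m by rewrite normc_gt0.
set k := normc c + 1; have k0 : 0 < k by rewrite ltr_wpDl// normc_ge0.
(* The first bound keeps [|1 - c (z + h)|] above [m / 2]; the second then makes the exact remainder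
   [(c h)^2 / ((1 - c z)^2 (1 - c (z + h)))] at most [e |h|]. *)
exists (Num.min (m / 2 / k) (e * (m ^+ 2 * (m / 2)) / k ^+ 2)).
  by rewrite lt_min !divr_gt0 ?mulr_gt0 ?exprn_gt0 ?divr_gt0.
move=> h; rewrite lt_min => /andP[]; rewrite !ltr_pdivlMr ?exprn_gt0// => h1 h2.
have ck : normc (c * h) <= normc h * k.
  by rewrite ComplexField.Normc.normcM mulrC ler_wpM2l ?normc_ge0// lerDl.
have m2 : m / 2 <= normc (1 - c * (z + h)).
  rewrite mulrDr opprD addrA; apply: le_trans (normc_triangle _ _).
  by rewrite -/m; lra.
have nzh : 1 - c * (z + h) != 0.
  by rewrite -normc_gt0; apply: lt_le_trans m2; rewrite divr_gt0.
have -> : (1 - c * (z + h))^-1 - (1 - c * z)^-1 - c / (1 - c * z) ^+ 2 * h =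
    (c * h) ^+ 2 / ((1 - c * z) ^+ 2 * (1 - c * (z + h))) by field; apply/andP.
rewrite !(ComplexField.Normc.normcM, ComplexField.Normc.normcV) -/m.
rewrite -expr2 ler_pdivrMr; last first.
  by rewrite !mulr_gt0// (lt_le_trans _ m2) ?divr_gt0.
apply: (@le_trans _ _ (normc h * (normc h * k ^+ 2))).
  have : (normc c * normc h) ^+ 2 <= (normc h * k) ^+ 2.
    by rewrite ler_sqr ?nnegrE ?mulr_ge0 ?normc_ge0 -?ComplexField.Normc.normcM ?(ltW k0).
  by rewrite !exprMn => /le_trans; apply; rewrite expr2 mulrA.
rewrite [leRHS]mulrAC [leLHS]mulrC ler_wpM2r ?normc_ge0//.
apply: le_trans (ltW h2) _; rewrite ler_wpM2l ?(ltW e0)//.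
by rewrite expr2 ler_wpM2l// mulr_ge0 ?normc_ge0.
Qed.

Lemma normc_circle r (t : R) : normc (circle_pt r t) = `|r|.
Proof.
rewrite /= !exprMn -mulrDr cos2Dsin2 mulr1; exact: sqrtr_sqr.
Qed.

Lemma circle_ptD2pi r (t : R) : circle_pt r (t + 2 * pi) = circle_pt r t.
Proof. by rewrite /circle_pt mulr_natl cosD2pi sinD2pi. Qed.

Lemma circle_pt_2pi (r : R) : circle_pt r (2 * pi) = circle_pt r 0.
Proof. by rewrite -(circle_ptD2pi r 0) add0r. Qed.

Lemma circle_pt_real (r t : R) : circle_pt r t = r%:C * circle_pt 1 t.
Proof. by rewrite /circle_pt; apply/eqP; rewrite eq_complex /= !mul1r !mul0r subr0 addr0 !eqxx. Qed.

End complex_derivative.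

(** * Complex-valued paths *)

Section complex_paths.
Local Open Scope complex_scope.
Context {R : realType}.
Implicit Types (f g : R[i] -> R[i]) (z w d : R[i]) (h k : R -> R[i]) (a b : R).

Definition ccont_on h a b :=
  cont_on (fun t => complex.Re (h t)) a b /\ cont_on (fun t => complex.Im (h t)) a b.

Lemma ReD z w : complex.Re (z + w) = complex.Re z + complex.Re w.
Proof. by case: z; case: w. Qed.

Lemma ImD z w : complex.Im (z + w) = complex.Im z + complex.Im w.
Proof. by case: z; case: w. Qed.

Lemma ReN z : complex.Re (- z) = - complex.Re z.
Proof. by case: z. Qed.

Lemma ImN z : complex.Im (- z) = - complex.Im z.
Proof. by case: z. Qed.

Lemma ReB z w : complex.Re (z - w) = complex.Re z - complex.Re w.
Proof. by case: z; case: w. Qed.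

Lemma ImB z w : complex.Im (z - w) = complex.Im z - complex.Im w.
Proof. by case: z; case: w. Qed.

Lemma ReM z w : complex.Re (z * w) =
  complex.Re z * complex.Re w - complex.Im z * complex.Im w.
Proof. by case: z; case: w. Qed.

Lemma ImM z w : complex.Im (z * w) =
  complex.Re z * complex.Im w + complex.Im z * complex.Re w.
Proof. by case: z => ? ?; case: w => ? ? /=; ring. Qed.

Lemma complex_eq z w : complex.Re z = complex.Re w -> complex.Im z = complex.Im w -> z = w.
Proof. by case: z => ? ?; case: w => ? ? /= -> ->. Qed.

Lemma ccont_onP h a b : ccont_on h a b <-> forall t, a <= t <= b ->
  forall e, 0 < e -> exists2 del, 0 < del &
    forall s, `|s - t| < del -> normc (h s - h t) <= e.
Proof.
split=> [[h1 h2] t tab e e0|H].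
  have e2 : 0 < e / 2 by rewrite divr_gt0.
  have /cvgrPdist_le/(_ _ e2)/nbhs_normP[d1 /= d10 H1] := h1 t tab.
  have /cvgrPdist_le/(_ _ e2)/nbhs_normP[d2 /= d20 H2] := h2 t tab.
  exists (Num.min d1 d2); first by rewrite lt_min d10.
  move=> s; rewrite lt_min distrC => /andP[/H1 /= s1 /H2 /= s2].
  rewrite (le_trans (normc_le_ReIm _))// ReB ImB distrC.
  by rewrite [X in _ + X]distrC; lra.
split=> t tab; apply/cvgrPdist_le => e e0; have [del del0 D] := H t tab e e0;
  apply/nbhs_normP; exists del => //= s; rewrite /ball_ /= distrC => /D;
  rewrite distrC; apply: le_trans.
- by rewrite -ReB ler_Re_normc.
- by rewrite -ImB ler_Im_normc.
Qed.

Lemma ccont_onD h k a b : ccont_on h a b -> ccont_on k a b ->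
  ccont_on (fun t => h t + k t) a b.
Proof.
move=> [h1 h2] [k1 k2]; split.
  rewrite (_ : (fun t => _) = (fun t => complex.Re (h t) + complex.Re (k t))).
    exact: cont_onD.
  by apply/funext => t; rewrite ReD.
rewrite (_ : (fun t => _) = (fun t => complex.Im (h t) + complex.Im (k t))).
  exact: cont_onD.
by apply/funext => t; rewrite ImD.
Qed.

Lemma ccont_onM h k a b : ccont_on h a b -> ccont_on k a b ->
  ccont_on (fun t => h t * k t) a b.
Proof.
move=> [h1 h2] [k1 k2]; split.
  rewrite (_ : (fun t => _) = (fun t => complex.Re (h t) * complex.Re (k t) -
      complex.Im (h t) * complex.Im (k t))).
    by apply: cont_onB; exact: cont_onM.
  by apply/funext => t; rewrite ReM.
rewrite (_ : (fun t => _) = (fun t => complex.Re (h t) * complex.Im (k t) +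
    complex.Im (h t) * complex.Re (k t))).
  by apply: cont_onD; exact: cont_onM.
by apply/funext => t; rewrite ImM.
Qed.

Lemma ccont_on_cst z a b : ccont_on (fun=> z) a b.
Proof. by split; exact: cont_on_cst. Qed.

Lemma ccont_on_real (u : R -> R) a b : cont_on u a b -> ccont_on (fun t => (u t)%:C) a b.
Proof. by move=> uc; split => //; exact: cont_on_cst. Qed.

Lemma ccont_on_comp f (f' : R[i] -> R[i]) h a b : ccont_on h a b ->
  (forall t, a <= t <= b -> cdiff f (h t) (f' (h t))) -> ccont_on (fun t => f (h t)) a b.
Proof.
move=> /ccont_onP hc df; apply/ccont_onP => t tab e e0.
have [d1 d10 H1] := cdiff_cont (df t tab) e0.
have [d2 d20 H2] := hc t tab (d1 / 2) (ltac:(by rewrite divr_gt0)).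
exists d2 => // s /H2 st; rewrite -[h s](subrK (h t)) [_ - _ + _]addrC.
by apply: H1; lra.
Qed.

Lemma ccont_on_normc h a b : ccont_on h a b -> cont_on (fun t => normc (h t)) a b.
Proof.
move=> /ccont_onP hc t tab; apply/cvgrPdist_le => e e0.
have [d d0 H] := hc t tab e e0; apply/nbhs_normP; exists d => //= s.
rewrite /ball_ /= distrC => /H; apply: le_trans; rewrite distrC ler_norml.
rewrite normc_triangle andbT lerNl opprB.
by rewrite -(normcN (h s - h t)) opprB normc_triangle.
Qed.

Lemma ccont_on_circle r a b : ccont_on (circle_pt r) a b.
Proof.
split=> t _; apply: cvgM; try exact: cvg_cst.
  exact: continuous_cos.
exact: continuous_sin.
Qed.

Definition cintg h a b : R[i] :=
  intg (fun t => complex.Re (h t)) a b +i* intg (fun t => complex.Im (h t)) a b.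

Lemma cintegralE h a b : cintegral a b h = cintg h a b.
Proof. by rewrite /cintegral !intgE. Qed.

Lemma eq_cintg h k a b : (forall t, a <= t <= b -> h t = k t) -> cintg h a b = cintg k a b.
Proof.
by move=> hk; rewrite /cintg; congr (_ +i* _); apply: eq_intg => t /hk ->.
Qed.

Lemma cintgD h k a b : ccont_on h a b -> ccont_on k a b ->
  cintg (fun t => h t + k t) a b = cintg h a b + cintg k a b.
Proof.
move=> [h1 h2] [k1 k2]; apply: complex_eq => /=; rewrite -intgD//;
  by apply: eq_intg => t _; rewrite ?ReD ?ImD.
Qed.

Lemma cintgZ z h a b : ccont_on h a b -> cintg (fun t => z * h t) a b = z * cintg h a b.
Proof.
move=> [h1 h2].
have cZ (c : R) u : cont_on u a b -> cont_on (fun t => c * u t) a b.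
  by move=> uc; apply: cont_onM => //; exact: cont_on_cst.
apply: complex_eq; rewrite ?ReM ?ImM /= -!intgZ//.
  by rewrite -intgB; [apply: eq_intg => t _; rewrite ReM|exact: cZ|exact: cZ].
by rewrite -intgD; [apply: eq_intg => t _; rewrite ImM|exact: cZ|exact: cZ].
Qed.

Lemma cintgB h k a b : ccont_on h a b -> ccont_on k a b ->
  cintg (fun t => h t - k t) a b = cintg h a b - cintg k a b.
Proof.
move=> [h1 h2] [k1 k2]; apply: complex_eq => /=; rewrite -intgB//;
  by apply: eq_intg => t _; rewrite ?ReB ?ImB.
Qed.

(* The factor 2 is not sharp, but it spares the rotation of the integral onto the real axis. *)
Lemma normc_cintg h a b : ccont_on h a b ->
  normc (cintg h a b) <= 2 * intg (fun t => normc (h t)) a b.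
Proof.
move=> hc; have [h1 h2] := hc; have hn := ccont_on_normc hc.
apply: le_trans (normc_le_ReIm _) _ => /=.
rewrite mulr2n mulrDl mul1r lerD//; apply: le_trans (le_norm_intg _) _ => //.
  by apply: le_intg => // [|t _]; [exact: cont_on_norm|exact: ler_Re_normc].
by apply: le_intg => // [|t _]; [exact: cont_on_norm|exact: ler_Im_normc].
Qed.

Lemma normc_cintg_bound h a b M : a <= b -> ccont_on h a b ->
  (forall t, a <= t <= b -> normc (h t) <= M) ->
  normc (cintg h a b) <= 2 * M * (b - a).
Proof.
move=> ab hc hM; apply: le_trans (normc_cintg hc) _.
by rewrite -mulrA ler_wpM2l//; apply: intg_ub => //; exact: ccont_on_normc.
Qed.

(** Kept as a pair of real statements because [green_eq] is applied to the real and the imaginary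
    part separately. *)
Definition cfd (F : R -> R -> R[i]) x y (Fx Fy : R[i]) :=
  fd (fun s t => complex.Re (F s t)) x y (complex.Re Fx) (complex.Re Fy) /\
  fd (fun s t => complex.Im (F s t)) x y (complex.Im Fx) (complex.Im Fy).

Lemma cfdP F x y Fx Fy : cfd F x y Fx Fy <->
  forall e, 0 < e -> exists2 d, 0 < d & forall h k : R, `|h| < d -> `|k| < d ->
  normc (F (x + h) (y + k) - F x y - (Fx * h%:C + Fy * k%:C)) <= e * (`|h| + `|k|).
Proof.
have ReE (h k : R) : complex.Re (F (x + h) (y + k) - F x y - (Fx * h%:C + Fy * k%:C)) =
  complex.Re (F (x + h) (y + k)) - complex.Re (F x y) -
    (complex.Re Fx * h + complex.Re Fy * k).
  by rewrite !(ReN, ReD, ReM) /=; ring.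
have ImE (h k : R) : complex.Im (F (x + h) (y + k) - F x y - (Fx * h%:C + Fy * k%:C)) =
  complex.Im (F (x + h) (y + k)) - complex.Im (F x y) -
    (complex.Im Fx * h + complex.Im Fy * k).
  by rewrite !(ImN, ImD, ImM) /=; ring.
split=> [[/fdP F1 /fdP F2] e e0|H].
  have e2 : 0 < e / 2 by rewrite divr_gt0.
  have [d1 d10 {}F1] := F1 _ e2; have [d2 d20 {}F2] := F2 _ e2.
  exists (Num.min d1 d2); first by rewrite lt_min d10.
  move=> h k; rewrite !lt_min => /andP[h1 h2] /andP[k1 k2].
  apply: le_trans (normc_le_ReIm _) _; rewrite ReE ImE.
  have := F1 h k h1 k1; have := F2 h k h2 k2; lra.
split; apply/fdP => e /H[d d0 {}H]; exists d => // h k hd kd;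
  apply: le_trans (H h k hd kd).
- by rewrite -ReE ler_Re_normc.
- by rewrite -ImE ler_Im_normc.
Qed.

Lemma cfd_eq F x y Fx Fy Gx Gy : cfd F x y Fx Fy -> Fx = Gx -> Fy = Gy -> cfd F x y Gx Gy.
Proof. by move=> ? <- <-. Qed.

Lemma cfdM F G x y Fx Fy Gx Gy : cfd F x y Fx Fy -> cfd G x y Gx Gy ->
  cfd (fun s t => F s t * G s t) x y (Fx * G x y + F x y * Gx) (Fy * G x y + F x y * Gy).
Proof.
move=> [F1 F2] [G1 G2]; split.
  have := fdD (fdM F1 G1) (fdM (fd_cst (-1) x y) (fdM F2 G2)).
  rewrite (_ : (fun s t => _) = (fun s t => complex.Re (F s t * G s t))); last first.
    by apply/funext => s; apply/funext => t; rewrite ReM mulN1r.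
  by move=> /fd_eq; apply; rewrite !(ReD, ReM); ring.
have := fdD (fdM F1 G2) (fdM F2 G1).
rewrite (_ : (fun s t => _) = (fun s t => complex.Im (F s t * G s t))); last first.
  by apply/funext => s; apply/funext => t; rewrite ImM.
by move=> /fd_eq; apply; rewrite !(ImD, ImM); ring.
Qed.

Lemma cfd_cst z x y : cfd (fun _ _ => z) x y 0 0.
Proof. by split; exact: fd_cst. Qed.

Lemma cfd_real (u : R -> R -> R) x y ux uy : fd u x y ux uy ->
  cfd (fun s t => (u s t)%:C) x y ux%:C uy%:C.
Proof. by move=> du; split => //=; exact: fd_cst. Qed.

Lemma cfdD F G x y Fx Fy Gx Gy : cfd F x y Fx Fy -> cfd G x y Gx Gy ->
  cfd (fun s t => F s t + G s t) x y (Fx + Gx) (Fy + Gy).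
Proof.
move=> [F1 F2] [G1 G2]; split.
  have := fdD F1 G1.
  rewrite (_ : (fun s t => _) = (fun s t => complex.Re (F s t + G s t))).
    by move=> /fd_eq; apply; rewrite ReD.
  by apply/funext => s; apply/funext => t; rewrite ReD.
have := fdD F2 G2.
rewrite (_ : (fun s t => _) = (fun s t => complex.Im (F s t + G s t))).
  by move=> /fd_eq; apply; rewrite ImD.
by apply/funext => s; apply/funext => t; rewrite ImD.
Qed.

Lemma cfd_comp f F x y d Fx Fy : cfd F x y Fx Fy -> cdiff f (F x y) d ->
  cfd (fun s t => f (F s t)) x y (d * Fx) (d * Fy).
Proof.
move=> /cfdP dF df; apply/cfdP => e e0.
set L := normc Fx + normc Fy + 1; set D := normc d + 1.
have Fx0 := normc_ge0 Fx; have Fy0 := normc_ge0 Fy; have dd0 := normc_ge0 d.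
have L0 : 0 < L by rewrite /L; lra.
have D0 : 0 < D by rewrite /D; lra.
have eL : 0 < e / 2 / L by rewrite !divr_gt0.
have eD : 0 < e / 2 / D by rewrite !divr_gt0.
have [d1 d10 {}df] := df _ eL.
have [d2 d20 F1] := dF _ eD; have [d3 d30 F2] := dF 1 ltr01.
exists (Num.min (d1 / 2 / L) (Num.min d2 d3)).
  by rewrite !lt_min d20 d30 !divr_gt0.
move=> h k; rewrite !lt_min => /and3P[h1 h2 h3] /and3P[k1 k2 k3].
have {F1} := F1 h k h2 k2; have {F2} := F2 h k h3 k3.
move: h1 k1; rewrite !ltr_pdivlMr// => h1 k1.
set u := F (x + h) (y + k) - F x y; set l := Fx * h%:C + Fy * k%:C => F2 F1.
have lb : normc l <= (normc Fx + normc Fy) * (`|h| + `|k|).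
  rewrite /l (le_trans (normcD _ _))// !ComplexField.Normc.normcM !normc_real.
  have := normr_ge0 h; have := normr_ge0 k; nra.
have ub : normc u <= L * (`|h| + `|k|).
  by rewrite -[u](subrK l) (le_trans (normcD _ _))// /L; lra.
have {}df := df u (ltac:(lra)).
have -> : F (x + h) (y + k) = F x y + u by rewrite /u [RHS]addrC subrK.
have -> : f (F x y + u) - f (F x y) - (d * Fx * h%:C + d * Fy * k%:C) =
   (f (F x y + u) - f (F x y) - d * u) + d * (u - l) by rewrite /l; ring.
rewrite (le_trans (normcD _ _))// ComplexField.Normc.normcM.
have hk : 0 <= `|h| + `|k| by rewrite addr_ge0.
have s1 : e / 2 / L * normc u <= e / 2 * (`|h| + `|k|).
  apply: (@le_trans _ _ (e / 2 / L * (L * (`|h| + `|k|)))).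
    by rewrite ler_wpM2l// ltW.
  by rewrite mulrA divfK ?gt_eqF.
have s2 : normc d * normc (u - l) <= e / 2 * (`|h| + `|k|).
  apply: (@le_trans _ _ (D * (e / 2 / D * (`|h| + `|k|)))).
    by apply: ler_pM; rewrite ?normc_ge0// /D lerDl.
  by rewrite mulrA (mulrC D) divfK ?gt_eqF.
have -> : e * (`|h| + `|k|) = e / 2 * (`|h| + `|k|) + e / 2 * (`|h| + `|k|) by lra.
by rewrite lerD// (le_trans df).
Qed.

Lemma is_derive_cos_scale r (t : R) : is_derive t 1 (fun s => r * cos s) (- (r * sin t)).
Proof.
have : is_derive t 1 (r *: (@cos R)) (r *: - sin t) by apply: is_deriveZ.
by rewrite /GRing.scale /= mulrN.
Qed.

Lemma is_derive_sin_scale r (t : R) : is_derive t 1 (fun s => r * sin s) (r * cos t).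
Proof.
by have : is_derive t 1 (r *: (@sin R)) (r *: cos t) by apply: is_deriveZ.
Qed.

Lemma cfd_circle r x y : cfd (fun _ t => circle_pt r t) x y 0 ('i * circle_pt r y).
Proof.
split.
  apply: fd_eq (fd_snd x (is_derive_cos_scale r y)) _ _ => //=; ring.
apply: fd_eq (fd_snd x (is_derive_sin_scale r y)) _ _ => //=; ring.
Qed.

End complex_paths.

(** * Cauchy's formula *)

Section cauchy.
Local Open Scope complex_scope.
Context {R : realType}.
Implicit Types (f g : R[i] -> R[i]) (z w d : R[i]) (h k : R -> R[i]) (a b r t : R).

Lemma cfd_conj F x y (Fx Fy : R[i]) : cfd F x y Fx Fy ->
  cfd (fun s t => (F s t)^*) x y Fx^* Fy^*.
Proof.
move=> [F1 F2]; split.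
  rewrite (_ : (fun s t => complex.Re (F s t)^*) = (fun s t => complex.Re (F s t))).
    by apply: fd_eq F1 _ _; [case: (Fx)|case: (Fy)].
  by apply/funext => s; apply/funext => t; case: (F s t).
rewrite (_ : (fun s t => complex.Im (F s t)^*) = (fun s t => -1 * complex.Im (F s t))).
  by apply: fd_eq (fdM (fd_cst (-1) x y) F2) _ _; [case: (Fx)|case: (Fy)] => ? ? /=; ring.
by apply/funext => s; apply/funext => t; case: (F s t) => ? ? /=; ring.
Qed.

Lemma ccont_on_conj h a b : ccont_on h a b -> ccont_on (fun t => (h t)^*) a b.
Proof.
move=> [h1 h2]; split.
  by rewrite (_ : (fun t => _) = (fun t => complex.Re (h t)))//; apply/funext => t; case: (h t).
rewrite (_ : (fun t => _) = (fun t => - complex.Im (h t))); first exact: cont_onN.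
by apply/funext => t; case: (h t).
Qed.

Lemma cintg_conj h a b : ccont_on h a b -> cintg (fun t => (h t)^*) a b = (cintg h a b)^*.
Proof.
move=> [h1 h2]; apply: complex_eq => /=.
  by apply: eq_intg => t _; case: (h t).
by rewrite -intgN//; apply: eq_intg => t _; case: (h t).
Qed.

Lemma cintg_cst z a b : a <= b -> cintg (fun=> z) a b = (b - a)%:C * z.
Proof.
by case: z => x y ab; apply: complex_eq => /=; rewrite intg_cst//=; ring.
Qed.

Lemma normc_conj z : normc z^* = normc z.
Proof. by case: z => a b /=; rewrite sqrrN. Qed.

Lemma ltr0_2pi : 0 < 2 * pi :> R.
Proof. by rewrite mulr_gt0 ?pi_gt0. Qed.

Lemma circle_pt_inv r t : r != 0 -> circle_pt r t * (circle_pt r^-1 t)^* = 1.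
Proof.
move=> r0; apply: complex_eq => /=.
  rewrite mulrN opprK !mulrA ![r * _ * r^-1]mulrAC divff// !mul1r -!expr2.
  exact: cos2Dsin2.
by rewrite mulrN !mulrA ![r * _ * r^-1]mulrAC divff// !mul1r mulrC addNr.
Qed.

(* With [zeta = circle_pt r t], this is [zeta / (zeta - z)]. *)
Definition ckernel z r t : R[i] := (1 - z * (circle_pt r^-1 t)^*)^-1.

Lemma ckernel_den z r t : normc z < r -> 1 - normc z / r <= normc (1 - z * (circle_pt r^-1 t)^*).
Proof.
move=> zr; have r0 : 0 < r := le_lt_trans (normc_ge0 z) zr.
apply: le_trans (normc_triangle _ _).
rewrite ComplexField.Normc.normcM normc_conj normc_circle ger0_norm ?invr_ge0 ?(ltW r0)//.
by rewrite ComplexField.Normc.normc1.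
Qed.

Lemma ckernel_den_gt0 z r : normc z < r -> 0 < 1 - normc z / r.
Proof.
move=> zr; have r0 : 0 < r := le_lt_trans (normc_ge0 z) zr.
by rewrite subr_gt0 ltr_pdivrMr// mul1r.
Qed.

Lemma ckernel_neq0 z r t : normc z < r -> 1 - z * (circle_pt r^-1 t)^* != 0.
Proof.
move=> zr; rewrite -normc_gt0 (lt_le_trans (ckernel_den_gt0 zr))//.
exact: ckernel_den.
Qed.

Lemma normc_ckernel z r t : normc z < r -> normc (ckernel z r t) <= (1 - normc z / r)^-1.
Proof.
move=> zr; rewrite ComplexField.Normc.normcV lef_pV2 ?posrE ?ckernel_den_gt0//.
  exact: ckernel_den.
by rewrite normc_gt0 ckernel_neq0.
Qed.

Lemma ccont_ckernel z r a b : normc z < r -> ccont_on (ckernel z r) a b.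
Proof.
move=> zr; apply: (@ccont_on_comp _ (fun w => (1 - z * w)^-1)
   (fun w => z / (1 - z * w) ^+ 2) (fun t => (circle_pt r^-1 t)^*)).
  exact/ccont_on_conj/ccont_on_circle.
by move=> t _; apply: cdiff_geom; exact: ckernel_neq0.
Qed.

(* [P dl + Q dt] is the pull-back of [f(w) / (w - z) dw], up to a constant, under the contraction
   [zeta] of the circle to [z]. Bisection needs no continuity of its derivative. *)
Lemma cauchy_aux f (f' : R[i] -> R[i]) z r : normc z < r ->
  (forall w, normc w <= r -> cdiff f w (f' w)) ->
  cintg (fun t => f (circle_pt r t) * ckernel z r t) 0 (2 * pi) =
  f z * cintg (ckernel z r) 0 (2 * pi).
Proof.
move=> zr df; have r0 : 0 < r := le_lt_trans (normc_ge0 z) zr.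
have pi0 := ltr0_2pi.
pose zeta (l t : R) := z + l%:C * (circle_pt r t - z).
have zeta_r l t : 0 <= l <= 1 -> normc (zeta l t) <= r.
  move=> /andP[l0 l1].
  have -> : zeta l t = (1 - l)%:C * z + l%:C * circle_pt r t.
    by rewrite /zeta rmorphB /=; ring.
  rewrite (le_trans (normcD _ _))// !ComplexField.Normc.normcM !normc_real normc_circle.
  rewrite !ger0_norm ?subr_ge0 ?(ltW r0)//; nra.
have dzeta l t : cfd zeta l t (circle_pt r t - z) (l%:C * ('i * circle_pt r t)).
  have dl : cfd (fun s _ : R => s%:C) l t 1 0.
    by apply: cfd_eq (cfd_real (fd_fst t (is_derive_id l 1))) _ _.
  have := cfdD (cfd_cst z l t) (cfdM dl (cfdD (cfd_circle r l t) (cfd_cst (- z) l t))).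
  by move=> /cfd_eq; apply; ring.
have df' l t : 0 <= l <= 1 -> cfd (fun s u => f (zeta s u)) l t
    (f' (zeta l t) * (circle_pt r t - z)) (f' (zeta l t) * (l%:C * ('i * circle_pt r t))).
  by move=> l01; apply: cfd_comp => //; apply: df; exact: zeta_r.
have dker l t : exists D, cfd (fun _ u => ckernel z r u) l t 0 D.
  have := cfd_comp (cfd_conj (cfd_circle r^-1 l t)) (cdiff_geom (ckernel_neq0 t zr)).
  by move=> dK; eexists; apply: (cfd_eq dK) => //; rewrite rmorph0 mulr0.
have cz l a b : 0 <= l <= 1 -> ccont_on (fun t => f (zeta l t)) a b.
  by move=> l01; split=> t _; [apply: (fd_cont_snd (df' l t l01).1)|
    apply: (fd_cont_snd (df' l t l01).2)].
have cQ l a b : 0 <= l <= 1 -> ccont_on (fun t => f (zeta l t) * ckernel z r t) a b.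
  by move=> l01; apply: ccont_onM; [exact: cz|exact: ccont_ckernel].
have invariant l : 0 < l <= 1 ->
    cintg (fun t => f (zeta 1 t) * ckernel z r t) 0 (2 * pi) =
    cintg (fun t => f (zeta l t) * ckernel z r t) 0 (2 * pi).
  move=> /andP[l0 l1].
  pose P (s t : R) := (- 'i * (s `^ (-1))%:C) * f (zeta s t).
  pose Q (s t : R) := f (zeta s t) * ckernel z r t.
  have H s t : l <= s <= 1 -> exists Px D Qy, cfd P s t Px D /\ cfd Q s t D Qy.
    move=> /andP[ls s1]; have s0 : 0 < s := lt_le_trans l0 ls.
    have s01 : 0 <= s <= 1 by rewrite ltW.
    have dV := is_derive1_powR (-1) s0.
    have dP := cfdM (cfdM (cfd_cst (- 'i) s t) (cfd_real (fd_fst t dV))) (df' s t s01).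
    have [D dD] := dker s t; have dQ := cfdM (df' s t s01) dD.
    do 3 eexists; split; first exact: dP.
    apply: cfd_eq dQ _ erefl; rewrite mulr0 addr0 mul0r mulr0 addr0 mul0r add0r.
    (* The last factor is the inverse of the kernel, so both mixed derivatives become the value of
       [f'] at [zeta] times the point of the circle. *)
    have -> : circle_pt r t - z = circle_pt r t * (1 - z * (circle_pt r^-1 t)^*).
      by rewrite mulrBr mulr1 mulrCA circle_pt_inv ?gt_eqF// mulr1.
    rewrite /ckernel -!mulrA mulfV ?ckernel_neq0// mulr1.
    have e1 : (s `^ (-1))%:C * s%:C = 1.
      by rewrite powR_inv1 ?(ltW s0)// -rmorphM /= mulVf ?gt_eqF.
    have e2 : 'i * 'i = -1 :> R[i] by apply: complex_eq => /=; ring.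
    transitivity (- ('i * 'i) * ((s `^ (-1))%:C * s%:C) * (f' (zeta s t) * circle_pt r t)).
      by rewrite e1 e2; ring.
    by ring.
  (* The sides [t = 0] and [t = 2 pi] carry the same values of [P], so only the two closed curves
     [s = l] and [s = 1] remain in Green's formula. *)
  have Pper s : P s 0 = P s (2 * pi) by rewrite /P /zeta circle_pt_2pi.
  have i0 (u : R -> R) : intg (fun s => u s - u s) l 1 = 0.
    rewrite (_ : (fun s => _) = (fun=> 0)); last by apply/funext => s; rewrite subrr.
    by rewrite intg_cst// mul0r.
  have [Q11 Q12] := cQ 1 0 (2 * pi) ltac:(by rewrite ler01 lexx).
  have [Q21 Q22] := cQ l 0 (2 * pi) ltac:(by rewrite ltW).
  apply: complex_eq; apply/eqP; rewrite /= -subr_eq0 -intgB//.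
    have := @green_eq _ (fun s t => complex.Re (P s t)) (fun s t => complex.Re (Q s t))
      l 1 0 (2 * pi) l1 (ltW pi0).
    rewrite (_ : (fun x => complex.Re (P x 0) - _) =
      (fun x => complex.Re (P x 0) - complex.Re (P x 0))); last first.
      by apply/funext => s; rewrite -Pper.
    rewrite i0 add0r => -> // s t ls _; have [Px [D [Qy [[dP _] [dQ _]]]]] := H s t ls.
    by do 3 eexists; split; [exact: dP|exact: dQ].
  have := @green_eq _ (fun s t => complex.Im (P s t)) (fun s t => complex.Im (Q s t))
    l 1 0 (2 * pi) l1 (ltW pi0).
  rewrite (_ : (fun x => complex.Im (P x 0) - _) =
    (fun x => complex.Im (P x 0) - complex.Im (P x 0))); last first.
    by apply/funext => s; rewrite -Pper.
  rewrite i0 add0r => -> // s t ls _; have [Px [D [Qy [[_ dP] [_ dQ]]]]] := H s t ls.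
  by do 3 eexists; split; [exact: dP|exact: dQ].
have zeta1 t : zeta 1 t = circle_pt r t by rewrite /zeta mul1r addrC subrK.
rewrite -(eq_cintg (h := fun t => f (zeta 1 t) * ckernel z r t)); last first.
  by move=> t _; rewrite zeta1.
apply/eqP; rewrite -subr_eq0 -normc_eq0 eq_le normc_ge0 andbT.
set M := (1 - normc z / r)^-1; have M0 : 0 < M by rewrite invr_gt0 ckernel_den_gt0.
apply/ler_addgt0Pr => e e0; rewrite add0r.
have K0 : 0 < 2 * M * (2 * pi) by rewrite !mulr_gt0 ?pi_gt0.
have [del del0 fc] := cdiff_cont (df z (ltW zr)) (divr_gt0 e0 K0).
(* The contracted circle lies within [2 r l <= del / 2] of [z]; the minimum with 1 keeps the
   contraction inside the disc. *)
pose l := Num.min 1 (del / (4 * r)).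
have l0 : 0 < l by rewrite lt_min ltr01 divr_gt0 ?mulr_gt0.
have l1 : l <= 1 by rewrite ge_min lexx.
have l01 : 0 <= l <= 1 by rewrite ltW.
rewrite (invariant l) ?l0// -cintgZ; last exact: ccont_ckernel.
rewrite -cintgB; [|exact: cQ|by apply: ccont_onM; [exact: ccont_on_cst|exact: ccont_ckernel]].
apply: le_trans (normc_cintg_bound (M := e / (2 * M * (2 * pi)) * M) (ltW pi0) _ _) _.
- apply: (ccont_onD (cQ _ _ _ l01)).
  rewrite (_ : (fun t => _) = (fun t => (- f z) * ckernel z r t)); last first.
    by apply/funext => t; rewrite mulNr.
  by apply: ccont_onM; [exact: ccont_on_cst|exact: ccont_ckernel].
- move=> t _; rewrite -mulrBl ComplexField.Normc.normcM ler_pM ?normc_ge0//.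
    apply: fc; rewrite ComplexField.Normc.normcM normc_real ger0_norm ?(ltW l0)//.
    have h1 : normc (circle_pt r t - z) <= 2 * r.
      by rewrite (le_trans (normcB _ _))// normc_circle ger0_norm ?(ltW r0)//; lra.
    have h2 : l * (4 * r) <= del.
      by rewrite -ler_pdivlMr ?mulr_gt0// ge_min lexx orbT.
    have := ler_wpM2l (ltW l0) h1; lra.
  exact: normc_ckernel.
rewrite subr0 le_eqVlt; apply/orP; left; apply/eqP.
transitivity (e / (2 * M * (2 * pi)) * (2 * M * (2 * pi))); first by ring.
by rewrite divfK ?gt_eqF.
Qed.

(** At the centre the kernel is the constant 1, whose integral is known outright; the kernel of a
    general point is integrated with the help of this case. *)
Lemma mean_value f (f' : R[i] -> R[i]) r : 0 < r ->
  (forall w, normc w <= r -> cdiff f w (f' w)) ->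
  cintg (fun t => f (circle_pt r t)) 0 (2 * pi) = (2 * pi)%:C * f 0.
Proof.
move=> r0 df; have := cauchy_aux (z := 0) _ df.
rewrite ComplexField.Normc.normc0 => /(_ r0).
have k1 t : ckernel 0 r t = 1 by rewrite /ckernel mul0r subr0 invr1.
rewrite (eq_cintg (k := fun t => f (circle_pt r t))); last by move=> t _; rewrite k1 mulr1.
rewrite [X in _ = _ * X](eq_cintg (k := fun=> 1)) => [->|t _]; last exact: k1.
by rewrite cintg_cst ?(ltW ltr0_2pi)// subr0 mulr1 mulrC.
Qed.

(** For [z != 0], the inverse of the point obtained from [z] by reflection in the circle of radius
    [r]. When [|z| < r], the function [1 - reflected z r * w] of [w] therefore has no zero in the
    closed disc. *)
Definition reflected z r : R[i] := z^* * (r ^- 2)%:C.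

Lemma reflected_neq0 z r w : normc z < r -> normc w <= r -> 1 - reflected z r * w != 0.
Proof.
move=> zr wr; have r0 : 0 < r := le_lt_trans (normc_ge0 z) zr.
rewrite -normc_gt0; apply: lt_le_trans (normc_triangle _ _).
rewrite ComplexField.Normc.normc1 !ComplexField.Normc.normcM normc_conj normc_real.
rewrite ger0_norm ?invr_ge0 ?sqr_ge0// subr_gt0 mulrAC ltr_pdivrMr ?exprn_gt0// mul1r.
by rewrite expr2 (@le_lt_trans _ _ (normc z * r)) ?ler_wpM2l ?normc_ge0 ?ltr_pM2r.
Qed.

(* On the circle the conjugate kernel is the boundary value of an analytic function. *)
Lemma ckernel_conj z r t : r != 0 ->
  (ckernel z r t)^* = (1 - reflected z r * circle_pt r t)^-1.
Proof.
move=> r0; rewrite /ckernel [LHS]fmorphV; congr (_^-1).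
by apply: complex_eq; rewrite /reflected; case: (z) => x y /=; field.
Qed.

(** The conjugate of the kernel extends to an analytic function of the point of the circle with
    value 1 at 0, and the mean value property applies to that extension. *)
Lemma cintg_ckernel z r : normc z < r -> cintg (ckernel z r) 0 (2 * pi) = (2 * pi)%:C.
Proof.
move=> zr; have r0 : 0 < r := le_lt_trans (normc_ge0 z) zr.
have := mean_value r0 (fun w wr => cdiff_geom (reflected_neq0 zr wr)).
rewrite mulr0 subr0 invr1 mulr1 => mv.
rewrite -[LHS]conjcK -cintg_conj; last exact: ccont_ckernel.
rewrite (eq_cintg (k := fun t => (1 - reflected z r * circle_pt r t)^-1)).
  by rewrite mv; apply: complex_eq => //=; rewrite oppr0.
by move=> t _; rewrite ckernel_conj ?gt_eqF.
Qed.

Lemma cauchy_formula f (f' : R[i] -> R[i]) z r : normc z < r ->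
  (forall w, normc w <= r -> cdiff f w (f' w)) ->
  cintg (fun t => f (circle_pt r t) * ckernel z r t) 0 (2 * pi) = (2 * pi)%:C * f z.
Proof. by move=> zr df; rewrite (cauchy_aux zr df) cintg_ckernel// mulrC. Qed.

End cauchy.

(** * Regularity of analytic functions *)

Section regularity.
Local Open Scope complex_scope.
Context {R : realType}.
Implicit Types (f g : R[i] -> R[i]) (z w d h : R[i]) (phi : R -> R[i]) (a b r t rho : R).

Lemma quadratic_cdiff f z d rho C : normc z < rho -> 0 <= C ->
  (forall h, normc (z + h) <= rho ->
    normc (f (z + h) - f z - d * h) <= C * normc h ^+ 2) -> cdiff f z d.
Proof.
move=> zr C0 H e e0; have C1 : 0 < C + 1 by lra.
exists (Num.min (rho - normc z) (e / (C + 1))).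
  by rewrite lt_min subr_gt0 zr divr_gt0.
move=> h; rewrite lt_min (ltr_pdivlMr _ _ C1) => /andP[h1 h2].
have zh : normc (z + h) <= rho by apply: le_trans (normcD z h) _; lra.
apply: le_trans (H h zh) _.
rewrite expr2 mulrA ler_wpM2r ?normc_ge0//.
have := normc_ge0 h; nra.
Qed.

(* Up to the factor [2 pi / n!], the [n]-th derivative of the Cauchy integral of [phi]. *)
Definition cpow (phi : R -> R[i]) r n z :=
  cintg (fun t => phi t * ((circle_pt r^-1 t)^* ^+ n * ckernel z r t ^+ n.+1)) 0 (2 * pi).

Lemma ccont_on_exp phi n a b : ccont_on phi a b -> ccont_on (fun t => phi t ^+ n) a b.
Proof.
move=> hc; elim: n => [|n IH]; first exact: ccont_on_cst.
rewrite (_ : (fun t => _) = (fun t => phi t * phi t ^+ n)); first exact: ccont_onM.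
by apply/funext => t; rewrite exprS.
Qed.

Lemma ccont_cpow phi r n m z : normc z < r -> ccont_on phi 0 (2 * pi) ->
  ccont_on (fun t => phi t * ((circle_pt r^-1 t)^* ^+ n * ckernel z r t ^+ m)) 0 (2 * pi).
Proof.
move=> zr phic; apply: ccont_onM => //; apply: ccont_onM; apply: ccont_on_exp.
  exact/ccont_on_conj/ccont_on_circle.
exact: ccont_ckernel.
Qed.

Lemma normc_circle_inv_conj r t : 0 < r -> normc (circle_pt r^-1 t)^* = r^-1.
Proof. by move=> r0; rewrite normc_conj normc_circle ger0_norm// invr_ge0 ltW. Qed.

Lemma normcX z n : normc (z ^+ n) = normc z ^+ n.
Proof.
elim: n => [|n IH]; first by rewrite !expr0 ComplexField.Normc.normc1.
by rewrite !exprS ComplexField.Normc.normcM IH.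
Qed.

Lemma normc_ckernel_le z r rho t : normc z <= rho -> rho < r ->
  normc (ckernel z r t) <= (1 - rho / r)^-1.
Proof.
move=> zr rr; have r0 : 0 < r by rewrite (le_lt_trans _ rr)// (le_trans _ zr)// normc_ge0.
apply: le_trans (normc_ckernel _ (le_lt_trans zr rr)) _.
have := ckernel_den_gt0 (le_lt_trans zr rr) => d0.
rewrite lef_pV2 ?posrE//.
  by rewrite lerD2l lerN2 ler_wpM2r// invr_ge0 ltW.
by rewrite subr_gt0 ltr_pdivrMr// mul1r.
Qed.

(** Exact second-order remainders of [1 / (1 - z w)] and of its derivative in [z]. They reduce
    differentiation under the integral sign to bounds on the kernel. *)
Lemma ckernel_taylor z h r t : normc z < r -> normc (z + h) < r ->
  let w := (circle_pt r^-1 t)^* in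
  let K := ckernel z r t in let L := ckernel (z + h) r t in
  L - K - w * K ^+ 2 * h = h ^+ 2 * (w ^+ 2 * (K ^+ 2 * L)) /\
  w * L ^+ 2 - w * K ^+ 2 - 2 * w ^+ 2 * K ^+ 3 * h =
    h ^+ 2 * (w ^+ 3 * (K ^+ 2 * (L * (L + 2 * K)))).
Proof.
move=> z1 z2 w K L; have := ckernel_neq0 t z1; have := ckernel_neq0 t z2.
rewrite /K /L /ckernel -/w => n2 n1.
by split; field; rewrite n1 n2.
Qed.

(** [phi] is any bounded continuous function rather than the trace of an analytic one:
    [analytic_uniform_limit] applies this to a limit whose analyticity is still to be proved. *)
Lemma cpow_taylor phi r rho : 0 <= rho -> rho < r -> ccont_on phi 0 (2 * pi) ->
  (exists B, forall t, 0 <= t <= 2 * pi -> normc (phi t) <= B) ->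
  exists2 C, 0 <= C & forall z, normc z <= rho ->
    [/\ normc (cpow phi r 0 z) <= C, normc (cpow phi r 1 z) <= C &
    forall h, normc (z + h) <= rho ->
     normc (cpow phi r 0 (z + h) - cpow phi r 0 z - cpow phi r 1 z * h) <= C * normc h ^+ 2 /\
     normc (cpow phi r 1 (z + h) - cpow phi r 1 z - 2 * cpow phi r 2 z * h) <= C * normc h ^+ 2].
Proof.
move=> rho0 rr phic [B0 phiB0].
have r0 : 0 < r := le_lt_trans rho0 rr.
pose B := Num.max B0 0; have B_ge0 : 0 <= B by rewrite le_max lexx orbT.
have phiB t : 0 <= t <= 2 * pi -> normc (phi t) <= B.
  by move=> /phiB0 h; rewrite le_max h.
pose M := Num.max 1 (1 - rho / r)^-1; pose q := Num.max 1 r^-1.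
have M1 : 1 <= M by rewrite le_max lexx.
have q1 : 1 <= q by rewrite le_max lexx.
have M0 : 0 <= M by apply: le_trans M1.
have q0 : 0 <= q by apply: le_trans q1.
have KM z t : normc z <= rho -> normc (ckernel z r t) <= M.
  by move=> zr; rewrite le_max (normc_ckernel_le _ zr rr) orbT.
have wq t : normc (circle_pt r^-1 t)^* <= q.
  by rewrite normc_circle_inv_conj// le_max lexx orbT.
(* The worst integrand is the remainder [w^3 K^2 L (L + 2 K)]; since [q] and [M] are at least 1, its
   bound [q^3 * 3 M^4] dominates the others. *)
pose D := B * (q ^+ 3 * (3 * M ^+ 4)).
have D0 : 0 <= D by rewrite !mulr_ge0 ?exprn_ge0.
have pi0 := @ltr0_2pi R.
exists (2 * D * (2 * pi - 0)).
  by rewrite subr0 mulr_ge0// ?(ltW pi0)// mulr_ge0.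
have bnd (psi : R -> R[i]) : ccont_on psi 0 (2 * pi) ->
    (forall t, 0 <= t <= 2 * pi -> normc (psi t) <= D) ->
    normc (cintg psi 0 (2 * pi)) <= 2 * D * (2 * pi - 0).
  by move=> pc pD; apply: normc_cintg_bound => //; exact: ltW.
have bnd2 (psi : R -> R[i]) h : ccont_on psi 0 (2 * pi) ->
    (forall t, 0 <= t <= 2 * pi -> normc (psi t) <= D) ->
    normc (cintg (fun t => h ^+ 2 * psi t) 0 (2 * pi)) <= 2 * D * (2 * pi - 0) * normc h ^+ 2.
  move=> pc pD; rewrite cintgZ// ComplexField.Normc.normcM normcX mulrC.
  by rewrite ler_wpM2r ?exprn_ge0 ?normc_ge0// bnd.
have powle (x : R) m n : 1 <= x -> (m <= n)%N -> x ^+ m <= x ^+ n.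
  by move=> x1 mn; rewrite ler_weXn2l.
have Ptbound t (u v : R[i]) : 0 <= t <= 2 * pi -> normc u <= q ^+ 3 -> normc v <= 3 * M ^+ 4 ->
   normc (phi t * (u * v)) <= D.
  move=> tt uq vM; rewrite !ComplexField.Normc.normcM ler_pM ?mulr_ge0 ?normc_ge0 ?phiB//.
  by rewrite ler_pM ?normc_ge0.
have wpow t n : (n <= 3)%N -> normc ((circle_pt r^-1 t)^* ^+ n) <= q ^+ 3.
  move=> n3; rewrite normcX (@le_trans _ _ (q ^+ n))//; last exact: powle.
  by rewrite lerXn2r ?nnegrE ?normc_ge0 ?wq.
have Mle (x : R) : 0 <= x -> x <= 3 * x by move=> x0; lra.
have Kpow z t n : normc z <= rho -> (n <= 4)%N -> normc (ckernel z r t ^+ n) <= 3 * M ^+ 4.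
  move=> zr n3; rewrite normcX (@le_trans _ _ (M ^+ 4))// ?Mle ?exprn_ge0//.
  rewrite (@le_trans _ _ (M ^+ n))//; last exact: powle.
  by rewrite lerXn2r ?nnegrE ?normc_ge0// KM.
move=> z zr; have zr' := le_lt_trans zr rr; split.
- apply: bnd; first exact: ccont_cpow.
  by move=> t tt; apply: Ptbound => //; [exact: wpow|exact: Kpow].
- apply: bnd; first exact: ccont_cpow.
  by move=> t tt; apply: Ptbound => //; [exact: wpow|exact: Kpow].
move=> h hr; have hr' := le_lt_trans hr rr.
have cc1 t : cont_on (fun=> (t : R)) 0 (2 * pi) by exact: cont_on_cst.
split.
  rewrite mulrC /cpow -cintgZ; last exact: ccont_cpow.
  rewrite -cintgB; [|exact: ccont_cpow..].
  rewrite -cintgB; last 2 first.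
  - rewrite (_ : (fun t => _) = (fun t => phi t * ((circle_pt r^-1 t)^* ^+ 0 *
       ckernel (z + h) r t ^+ 1) + (-1) * (phi t * ((circle_pt r^-1 t)^* ^+ 0 *
       ckernel z r t ^+ 1)))).
      by apply: ccont_onD; [|apply: ccont_onM; first exact: ccont_on_cst];
        exact: ccont_cpow.
    by apply/funext => t; rewrite mulN1r.
  - by apply: ccont_onM; [exact: ccont_on_cst|exact: ccont_cpow].
  rewrite (eq_cintg (k := fun t => h ^+ 2 * (phi t * ((circle_pt r^-1 t)^* ^+ 2 *
    (ckernel z r t ^+ 2 * ckernel (z + h) r t))))).
    apply: bnd2.
      apply: ccont_onM => //; apply: ccont_onM.
        exact/ccont_on_exp/ccont_on_conj/ccont_on_circle.
      by apply: ccont_onM; [apply: ccont_on_exp|]; exact: ccont_ckernel.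
    move=> t tt; apply: Ptbound => //; first exact: wpow.
    rewrite ComplexField.Normc.normcM normcX.
    apply: (@le_trans _ _ (M ^+ 2 * M)).
      by rewrite ler_pM ?exprn_ge0 ?normc_ge0 ?KM// lerXn2r ?nnegrE ?normc_ge0 ?KM.
    rewrite -exprSr (@le_trans _ _ (M ^+ 4))// ?powle// Mle// exprn_ge0//.
  move=> t _; have [E _] := ckernel_taylor t zr' hr'.
  rewrite [RHS]mulrCA -E expr0 expr1 !mul1r; ring.
have -> : 2 * cpow phi r 2 z * h = (2 * h) * cpow phi r 2 z by ring.
rewrite /cpow -cintgZ; last exact: ccont_cpow.
rewrite -cintgB; [|exact: ccont_cpow..].
rewrite -cintgB; last 2 first.
- rewrite (_ : (fun t => _) = (fun t => phi t * ((circle_pt r^-1 t)^* ^+ 1 *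
     ckernel (z + h) r t ^+ 2) + (-1) * (phi t * ((circle_pt r^-1 t)^* ^+ 1 *
     ckernel z r t ^+ 2)))).
    by apply: ccont_onD; [|apply: ccont_onM; first exact: ccont_on_cst];
      exact: ccont_cpow.
  by apply/funext => t; rewrite mulN1r.
- by apply: ccont_onM; [exact: ccont_on_cst|exact: ccont_cpow].
rewrite (eq_cintg (k := fun t => h ^+ 2 * (phi t * ((circle_pt r^-1 t)^* ^+ 3 *
  (ckernel z r t ^+ 2 * (ckernel (z + h) r t * (ckernel (z + h) r t + 2 * ckernel z r t))))))).
  have c2 : ccont_on (fun t => ckernel (z + h) r t + 2 * ckernel z r t) 0 (2 * pi).
    apply: ccont_onD; first exact: ccont_ckernel.
    by apply: ccont_onM; [exact: ccont_on_cst|exact: ccont_ckernel].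
  apply: bnd2.
    apply: ccont_onM => //; apply: ccont_onM.
      exact/ccont_on_exp/ccont_on_conj/ccont_on_circle.
    apply: ccont_onM; first exact/ccont_on_exp/ccont_ckernel.
    by apply: ccont_onM => //; exact: ccont_ckernel.
  move=> t tt; apply: Ptbound => //; first exact: wpow.
  rewrite ComplexField.Normc.normcM normcX ComplexField.Normc.normcM.
  apply: (@le_trans _ _ (M ^+ 2 * (M * (3 * M)))).
    rewrite ler_pM ?exprn_ge0 ?mulr_ge0 ?normc_ge0 ?KM//.
      by rewrite lerXn2r ?nnegrE ?normc_ge0 ?KM.
    rewrite ler_pM ?normc_ge0 ?KM//.
    rewrite (le_trans (normcD _ _))// ComplexField.Normc.normcM.
    have -> : normc (2 : R[i]) = 2.
      by rewrite [LHS](@normcMn R 1 2) ComplexField.Normc.normc1.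
    have := KM _ t hr; have := KM _ t zr; lra.
  by rewrite le_eqVlt; apply/orP; left; apply/eqP; ring.
move=> t _; have [_ E] := ckernel_taylor t zr' hr'.
rewrite [RHS]mulrCA -E expr1; ring.
Qed.

End regularity.

(** * Derivatives, local bounds and uniform limits of analytic functions *)

Section analytic.
Local Open Scope complex_scope.
Context {R : realType}.
Implicit Types (f g k : R[i] -> R[i]) (z w d h : R[i]) (a b r t rho : R).

Lemma ccont_on_circle_comp f r a b : analytic_on_disc f -> 0 <= r < 1 ->
  ccont_on (fun t => f (circle_pt r t)) a b.
Proof.
move=> fa /andP[r0 r1]; apply: (ccont_on_comp (f' := cderiv f)).
  exact: ccont_on_circle.
by move=> t _; apply: analytic_cdiff => //; rewrite normc_circle ger0_norm.
Qed.

Lemma ccont_on_bounded phi a b : a <= b -> ccont_on phi a b ->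
  exists B : R, forall t, a <= t <= b -> normc (phi t) <= B.
Proof.
move=> ab /ccont_on_normc /cont_on_within /(EVT_max ab)[c _ H].
by exists (normc (phi c)) => t tab; apply: H; rewrite in_itv.
Qed.

Lemma cauchy_cpow f r z : analytic_on_disc f -> normc z < r -> r < 1 ->
  f z = ((2 * pi)^-1)%:C * cpow (fun t => f (circle_pt r t)) r 0 z.
Proof.
move=> fa zr r1; have df w : normc w <= r -> cdiff f w (cderiv f w).
  by move=> wr; apply: analytic_cdiff => //; exact: le_lt_trans r1.
have -> : cpow (fun t => f (circle_pt r t)) r 0 z = (2 * pi)%:C * f z.
  rewrite -(cauchy_formula zr df); apply: eq_cintg => t _.
  by rewrite expr0 mul1r expr1.
by rewrite mulrA -rmorphM /= mulVf ?mul1r// gt_eqF// ltr0_2pi.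
Qed.

Lemma normcC_scale (x : R) z : 0 <= x -> normc (x%:C * z) = x * normc z.
Proof. by move=> x0; rewrite ComplexField.Normc.normcM normc_real ger0_norm. Qed.

Lemma analytic_taylor_cpow f r rho : analytic_on_disc f -> 0 <= rho -> rho < r -> r < 1 ->
  exists2 C, 0 <= C & forall z, normc z <= rho ->
   let f' w := ((2 * pi)^-1)%:C * cpow (fun t => f (circle_pt r t)) r 1 w in
   let f'' w := ((2 * pi)^-1)%:C * (2 * cpow (fun t => f (circle_pt r t)) r 2 w) in
   [/\ normc (f z) <= C, normc (f' z) <= C & forall h, normc (z + h) <= rho ->
     normc (f (z + h) - f z - f' z * h) <= C * normc h ^+ 2 /\
     normc (f' (z + h) - f' z - f'' z * h) <= C * normc h ^+ 2].
Proof.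
move=> fa rho0 rr r1; have r0 : 0 <= r < 1 by rewrite r1 andbT; lra.
have pi0 := @ltr0_2pi R; have pi1 := ltW pi0.
have phic : ccont_on (fun t => f (circle_pt r t)) 0 (2 * pi) by exact: ccont_on_circle_comp.
have [C C0 H] := cpow_taylor rho0 rr phic (ccont_on_bounded pi1 phic).
have i0 : 0 <= (2 * pi)^-1 :> R by rewrite invr_ge0.
exists ((2 * pi)^-1 * C); first by rewrite mulr_ge0.
move=> z zr f' f''; have [H1 H2 H3] := H z zr; have zr' := le_lt_trans zr rr; split.
- by rewrite (cauchy_cpow fa zr' r1) normcC_scale// ler_wpM2l.
- by rewrite /f' normcC_scale// ler_wpM2l.
move=> h hr; have [h1 h2] := H3 h hr.
rewrite (cauchy_cpow fa (le_lt_trans hr rr) r1) (cauchy_cpow fa zr' r1) /f' /f''.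
have fact (c u v d : R[i]) : c * u - c * v - c * d * h = c * (u - v - d * h) by ring.
by split; rewrite fact normcC_scale// -[leRHS]mulrA ler_wpM2l.
Qed.

Lemma cderiv_cpow f r rho z : analytic_on_disc f -> 0 <= rho -> rho < r -> r < 1 -> normc z < rho ->
  cderiv f z = ((2 * pi)^-1)%:C * cpow (fun t => f (circle_pt r t)) r 1 z.
Proof.
move=> fa rho0 rr r1 zr; have [C C0 H] := analytic_taylor_cpow fa rho0 rr r1.
apply: cderivE; apply: (quadratic_cdiff zr C0) => h hr.
by have [_ _ /(_ h hr)[]] := H z (ltW zr).
Qed.

Lemma analytic_cderiv f : analytic_on_disc f -> analytic_on_disc (cderiv f).
Proof.
move=> fa z z1; have n0 := normc_ge0 z.
pose rho := (1 + normc z) / 2; pose r := (1 + rho) / 2.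
have [h1 h2 h3] : [/\ normc z < rho, rho < r & r < 1].
  by rewrite /r /rho; move: z1; rewrite /unit_disc /= => z1; split; lra.
have h0 : 0 <= rho by lra.
have [C C0 H] := analytic_taylor_cpow fa h0 h2 h3.
have [_ _ Hz] := H z (ltW h1); 
pose f' w := ((2 * pi)^-1)%:C * cpow (fun t => f (circle_pt r t)) r 1 w.
have dq := quadratic_cdiff (f := f') h1 C0 (fun h hr => (Hz h hr).2).
have [] // := cdiff_derivable (cdiff_near (g := cderiv f) (del := rho - normc z) _ _ dq).
  by rewrite subr_gt0.
move=> h hr; rewrite (cderiv_cpow fa h0 h2 h3)//.
by apply: le_lt_trans (normcD _ _) _; lra.
Qed.

(** One constant serves the whole closed disc. Apart from differentiation under integrals, this
    provides the bounds on functions and derivatives over smaller discs that are used below. *)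
Lemma analytic_taylor f rho : analytic_on_disc f -> 0 <= rho < 1 ->
  exists2 C, 0 <= C & forall z, normc z <= rho ->
   [/\ normc (f z) <= C, normc (cderiv f z) <= C & forall h, normc (z + h) <= rho ->
     normc (f (z + h) - f z - cderiv f z * h) <= C * normc h ^+ 2].
Proof.
move=> fa /andP[r0 r1]; pose rho' := (1 + rho) / 2; pose r := (1 + rho') / 2.
have [h1 h2 h3] : [/\ rho < rho', rho' < r & r < 1] by rewrite /r /rho'; split; lra.
have h0 : 0 <= rho' by lra.
have [C C0 H] := analytic_taylor_cpow fa h0 h2 h3; exists C => // z zr.
have [H1 H2 H3] := H z (le_trans zr (ltW h1)).
have E := cderiv_cpow fa h0 h2 h3 (le_lt_trans zr h1).
rewrite E; split => // h hr.
by have [] := H3 h (le_trans hr (ltW h1)).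
Qed.

Lemma analytic_cst z : analytic_on_disc (fun=> z).
Proof. by apply: (cdiff_analytic (f' := fun=> 0)) => w _; exact: cdiff_cst. Qed.

Lemma analytic_id : analytic_on_disc (@id R[i]).
Proof. by apply: (cdiff_analytic (f' := fun=> 1)) => w _; exact: cdiff_id. Qed.

Lemma analyticD f g : analytic_on_disc f -> analytic_on_disc g ->
  analytic_on_disc (fun z => f z + g z).
Proof.
move=> fa ga; apply: (cdiff_analytic (f' := fun z => cderiv f z + cderiv g z)) => z z1.
by apply: cdiffD; exact: analytic_cdiff.
Qed.

Lemma analyticM f g : analytic_on_disc f -> analytic_on_disc g ->
  analytic_on_disc (fun z => f z * g z).
Proof.
move=> fa ga; apply: (cdiff_analytic
  (f' := fun z => cderiv f z * g z + f z * cderiv g z)) => z z1.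
by apply: cdiffM; exact: analytic_cdiff.
Qed.

Lemma analytic_ext f g : (forall z, normc z < 1 -> f z = g z) -> analytic_on_disc f ->
  analytic_on_disc g.
Proof.
move=> fg fa; apply: (cdiff_analytic (f' := cderiv f)) => z z1.
apply: (cdiff_near (f := f) (del := 1 - normc z)); rewrite ?subr_gt0//.
  by move=> h hd; apply: fg; apply: le_lt_trans (normcD _ _) _; lra.
exact: analytic_cdiff.
Qed.

Lemma analyticX n : analytic_on_disc (fun z : R[i] => z ^+ n).
Proof.
elim: n => [|n IH]; first exact: analytic_cst.
apply: (analytic_ext (f := fun z => z * z ^+ n)) => [z _|].
  by rewrite exprS.
exact: (analyticM (f := id) (g := fun z => z ^+ n) analytic_id IH).
Qed.

(** Weierstrass's theorem: [f] is continuous on each circle and Cauchy's formula passes to the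
    limit, after which differentiation under the integral gives the derivative. The approximant may
    depend on the disc and on [e], so no sequence has to be fixed. *)
Lemma analytic_uniform_limit f :
  (forall rho, 0 <= rho < 1 -> forall e, 0 < e -> exists2 g, analytic_on_disc g &
     forall z, normc z <= rho -> normc (f z - g z) <= e) -> analytic_on_disc f.
Proof.
move=> H; have fc r : 0 <= r < 1 -> ccont_on (fun t => f (circle_pt r t)) 0 (2 * pi).
  move=> r01; have /andP[r0 _] := r01; apply/ccont_onP => t tt e e0.
  have e3 : 0 < e / 3 by rewrite divr_gt0.
  have [g ga fg] := H r r01 _ e3.
  have /ccont_onP/(_ t tt _ e3)[del del0 gc] := ccont_on_circle_comp 0 (2 * pi) ga r01.
  exists del => // s /gc {}gc.
  have n u : normc (circle_pt r u) <= r by rewrite normc_circle ger0_norm.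
  have -> : f (circle_pt r s) - f (circle_pt r t) =
    (f (circle_pt r s) - g (circle_pt r s)) + (g (circle_pt r s) - g (circle_pt r t)) -
    (f (circle_pt r t) - g (circle_pt r t)) by ring.
  have := fg _ (n s); have := fg _ (n t).
  move: (f (circle_pt r t) - _) (f (circle_pt r s) - _) => u v ub vb.
  have := normcB (v + (g (circle_pt r s) - g (circle_pt r t))) u.
  have := normcD v (g (circle_pt r s) - g (circle_pt r t)); lra.
have rep z r : normc z < r -> r < 1 ->
    f z = ((2 * pi)^-1)%:C * cpow (fun t => f (circle_pt r t)) r 0 z.
  move=> zr r1; have n0 := normc_ge0 z; have r01 : 0 <= r < 1 by rewrite r1 andbT; lra.
  apply/eqP; rewrite -subr_eq0 -normc_eq0 eq_le normc_ge0 andbT.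
  have [r0 _] := andP r01.
  set M := (1 - normc z / r)^-1; have M0 : 0 < M by rewrite invr_gt0 ckernel_den_gt0.
  apply/ler_addgt0Pr => e e0; rewrite add0r.
  have N0 : 0 < 1 + 2 * M by lra.
  (* [e'] bounds [f - g] at [z], and [2 * (e' * M)] bounds the normalised difference of the two
     Cauchy integrals. *)
  have [e' e1 eE] : exists2 e', 0 < e' & e = e' + 2 * (e' * M).
    exists (e / (1 + 2 * M)); first by rewrite divr_gt0.
    by rewrite -{1}(divfK (lt0r_neq0 N0) e); move: (e / _) => u; ring.
  have [g ga fg] := H r r01 _ e1.
  have pi0 := @ltr0_2pi R; have i0 : 0 <= (2 * pi)^-1 :> R by rewrite invr_ge0 ltW.
  have gc := ccont_on_circle_comp 0 (2 * pi) ga r01; have fcr := fc r r01.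
  have -> : f z - ((2 * pi)^-1)%:C * cpow (fun t => f (circle_pt r t)) r 0 z =
     (f z - g z) - ((2 * pi)^-1)%:C * (cpow (fun t => f (circle_pt r t)) r 0 z -
       cpow (fun t => g (circle_pt r t)) r 0 z).
    rewrite [in RHS]mulrBr -(cauchy_cpow ga zr r1); ring.
  rewrite (le_trans (normcB _ _))// normcC_scale// -cintgB; [|exact: ccont_cpow..].
  have B : normc (cintg (fun t => f (circle_pt r t) * ((circle_pt r^-1 t)^*%C ^+ 0 *
      ckernel z r t ^+ 1) - g (circle_pt r t) * ((circle_pt r^-1 t)^*%C ^+ 0 *
      ckernel z r t ^+ 1)) 0 (2 * pi)) <= 2 * (e' * M) * (2 * pi - 0).
    apply: normc_cintg_bound; first exact: ltW.
      apply: (ccont_onD (ccont_cpow _ _ zr (fc r r01))).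
      rewrite (_ : (fun t => _) = (fun t => (-1) * (g (circle_pt r t) *
        ((circle_pt r^-1 t)^*%C ^+ 0 * ckernel z r t ^+ 1)))).
        by apply: ccont_onM; [exact: ccont_on_cst|exact: ccont_cpow].
      by apply/funext => t; rewrite mulN1r.
    move=> t _; rewrite -mulrBl expr0 mul1r expr1 ComplexField.Normc.normcM.
    rewrite ler_pM ?normc_ge0// ?normc_ckernel// fg// normc_circle ger0_norm//.
  have := fg z (ltW zr); have := ler_wpM2l i0 B.
  by rewrite subr0 [X in _ <= X -> _]mulrCA mulVf ?gt_eqF// mulr1 eE; lra.
move=> z; rewrite /unit_disc /= => z1; have n0 := normc_ge0 z.
pose rho := (1 + normc z) / 2; pose r := (1 + rho) / 2.
have [h1 h2 h3] : [/\ normc z < rho, rho < r & r < 1] by rewrite /r /rho; split; lra.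
have h0 : 0 <= rho by lra.
have r01 : 0 <= r < 1 by rewrite h3 andbT; lra.
have [C C0 HC] := cpow_taylor h0 h2 (fc r r01)
  (ccont_on_bounded (ltW ltr0_2pi) (fc r r01)).
have [_ _ Hz] := HC z (ltW h1).
have dq := quadratic_cdiff (f := cpow (fun t => f (circle_pt r t)) r 0) h1 C0
  (fun h hr => (Hz h hr).1).
have dc := cdiffM (cdiff_cst ((2 * pi)^-1)%:C z) dq.
have [] // := cdiff_derivable (cdiff_near (g := f) (del := rho - normc z) _ _ dc).
  by rewrite subr_gt0.
move=> h hr; rewrite -rep//.
by apply: lt_trans h2; apply: le_lt_trans (normcD _ _) _; lra.
Qed.

End analytic.

(** * Integral operators and Hardy means *)

Section operators.
Local Open Scope complex_scope.
Context {R : realType}.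
Implicit Types (f g k : R[i] -> R[i]) (z w d h : R[i]) (a b r t rho : R).

(** With [k = f g'] this is [T_g f] in a form without division by [z], so that the origin is not a
    special point. *)
Definition seg_avg k z := cintg (fun t => k (t%:C * z)) 0 1.

Lemma ccont_on_segment k z : analytic_on_disc k -> normc z < 1 ->
  ccont_on (fun t => k (t%:C * z)) 0 1.
Proof.
move=> ka z1; apply: (ccont_on_comp (f' := cderiv k)).
  by apply: ccont_onM; [apply: ccont_on_real; exact: cont_on_id|exact: ccont_on_cst].
move=> t /andP[t0 t1]; apply: analytic_cdiff => //; rewrite normcC_scale//.
have := normc_ge0 z; nra.
Qed.

Lemma analytic_seg_avg k : analytic_on_disc k -> analytic_on_disc (seg_avg k).
Proof.
move=> ka; have k'a := analytic_cderiv ka.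
apply: (cdiff_analytic (f' := fun z => cintg (fun t => t%:C * cderiv k (t%:C * z)) 0 1)).
move=> z z1; have n0 := normc_ge0 z.
pose rho := (1 + normc z) / 2.
have [h0 h1 h2] : [/\ 0 <= rho, normc z < rho & rho < 1] by rewrite /rho; split; lra.
have [C C0 H] := analytic_taylor ka (introT andP (conj h0 h2)).
apply: (@quadratic_cdiff _ _ _ _ rho (2 * C * (1 - 0))) => //; first by rewrite subr0; lra.
move=> h hr.
have z1' : normc (z + h) < 1 by apply: le_lt_trans h2.
have c1 := ccont_on_segment ka z1; have c2 := ccont_on_segment ka z1'.
have c3 : ccont_on (fun t => t%:C * cderiv k (t%:C * z)) 0 1.
  apply: ccont_onM; first by apply: ccont_on_real; exact: cont_on_id.
  exact: ccont_on_segment.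
rewrite /seg_avg [_ * h]mulrC -cintgZ// -!cintgB//; last 2 first.
- have c1' := ccont_onM (ccont_on_cst (-1) 0 1) c1.
  by have := ccont_onD c2 c1'; under [X in ccont_on X]eq_fun do rewrite mulN1r.
- exact: ccont_onM (ccont_on_cst h 0 1) c3.
have -> : 2 * C * (1 - 0) * normc h ^+ 2 = 2 * (C * normc h ^+ 2) * (1 - 0) by ring.
apply: normc_cintg_bound => //.
  have c1' := ccont_onM (ccont_on_cst (-1) 0 1) c1.
  have c3' := ccont_onM (ccont_on_cst (- h) 0 1) c3.
  have := ccont_onD (ccont_onD c2 c1') c3'.
  by under [X in ccont_on X]eq_fun do rewrite mulN1r mulNr.
move=> t /andP[t0 t1].
have n1 w : normc (t%:C * w) <= normc w.
  by rewrite normcC_scale// ler_piMl// normc_ge0.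
have [_ _ /(_ (t%:C * h))] := H (t%:C * z) (le_trans (n1 z) (ltW h1)).
rewrite -mulrDr => /(_ (le_trans (n1 _) hr)) Ht.
rewrite (_ : h * _ = cderiv k (t%:C * z) * (t%:C * h)); last by ring.
apply: le_trans Ht _; rewrite ler_wpM2l// lerXn2r ?nnegrE ?normc_ge0//.
Qed.

Lemma cesaro_opE g f z : analytic_on_disc g -> analytic_on_disc f -> normc z < 1 ->
  cesaro_op g f z = seg_avg (fun w => f w * cderiv g w) z.
Proof.
move=> ga fa z1; rewrite /cesaro_op; case: eqP => [->|/eqP z0].
  rewrite /seg_avg (eq_cintg (k := fun=> f 0 * cderiv g 0)); last by move=> t _; rewrite mulr0.
  by rewrite cintg_cst// subr0 mul1r.
rewrite /volterra_op cintegralE (eq_cintg (k := fun t => z * (f (t%:C * z) * cderiv g (t%:C * z)))).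
  rewrite (cintgZ z (ccont_on_segment (analyticM fa (analytic_cderiv ga)) z1)).
  by rewrite mulrA mulVf// mul1r.
by move=> t _; rewrite mulrC.
Qed.

Lemma volterra_cesaro g f z : analytic_on_disc g -> analytic_on_disc f -> normc z < 1 ->
  volterra_op g f z = z * cesaro_op g f z.
Proof.
move=> ga fa z1; rewrite /cesaro_op; case: eqP => [->|/eqP z0].
  rewrite mul0r /volterra_op cintegralE (eq_cintg (k := fun=> 0)).
    by rewrite cintg_cst// mulr0.
  by move=> t _; rewrite mulr0.
by rewrite mulrA mulfV// mul1r.
Qed.

Lemma analytic_cesaro g f : analytic_on_disc g -> analytic_on_disc f ->
  analytic_on_disc (cesaro_op g f).
Proof.
move=> ga fa; have ka := analyticM fa (analytic_cderiv ga).
by apply: (analytic_ext _ (analytic_seg_avg ka)) => z z1; rewrite cesaro_opE.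
Qed.

Lemma analytic_volterra g f : analytic_on_disc g -> analytic_on_disc f ->
  analytic_on_disc (volterra_op g f).
Proof.
move=> ga fa; apply: (analytic_ext _ (analyticM analytic_id (analytic_cesaro ga fa))) => z z1.
by rewrite volterra_cesaro.
Qed.

End operators.

Section hardy_mean.
Local Open Scope complex_scope.
Context {R : realType}.
Implicit Types (f g k : R[i] -> R[i]) (z w d h : R[i]) (a b p r t N : R).
Notation mu := (@lebesgue_measure R).

Lemma cont_on_powR (u : R -> R) p a b : 0 < p -> (forall x, 0 <= u x) -> cont_on u a b ->
  cont_on (fun x => u x `^ p) a b.
Proof.
(* Where [u] vanishes the power need not be differentiable, and continuity is checked directly;
   elsewhere it follows from the derivative of the power. *)
move=> p0 u0 uc x xab; have := u0 x; rewrite le_eqVlt => /predU1P[ux|ux].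
  apply/cvgrPdist_le => e e0.
  have e1 : 0 < e `^ p^-1 by rewrite powR_gt0.
  have /cvgrPdist_le/(_ _ e1) := uc x xab; rewrite -ux powR0 ?gt_eqF//.
  apply: filterS => y; rewrite !sub0r !normrN !ger0_norm ?powR_ge0// => uy.
  have := ge0_ler_powR (ltW p0) _ _ uy; rewrite -powRrM mulVf ?gt_eqF// powRr1 ?(ltW e0)//.
  by apply; rewrite nnegrE ?powR_ge0.
apply: (@continuous_comp _ _ _ u (fun y => y `^ p)); first exact: uc.
have [du _] := is_derive1_powR p ux.
exact/differentiable_continuous/derivable1_diffP.
Qed.

(** Neither divided by [2 pi] nor raised to the power [1/p]: as a plain real integral it is compared
    and added without extended reals. A bound [N] on the Hardy norm becomes the bound [2 pi N^p]
    here. *)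
Definition pmean p f r := intg (fun t => normc (f (circle_pt r t)) `^ p) 0 (2 * pi).

Lemma cont_on_normc_powR f p r a b : analytic_on_disc f -> 0 < p -> 0 <= r < 1 ->
  cont_on (fun t => normc (f (circle_pt r t)) `^ p) a b.
Proof.
move=> fa p0 r01; apply: cont_on_powR => //.
  by move=> x; exact: normc_ge0.
exact/ccont_on_normc/ccont_on_circle_comp.
Qed.

Lemma circle_meanE f p r : analytic_on_disc f -> 0 < p -> 0 <= r < 1 ->
  circle_mean p f r = ((2 * pi)^-1 * pmean p f r)%:E.
Proof.
move=> fa p0 r01; rewrite /circle_mean EFinM; congr (_ * _)%E.
rewrite /pmean -intgE /Rintegral fineK//.
apply: integrable_fin_num => //.
exact: (cont_on_integrable (cont_on_normc_powR fa p0 r01)).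
Qed.

Lemma pmean_ge0 f p r : 0 <= pmean p f r.
Proof. by apply: intg_ge0 => t _; exact: powR_ge0. Qed.

Lemma hardy_norm_le f p N : analytic_on_disc f -> 0 < p -> 0 <= N ->
  (hardy_norm p f <= N%:E)%E <-> forall r, 0 <= r < 1 -> pmean p f r <= 2 * pi * N `^ p.
Proof.
move=> fa p0 N0; have pi0 := @ltr0_2pi R.
have E r : 0 <= r < 1 -> (poweR (circle_mean p f r) p^-1 <= N%:E)%E =
    (pmean p f r <= 2 * pi * N `^ p).
  move=> r01; rewrite circle_meanE// poweR_EFin lee_fin.
  have x0 : 0 <= (2 * pi)^-1 * pmean p f r by rewrite mulr_ge0 ?pmean_ge0// invr_ge0 ltW.
  rewrite -ler_pdivrMl//; apply/idP/idP => h.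
    have := ge0_ler_powR (ltW p0) _ _ h; rewrite !nnegrE powR_ge0 N0 => /(_ isT isT).
    by rewrite -powRrM mulVf ?gt_eqF// powRr1.
  have p1 : 0 <= p^-1 by rewrite invr_ge0 ltW.
  have := ge0_ler_powR p1 _ _ h; rewrite !nnegrE powR_ge0 x0 => /(_ isT isT).
  by rewrite -powRrM mulfV ?gt_eqF// powRr1.
split=> [h r r01|h].
  rewrite -E//; apply: le_trans h; apply: ereal_sup_ubound.
  by exists r => //; rewrite /= in_itv.
apply: ge_ereal_sup => x [r rin <-]; move: rin; rewrite /= in_itv /= => r01.
by rewrite E// h.
Qed.

Lemma hardyP f p : 0 < p -> hardy p f <->
  analytic_on_disc f /\ exists2 N, 0 <= N & forall r, 0 <= r < 1 -> pmean p f r <= 2 * pi * N `^ p.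
Proof.
move=> p0; split=> [[fa fN]|[fa [N N0 H]]]; split=> //.
  have h0 : (0 <= hardy_norm p f)%E.
    apply: le_trans (_ : (poweR (circle_mean p f 0) p^-1 <= _)%E); first exact: poweR_ge0.
    by apply: ereal_sup_ubound; exists 0 => //; rewrite /= in_itv /= lexx ltr01.
  have fin : hardy_norm p f \is a fin_num by rewrite ge0_fin_numE.
  exists (fine (hardy_norm p f)); first exact: fine_ge0.
  by apply/hardy_norm_le => //; [exact: fine_ge0|rewrite fineK].
by apply: le_lt_trans (ltry N); apply/hardy_norm_le.
Qed.

End hardy_mean.

(** * Pointwise growth from a bounded circle mean *)

Section growth.
Local Open Scope complex_scope.
Context {R : realType}.
Implicit Types (f g k : R[i] -> R[i]) (z w d h : R[i]) (a b p r t : R).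

(* Replaces Jensen's inequality, at the cost of a constant factor. *)
Lemma le_tangent_powR (x k p : R) : 0 <= x -> 0 < k -> 1 <= p ->
  x <= k + k `^ (1 - p) * x `^ p.
Proof.
move=> x0 k0 p1; have [xk|kx] := leP x k.
  by rewrite (le_trans xk)// lerDl mulr_ge0 ?powR_ge0.
have x1 : 0 < x by apply: lt_trans kx.
rewrite (le_trans _ (_ : k `^ (1 - p) * x `^ p <= _))//; last by rewrite lerDr ltW.
rewrite -(mulr_powRB1 x0 (lt_le_trans ltr01 p1)) mulrCA ler_peMr// -opprB powRN.
rewrite mulrC ler_pdivlMr ?powR_gt0// mul1r ge0_ler_powR ?nnegrE ?subr_ge0 ?(ltW k0) ?(ltW kx)//.
Qed.

(** Cauchy's formula is applied to [f m], where [m] is on the circle the conjugate of the kernel: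
    the kernel is thereby replaced by its squared modulus [N], the Poisson kernel up to a factor.
    Its mass is of order [1 / (1 - s)] against a maximum of order [(1 - s)^(-2)], and this ratio
    gives the exponent [1/p]. *)
Lemma analytic_growth f p r z : analytic_on_disc f -> 1 <= p -> r < 1 -> normc z < r ->
  pmean p f r <= 2 * pi -> normc (f z) `^ p <= 4 `^ p * (2 / (r - normc z)).
Proof.
move=> fa p1 r1 zr mf; have n0 := normc_ge0 z.
have r0 : 0 < r := le_lt_trans n0 zr; have p0 : 0 < p := lt_le_trans ltr01 p1.
have r01 : 0 <= r < 1 by rewrite r1 ltW.
have pi0 := @ltr0_2pi R; have pi1 := ltW pi0.
set s := normc z / r; have s0 : 0 <= s by rewrite divr_ge0// ltW.
have s1 : 0 < 1 - s by exact: ckernel_den_gt0.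
pose c := reflected z r; pose m w := (1 - c * w)^-1.
have dm w : normc w <= r -> cdiff m w (c / (1 - c * w) ^+ 2).
  by move=> wr; apply: cdiff_geom; exact: reflected_neq0.
pose N t := normc (ckernel z r t) ^+ 2.
have mK t : m (circle_pt r t) * ckernel z r t = (N t)%:C.
  rewrite /m /c -ckernel_conj ?gt_eqF// /N sqr_normc_ReIm.
  by case: (ckernel z r t) => x y; apply: complex_eq => /=; ring.
have mz : m z = ((1 - s ^+ 2)^-1)%:C.
  rewrite /m fmorphV; congr (_^-1).
  rewrite /c /reflected /s exprMn sqr_normc_ReIm exprVn.
  by case: (z) => x y; apply: complex_eq => /=; field; rewrite gt_eqF.
have s2 : 0 < 1 - s ^+ 2 by rewrite (_ : 1 - s ^+ 2 = (1 - s) * (1 + s)) ?mulr_gt0//; [exact: ltr_wpDr|ring].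
have Kc a b : ccont_on (ckernel z r) a b by exact: ccont_ckernel.
have Nc a b : cont_on N a b.
  have := ccont_on_normc (Kc a b) => H.
  by rewrite (_ : N = fun t => normc (ckernel z r t) * normc (ckernel z r t));
    [exact: cont_onM|apply/funext => t; rewrite /N expr2].
have NM t : N t <= (1 - s) ^- 2.
  by rewrite -exprVn lerXn2r ?nnegrE ?normc_ge0 ?invr_ge0 ?(ltW s1)// normc_ckernel.
have N0 t : 0 <= N t by exact: sqr_ge0.
have mean1 : intg N 0 (2 * pi) = 2 * pi / (1 - s ^+ 2).
  have := cauchy_formula zr dm; rewrite mz.
  rewrite (eq_cintg (k := fun t => (N t)%:C)); last by move=> t _; exact: mK.
  by move=> /(congr1 (@complex.Re R)) /= ->; rewrite mul0r subr0.
have fc := ccont_on_circle_comp 0 (2 * pi) fa r01.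
have fnc := ccont_on_normc fc.
have fpc : cont_on (fun t => normc (f (circle_pt r t)) `^ p) 0 (2 * pi).
  exact: cont_on_normc_powR.
have df w : normc w <= r -> cdiff (fun w => f w * m w) w
    (cderiv f w * m w + f w * (c / (1 - c * w) ^+ 2)).
  by move=> wr; apply: cdiffM; [apply: analytic_cdiff => //; exact: le_lt_trans r1|exact: dm].
have poisson : 2 * pi / (1 - s ^+ 2) * normc (f z) <=
    2 * intg (fun t => normc (f (circle_pt r t)) * N t) 0 (2 * pi).
  have := cauchy_formula zr df; rewrite mz.
  rewrite (eq_cintg (k := fun t => f (circle_pt r t) * (N t)%:C)); last first.
    by move=> t _; rewrite -mulrA mK.
  have hc : ccont_on (fun t => f (circle_pt r t) * (N t)%:C) 0 (2 * pi).
    by apply: ccont_onM => //; exact: ccont_on_real.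
  move=> E; have := normc_cintg hc; rewrite E !ComplexField.Normc.normcM !normc_real.
  rewrite !ger0_norm ?invr_ge0 ?(ltW s2)// => H.
  rewrite mulrAC -mulrA; apply: le_trans H _; rewrite ler_wpM2l//.
  rewrite le_eqVlt; apply/orP; left; apply/eqP; apply: eq_intg => t _.
  by rewrite ComplexField.Normc.normcM normc_real ger0_norm.
(* At this value the two terms of [le_tangent_powR] balance: [k^p = 2 / (1 - s)] bounds the quotient
   of the maximum of [N] by its mean. *)
set k := (2 / (1 - s)) `^ p^-1.
have k0 : 0 < k by rewrite powR_gt0// divr_gt0.
have kp : k `^ p = 2 / (1 - s).
  by rewrite -powRrM mulVf ?gt_eqF// powRr1// divr_ge0// ltW.
have bound : intg (fun t => normc (f (circle_pt r t)) * N t) 0 (2 * pi) <=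
    k * (2 * pi / (1 - s ^+ 2)) + k `^ (1 - p) * (1 - s) ^- 2 * (2 * pi).
  have cst (x : R) a b : cont_on (fun=> x) a b by exact: cont_on_cst.
  apply: (@le_trans _ _ (intg (fun t => k * N t + k `^ (1 - p) * (1 - s) ^- 2 *
      normc (f (circle_pt r t)) `^ p) 0 (2 * pi))).
    apply: le_intg; [exact: cont_onM|by apply: cont_onD; exact: cont_onM|].
    move=> t _; have := le_tangent_powR (normc_ge0 (f (circle_pt r t))) k0 p1.
    move=> /(ler_wpM2r (N0 t)) /le_trans; apply; rewrite mulrDl lerD2l.
    rewrite -!mulrA ler_wpM2l ?powR_ge0// mulrC ler_wpM2r ?powR_ge0//.
  rewrite intgD; [|exact: cont_onM..]; rewrite !intgZ// mean1 lerD2l.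
  by rewrite ler_wpM2l// mulr_ge0 ?powR_ge0// invr_ge0 sqr_ge0.
(* One factor 2 comes from [normc_cintg], the other from the two terms of the tangent bound, each at
   most [k] times the mass of [N]. *)
have fk : normc (f z) <= 4 * k.
  have := le_trans poisson (ler_wpM2l (ltac:(by []) : 0 <= 2 :> R) bound).
  have E : k `^ (1 - p) * (1 - s) ^- 2 * (2 * pi) <= k * (2 * pi / (1 - s ^+ 2)).
    have -> : (1 - s) ^- 2 = (1 + s) / (1 - s) / (1 - s ^+ 2).
      by have s1' : 0 < 1 + s := ltr_wpDr s0 ltr01; field; rewrite !gt_eqF.
    have -> : k `^ (1 - p) * ((1 + s) / (1 - s) / (1 - s ^+ 2)) * (2 * pi) =
      k `^ (1 - p) * ((1 + s) / (1 - s)) * (2 * pi / (1 - s ^+ 2)) by ring.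
    rewrite ler_wpM2r ?divr_ge0 ?(ltW s2)//.
    have ke : k = k `^ (1 - p) * (2 / (1 - s)).
      by rewrite -kp -powRD ?subrK ?powRr1 ?(ltW k0)//; apply/implyP => _; rewrite gt_eqF.
    rewrite [leRHS]ke ler_wpM2l ?powR_ge0// ler_wpM2r ?invr_ge0 ?(ltW s1)//; clear -s1; lra.
  set A := 2 * pi / (1 - s ^+ 2) in E *; have A0 : 0 < A by rewrite divr_gt0.
  move=> H; rewrite -(ler_pM2l A0); move: H E; clear; lra.
apply: (@le_trans _ _ ((4 * k) `^ p)).
  by rewrite ge0_ler_powR ?nnegrE ?normc_ge0 ?(ltW p0)// mulr_ge0// ltW.
rewrite powRM ?(ltW k0)// kp ler_wpM2l ?powR_ge0// ler_wpM2l//.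
rewrite lef_pV2 ?posrE ?s1 ?subr_gt0// /s.
have -> : 1 - normc z / r = (r - normc z) / r by field; rewrite gt_eqF.
by rewrite ler_pdivlMr// ler_piMr// ?subr_ge0 ltW.
Qed.

End growth.

(** * A Hardy-Stein inequality *)

Section hardy_stein.
Local Open Scope complex_scope.
Context {R : realType}.
Implicit Types (f g k : R[i] -> R[i]) (z w : R[i]) (a b p r s t : R).

Lemma fd_is_derive (F : R -> R -> R) x y Fx Fy : fd F x y Fx Fy -> is_derive x 1 (F ^~ y) Fx.
Proof.
move=> dF.
have dp : is_diff x (fun s : R => (s, y) : R * R) (fun u : R => (u, 0)).
  exact: (is_diff_pair (is_diff_id x) (is_diff_cst y x)).
have := @is_diff_comp _ _ _ _ _ _ _ _ x dp dF.
rewrite (_ : (fun p : R * R => F p.1 p.2) \o (fun s => (s, y)) = F ^~ y)// => -[dFx dE].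
split; first exact/derivable1_diffP.
by rewrite deriveE// dE /= mulr1 mulr0 addr0.
Qed.

Lemma fd_powR (F : R -> R -> R) x y Fx Fy b : fd F x y Fx Fy -> 0 < F x y ->
  fd (fun s t => F s t `^ b) x y (b * F x y `^ (b - 1) * Fx) (b * F x y `^ (b - 1) * Fy).
Proof. by move=> dF F0; exact: (fd_comp dF (is_derive1_powR b F0)). Qed.

Lemma cfd_polar s t : cfd (@circle_pt R) s t (circle_pt 1 t) ('i * circle_pt s t).
Proof.
have ds := fd_fst t (is_derive_id s 1); split.
  apply: fd_eq (fdM ds (fd_snd s (is_derive_cos t))) _ _ => /=; ring.
apply: fd_eq (fdM ds (fd_snd s (is_derive_sin t))) _ _ => /=; ring.
Qed.

Section polar.
Variable f : R[i] -> R[i].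
Hypothesis fa : analytic_on_disc f.

Let F s t := f (circle_pt s t).
Let D s t := cderiv f (circle_pt s t) * circle_pt 1 t.
Let E s t := cderiv (cderiv f) (circle_pt s t) * circle_pt 1 t ^+ 2.

(** Negative radii are allowed, so that the polar functions are differentiable in a full
    neighbourhood of [s = 0]. *)
Let in_disc s t : -1 < s < 1 -> normc (circle_pt s t) < 1.
Proof. by move=> s1; rewrite normc_circle ltr_norml. Qed.

Let dF s t : -1 < s < 1 -> cfd F s t (D s t) ('i * (s%:C * D s t)).
Proof.
move=> s1; apply: cfd_eq (cfd_comp (cfd_polar s t) (analytic_cdiff fa (in_disc t s1))) _ _ => //.
rewrite /D; move: (cderiv f _) => u; rewrite circle_pt_real.
by move: s%:C (circle_pt 1 t) => w x; ring.
Qed.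

Let dD s t : -1 < s < 1 -> cfd D s t (E s t) ('i * (D s t + s%:C * E s t)).
Proof.
move=> s1; have df' := analytic_cdiff (analytic_cderiv fa) (in_disc t s1).
apply: cfd_eq (cfdM (cfd_comp (cfd_polar s t) df') (cfd_circle 1 s t)) _ _.
  by rewrite /E; move: (cderiv _ _) (cderiv _ _) (circle_pt 1 t) => u v x; ring.
rewrite /E /D; move: (cderiv _ _) (cderiv _ _) => u v; rewrite circle_pt_real.
by move: s%:C (circle_pt 1 t) => x y; ring.
Qed.

Definition polar_weight s t := normc (f (circle_pt s t)) ^+ 2 + 1.

Let U s t := complex.Re (F s t).
Let V s t := complex.Im (F s t).
Let D1 s t := complex.Re (D s t).
Let D2 s t := complex.Im (D s t).
(** [A] and [B] are the real and imaginary parts of [conj F * D]: the radial derivative of [|f|^2]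
    is [2 A], its angular derivative is [- 2 s B]. *)
Let A s t := U s t * D1 s t + V s t * D2 s t.
Let B s t := U s t * D2 s t - V s t * D1 s t.
Let H s t := U s t * complex.Re (E s t) + V s t * complex.Im (E s t).

Let W s t := U s t * U s t + V s t * V s t + 1.

Let WE s t : polar_weight s t = W s t.
Proof. by rewrite /polar_weight /W sqr_normc_ReIm !expr2. Qed.

Let dU s t : -1 < s < 1 -> fd U s t (D1 s t) (- (s * D2 s t)).
Proof.
move=> s1; have [h _] := dF t s1; apply: fd_eq h _ _ => //.
by rewrite /D2; case: (D s t) => x y /=; ring.
Qed.

Let dV s t : -1 < s < 1 -> fd V s t (D2 s t) (s * D1 s t).
Proof.
move=> s1; have [_ h] := dF t s1; apply: fd_eq h _ _ => //.
by rewrite /D1; case: (D s t) => x y /=; ring.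
Qed.

Let dD1 s t : -1 < s < 1 ->
  fd D1 s t (complex.Re (E s t)) (- (D2 s t + s * complex.Im (E s t))).
Proof.
move=> s1; have [h _] := dD t s1; apply: fd_eq h _ _ => //.
by rewrite /D2; case: (D s t) => x y; case: (E s t) => x' y' /=; ring.
Qed.

Let dD2 s t : -1 < s < 1 ->
  fd D2 s t (complex.Im (E s t)) (D1 s t + s * complex.Re (E s t)).
Proof.
move=> s1; have [_ h] := dD t s1; apply: fd_eq h _ _ => //.
by rewrite /D1; case: (D s t) => x y; case: (E s t) => x' y' /=; ring.
Qed.

Let dW s t : -1 < s < 1 -> fd W s t (2 * A s t) (- (2 * s * B s t)).
Proof.
move=> s1; have du := dU t s1; have dv := dV t s1.
by apply: fd_eq (fdD (fdD (fdM du du) (fdM dv dv)) (fd_cst 1 s t)) _ _; rewrite /A /B; ring.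
Qed.

(** Only one partial derivative of [A], and of [B] below, enters Green's formula; the other stays
    existential. The terms in [H] cancel there, a trace of the Cauchy-Riemann equations. *)
Let dA s t : -1 < s < 1 -> exists y,
  fd A s t (D1 s t ^+ 2 + D2 s t ^+ 2 + H s t) y.
Proof.
move=> s1; eexists.
apply: fd_eq (fdD (fdM (dU t s1) (dD1 t s1)) (fdM (dV t s1) (dD2 t s1))) _ erefl.
by rewrite /H; ring.
Qed.

Let dB s t : -1 < s < 1 -> exists x,
  fd B s t x (- s * (D1 s t ^+ 2 + D2 s t ^+ 2) + A s t + s * H s t).
Proof.
move=> s1; eexists.
have := fdD (fdM (dU t s1) (dD2 t s1)) (fdM (fd_cst (-1) s t) (fdM (dV t s1) (dD1 t s1))).
rewrite (_ : (fun s t => _) = B); last first.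
  by apply/funext => x; apply/funext => y; rewrite /B mulN1r.
by move=> h; apply: fd_eq h erefl _; rewrite /H /A; ring.
Qed.

Let W0 s t : 0 < W s t.
Proof. by rewrite /W -!expr2 ltr_wpDl// addr_ge0// sqr_ge0. Qed.

Let Wper s : (F s 0 = F s (2 * pi)) * (D s 0 = D s (2 * pi)).
Proof. by rewrite /F /D !circle_pt_2pi. Qed.

Definition polar_deriv p s t : R :=
  p / 2 * polar_weight s t `^ (p / 4 - 1) * A s t.

Lemma polar_weight_gt0 s t : 0 < polar_weight s t.
Proof. by rewrite WE. Qed.

Lemma is_derive_polar p s t : -1 < s < 1 ->
  is_derive s 1 (fun x => polar_weight x t `^ (p / 4)) (polar_deriv p s t).
Proof.
move=> s1; have := fd_is_derive (fd_powR (p / 4) (dW t s1) (W0 s t)).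
rewrite (_ : (fun x => W x t `^ (p / 4)) = (fun x => polar_weight x t `^ (p / 4))).
  by rewrite /polar_deriv WE => /is_derive_eq; apply; field.
by apply/funext => x; rewrite WE.
Qed.

Let dpolar_deriv p s t : -1 < s < 1 -> exists x y, fd (polar_deriv p) s t x y.
Proof.
move=> s1; have [y dA'] := dA t s1; do 2 eexists.
have := fdM (fdM (fd_cst (p / 2) s t) (fd_powR (p / 4 - 1) (dW t s1) (W0 s t))) dA'.
rewrite (_ : (fun s t => _) = polar_deriv p); first exact.
by apply/funext => x; apply/funext => y'; rewrite /polar_deriv WE.
Qed.

Lemma cont_polar_weight p s t : -1 < s < 1 ->
  {for t, continuous (fun t => polar_weight s t `^ (p / 2))}.
Proof.
move=> s1; have := fd_cont_snd (fd_powR (p / 2) (dW t s1) (W0 s t)).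
by rewrite (_ : (fun t => _) = (fun t => polar_weight s t `^ (p / 2)))//; apply/funext => x; rewrite WE.
Qed.

Lemma cont_polar_deriv p t s : -1 < s < 1 -> {for s, continuous (polar_deriv p ^~ t)}.
Proof. by move=> /(dpolar_deriv p t)[x [y]] /fd_cont_fst. Qed.

Definition polar_energy p r s t := 4 * (s * (r - s)) * polar_deriv p s t ^+ 2.

Lemma cont_polar_energy p r s t : -1 < s < 1 ->
  {for (s, t), continuous (fun q : R * R => polar_energy p r q.1 q.2)}.
Proof.
move=> s1; have [x [y d]] := dpolar_deriv p t s1.
have ds := fd_fst t (is_derive_id s 1).
have := fd_cont (fdM (fdM (fd_cst 4 s t) (fdM ds (fdD (fd_cst r s t)
  (fdM (fd_cst (-1) s t) ds)))) (fdM d d)).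
rewrite (_ : (fun q : R * R => _) = (fun q : R * R => polar_energy p r q.1 q.2)); first exact.
by apply/funext => q; rewrite /polar_energy mulN1r expr2.
Qed.

(* Green's formula with the weight [r - s] for [u ^+ 2], where [u = (|f|^2 + 1)^(p/4)]: the Laplacian
   of this function is at least [4 (d_s u)^2]. *)
Lemma hardy_stein p r : 0 < p -> 0 <= r < 1 ->
  intg (fun t => intg (fun s => polar_energy p r s t) 0 r) 0 (2 * pi) <=
  r * intg (fun t => polar_weight r t `^ (p / 2)) 0 (2 * pi).
Proof.
move=> p0 /andP[r0 r1]; have pi0 := ltW (@ltr0_2pi R).
pose a := p / 2.
(* With [Phi = W^a], [Q] is [(r - s) s d_s Phi + s Phi] and [P] is [- (r - s) d_t Phi / s] with the
   division carried out. Then [d_s Q - d_t P] is [s (r - s)] times the Laplacian of [Phi], plus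
   [Phi], and the boundary leaves only [r Phi] on the circle. *)
pose Q s t := (r - s) * s * (2 * a) * (W s t `^ (a - 1) * A s t) + s * W s t `^ a.
pose P s t := (r - s) * (2 * a) * (W s t `^ (a - 1) * B s t).
have := @green_le _ P Q (polar_energy p r) 0 r 0 (2 * pi) r0 pi0.
have -> : intg (fun x => P x 0 - P x (2 * pi)) 0 r = 0.
  rewrite (eq_intg (f := fun=> 0)) ?intg_cst ?mul0r// => s _.
  by rewrite /P /W /B /U /V /D1 /D2 !Wper subrr.
rewrite add0r (eq_intg (h := fun y => Q r y - Q 0 y) (f := fun t => r * polar_weight r t `^ a)).
  rewrite intgZ; last first.
    by move=> t _; apply: cont_polar_weight; lra.
  apply => [s t sr|s t sr _].
    by apply: cont_polar_energy; lra.
  have s1 : -1 < s < 1 by lra.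
  have [Ay dA'] := dA t s1; have [Bx dB'] := dB t s1; have dW' := dW t s1.
  have ds := fd_fst t (is_derive_id s 1).
  have drs : fd (fun s _ => r - s) s t (-1) 0.
    have := fdD (fd_cst r s t) (fdM (fd_cst (-1) s t) ds).
    rewrite (_ : (fun s t => _) = (fun s _ => r - s)); last first.
      by apply/funext => x; apply/funext => y; rewrite mulN1r.
    by move=> h; apply: fd_eq h _ _; ring.
  have dWa := fd_powR (a - 1) dW' (W0 s t).
  have dQ := fdD (fdM (fdM (fdM drs ds) (fd_cst (2 * a) s t)) (fdM dWa dA'))
    (fdM ds (fd_powR a dW' (W0 s t))).
  have dP := fdM (fdM drs (fd_cst (2 * a) s t)) (fdM dWa dB').
  do 4 eexists; split; [exact: dP|exact: dQ|].
  have w2 : 0 <= W s t `^ (a - 2) by exact: powR_ge0.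
  have pw x : W s t `^ (1 + x) = W s t * W s t `^ x.
    by rewrite powRD ?powRr1 ?(ltW (W0 s t))// (gt_eqF (W0 s t)) implybT.
  have w1E : W s t `^ (a - 1) = W s t * W s t `^ (a - 2).
    by rewrite -pw; congr (_ `^ _); ring.
  have w0E : W s t `^ a = W s t ^+ 2 * W s t `^ (a - 2).
    by rewrite expr2 -mulrA -!pw; congr (_ `^ _); ring.
  have e2 : (polar_weight s t `^ (p / 4 - 1)) ^+ 2 = W s t `^ (a - 2).
    rewrite WE expr2 -powRD ?(gt_eqF (W0 s t)) ?implybT//; congr (_ `^ _).
    by rewrite /a; field.
  have sqE : polar_deriv p s t ^+ 2 = a ^+ 2 * W s t `^ (a - 2) * A s t ^+ 2.
    rewrite /polar_deriv -/a -e2; move: (_ `^ _) (A s t) => y u; ring.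
  rewrite /polar_energy sqE.
  rewrite (_ : a - 1 - 1 = a - 2); last by ring.
  rewrite w1E w0E -subr_ge0.
  set X := (X in 0 <= X).
  (* The first summand is [W^a]; the second uses [A^2 + B^2 = |F|^2 |D|^2], which trades [A] for [B]
     and leaves only nonnegative terms. *)
  have -> : X = W s t ^+ 2 * W s t `^ (a - 2) + 4 * a * (s * (r - s)) * W s t `^ (a - 2) *
     (D1 s t ^+ 2 + D2 s t ^+ 2 + a * B s t ^+ 2).
    rewrite /X; move: (W s t `^ (a - 2)) => w.
    rewrite /A /B /W; move: (H s t) (U s t) (V s t) (D1 s t) (D2 s t) => h u v d1 d2; ring.
  have a0 : 0 <= a by rewrite divr_ge0// ltW.
  have [s0 sr'] := andP sr.
  apply: addr_ge0; first by rewrite mulr_ge0// sqr_ge0.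
  apply: mulr_ge0; first by rewrite !mulr_ge0 ?subr_ge0 ?(ltW p0).
  by rewrite !addr_ge0 ?sqr_ge0// mulr_ge0// sqr_ge0.
by move=> t _; rewrite /Q subrr subr0 !mul0r mulr0 !mul0r !addr0 add0r subr0 WE.
Qed.

End polar.
End hardy_stein.

(** * Integrating the energy bound along a radius *)

Section hedberg.
Context {R : realType}.
Implicit Types (a b p q r s t x y : R).

Lemma powRD_gt0 x a b : 0 < x -> x `^ (a + b) = x `^ a * x `^ b.
Proof. by move=> x0; rewrite powRD// (gt_eqF x0) implybT. Qed.

Lemma is_derive_onem_powR b s : s < 1 ->
  is_derive s 1 (fun t => (1 - t) `^ b) (- (b * (1 - s) `^ (b - 1))).
Proof.
move=> s1; have d1 : is_derive s 1 (fun t : R => 1 - t) (-1).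
  by rewrite -[X in is_derive _ _ _ X]add0r; apply: is_deriveB.
have s0 : 0 < 1 - s by lra.
by have := @is_derive1_comp _ (fun y : R => y `^ b) (fun t => 1 - t) s _ _ (is_derive1_powR b s0) d1; rewrite mulrN1.
Qed.

Lemma cont_on_onem_powR b x y : y < 1 -> cont_on (fun t => (1 - t) `^ b) x y.
Proof.
move=> y1 t /andP[_ ty]; have [d _] := is_derive_onem_powR b (le_lt_trans ty y1).
exact/differentiable_continuous/derivable1_diffP.
Qed.

Lemma intg_onem_powR b x y : b != 0 -> x <= y -> y < 1 ->
  intg (fun t => (1 - t) `^ (b - 1)) x y = ((1 - x) `^ b - (1 - y) `^ b) / b.
Proof.
move=> b0 xy y1.
have d t : x <= t <= y ->
    is_derive t 1 (fun t => - b^-1 * (1 - t) `^ b) ((1 - t) `^ (b - 1)).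
  move=> /andP[_ ty]; have d := is_derive_onem_powR b (le_lt_trans ty y1).
  have : is_derive t 1 (- b^-1 *: (fun t => (1 - t) `^ b)) (- b^-1 *: - (b * (1 - t) `^ (b - 1))).
    exact: is_deriveZ.
  by move=> /is_derive_eq; apply; rewrite /GRing.scale /=; field.
by rewrite (intg_FTC2 xy (@cont_on_onem_powR (b - 1) x y y1) d); field.
Qed.

Lemma intg_onem_powR_le b x y : 0 < b -> x <= y -> y < 1 ->
  intg (fun t => (1 - t) `^ (b - 1)) x y <= (1 - x) `^ b / b.
Proof.
move=> b0 xy y1; rewrite intg_onem_powR ?gt_eqF// ler_wpM2r ?invr_ge0 ?(ltW b0)//.
by rewrite gerBl powR_ge0.
Qed.

Lemma intg_onem_powRN_le b x y : 0 < b -> x <= y -> y < 1 ->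
  intg (fun t => (1 - t) `^ (- b - 1)) x y <= (1 - y) `^ (- b) / b.
Proof.
move=> b0 xy y1; rewrite intg_onem_powR ?oppr_eq0 ?gt_eqF// invrN mulrN -mulNr opprB.
by rewrite ler_wpM2r ?invr_ge0 ?(ltW b0)// gerBl powR_ge0.
Qed.

(** Pointwise, [du <= du^2 w / (2 g) + g / (2 w)] with [w = t (1 - t)]. The first term integrates to
    the energy; the second would give a logarithm, which is relaxed to the power [d] of
    [(1 - x) / (1 - s)]. The condition [x >= 1/2] absorbs the factor [t] of the weight. *)
Lemma energy_growth (u du : R -> R) (G d K g x s : R) :
  2^-1 <= x -> x <= s -> s < 1 -> 0 < d -> 1 <= g -> 0 <= K -> 0 <= u x ->
  (forall t, x <= t <= s -> is_derive t 1 u (du t)) -> cont_on du x s ->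
  u x <= K * g -> intg (fun t => du t ^+ 2 * (t * (1 - t))) x s <= G -> G <= g ^+ 2 ->
  u s <= (K + 2^-1 + d^-1) * g * ((1 - x) `^ d * (1 - s) `^ (- d)).
Proof.
move=> x2 xs s1 d0 g1 K0 ux0 dudt duc uxK HG Gg.
have g0 : 0 < g := lt_le_trans ltr01 g1.
have cdu2 : cont_on (fun t => du t ^+ 2 * (t * (1 - t))) x s.
  have h : cont_on (fun t => du t * du t * (t * (1 - t))) x s.
    apply: cont_onM; first exact: cont_onM.
    by apply: cont_onM; [exact: cont_on_id|apply: cont_onB; [exact: cont_on_cst|exact: cont_on_id]].
  by rewrite (_ : (fun t => _) = (fun t => du t * du t * (t * (1 - t))))//; apply/funext => t; rewrite expr2.
have cpw : cont_on (fun t => (1 - t) `^ (- d - 1)) x s by exact: cont_on_onem_powR.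
have x1 : 0 < 1 - x by lra.
have cst (c : R) : cont_on (fun=> c) x s by exact: cont_on_cst.
have duB t : x <= t <= s -> du t <= (2 * g)^-1 * (du t ^+ 2 * (t * (1 - t))) +
    g * (1 - x) `^ d * (1 - t) `^ (- d - 1).
  move=> /andP[xt ts]; have t1 : 0 < 1 - t by lra.
  have t0 : 0 < t by lra.
  have w0 : 0 < t * (1 - t) by rewrite mulr_gt0.
  have e1 : (1 - t)^-1 <= (1 - x) `^ d * (1 - t) `^ (- d - 1).
    rewrite [- d - 1]addrC powRD_gt0// (powR_inv1 (ltW t1)) mulrCA ler_peMr ?invr_ge0 ?(ltW t1)//.
    rewrite powRN ler_pdivlMr ?powR_gt0// mul1r ge0_ler_powR ?nnegrE ?(ltW d0)//; clear -t1 x1 xt; lra.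
  have e2 : (t * (1 - t))^-1 <= 2 * (1 - t)^-1.
    rewrite invfM ler_wpM2r ?invr_ge0 ?(ltW t1)// -[2]invrK lef_pV2 ?posrE//; lra.
  apply: (@le_trans _ _ ((2 * g)^-1 * (du t ^+ 2 * (t * (1 - t))) + g / 2 * (t * (1 - t))^-1)).
    rewrite -subr_ge0; have -> : (2 * g)^-1 * (du t ^+ 2 * (t * (1 - t))) +
      g / 2 * (t * (1 - t))^-1 - du t =
      (du t * (t * (1 - t)) - g) ^+ 2 / (2 * g * (t * (1 - t))).
      by field; rewrite !gt_eqF.
    by rewrite divr_ge0 ?sqr_ge0// mulr_ge0 ?(ltW w0)// mulr_ge0 ?(ltW g0).
  rewrite lerD2l -!mulrA ler_wpM2l ?(ltW g0)//.
  by apply: le_trans e1; move: e2; clear; lra.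
have -> : u s = u x + intg du x s by rewrite (@intg_FTC2 _ _ u)// addrC subrK.
set X := (1 - x) `^ d * (1 - s) `^ (- d).
have X1 : 1 <= X.
  rewrite /X powRN ler_pdivlMr ?powR_gt0 ?mul1r ?ge0_ler_powR ?nnegrE ?(ltW d0)//; clear -xs s1 x1; lra.
have iB : intg du x s <= (2 * g)^-1 * G + g * d^-1 * X.
  apply: (@le_trans _ _ (intg (fun t => (2 * g)^-1 * (du t ^+ 2 * (t * (1 - t))) +
    g * (1 - x) `^ d * (1 - t) `^ (- d - 1)) x s)).
    by apply: le_intg => //; apply: cont_onD; exact: cont_onM.
  rewrite intgD; [|exact: cont_onM..]; rewrite !intgZ// lerD//.
    by rewrite ler_wpM2l// invr_ge0 mulr_ge0// ltW.
  rewrite /X -!mulrA ler_wpM2l ?(ltW g0)//.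
  rewrite mulrCA ler_wpM2l ?powR_ge0//.
  rewrite mulrC; exact: intg_onem_powRN_le.
have gG : (2 * g)^-1 * G <= 2^-1 * g.
  by rewrite invfM -mulrA ler_wpM2l// mulrC ler_pdivrMr// -expr2.
have h1 : u x <= K * g * X by apply: le_trans uxK _; rewrite ler_peMr// mulr_ge0// ltW.
have h2 : 2^-1 * g <= 2^-1 * g * X by rewrite ler_peMr// mulr_ge0// ltW.
rewrite !mulrDl; move: iB; rewrite [g * _]mulrC; lra.
Qed.

(** Below the splitting point [x] the growth bound integrates to a multiple of [(1 - x)^(-1/q)];
    above it the energy gives a multiple of [(1 + G)^(1/p) (1 - x)^al]. Since [al = 1/p - 1/q], both
    are of order [(1 + G)^(1/q)] when [1 - x] is of order [1 / (1 + G)]. *)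
Lemma hedberg p q K : 0 < p -> p < q -> 0 <= K -> exists2 C, 0 <= C &
  forall (u du : R -> R) r G, 2^-1 <= r < 1 ->
  (forall t, 0 <= t <= r -> is_derive t 1 u (du t)) -> cont_on du 0 r ->
  (forall t, 0 <= t <= r -> 0 < u t /\ u t ^+ 2 <= K / (1 - t)) ->
  intg (fun t => du t ^+ 2 * (t * (1 - t))) 0 r <= G ->
  intg (fun t => u t `^ (2 / p) * (1 - t) `^ (p^-1 - q^-1 - 1)) 0 r <=
    C * (1 + G) `^ q^-1.
Proof.
move=> p0 pq K0; have q0 : 0 < q := lt_trans p0 pq.
set al := p^-1 - q^-1; have al0 : 0 < al by rewrite subr_gt0 ltf_pV2.
(* Raising [(1 - s)^(-d)] to the power [2/p] costs [(1 - s)^(-al/2)], so half of the exponent [al]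
   is left for integrability. *)
pose d := al * p / 4; have d0 : 0 < d by rewrite divr_gt0// mulr_gt0.
pose C1 := Num.sqrt (2 * K) + 2^-1 + d^-1.
have C10 : 0 <= C1 by rewrite !addr_ge0 ?sqrtr_ge0// invr_ge0 ltW.
pose CA := K `^ p^-1 * q * 2 `^ q^-1.
pose CB := C1 `^ (2 / p) * (2 / al).
have CA0 : 0 <= CA by rewrite !mulr_ge0 ?powR_ge0// ltW.
have CB0 : 0 <= CB by rewrite mulr_ge0 ?powR_ge0// divr_ge0// ltW.
exists (CA + CB); first exact: addr_ge0.
move=> u du r G /andP[r2 r1] dudt duc uK HG.
have p1 : 0 < p^-1 by rewrite invr_gt0.
have q1 : 0 < q^-1 by rewrite invr_gt0.
have r0 : 0 <= r by lra.
have G0 : 0 <= G.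
  apply: le_trans HG; apply: intg_ge0 => t tr; rewrite mulr_ge0 ?sqr_ge0// mulr_ge0//; lra.
set Ga := 1 + G; have Ga1 : 1 <= Ga by rewrite lerDl.
have Ga0 : 0 < Ga := lt_le_trans ltr01 Ga1.
have cu : cont_on u 0 r.
  by move=> t tr; have [/derivable1_diffP/differentiable_continuous] := dudt t tr.
have cF : cont_on (fun t => u t `^ (2 / p) * (1 - t) `^ (al - 1)) 0 r.
  apply: cont_onM; last exact: cont_on_onem_powR.
  move=> t tr; have [ut0 _] := uK t tr.
  apply: (@continuous_comp _ _ _ u (fun y : R => y `^ (2 / p))); first exact: cu.
  have [h _] := is_derive1_powR (2 / p) ut0.
  exact/differentiable_continuous/derivable1_diffP.
(* Stated for any endpoint not beyond the splitting point, so that it also covers the case where [r]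
   comes first. *)
have partA x : 0 <= x <= r -> (2 * Ga)^-1 <= 1 - x ->
    intg (fun t => u t `^ (2 / p) * (1 - t) `^ (al - 1)) 0 x <= CA * Ga `^ q^-1.
  move=> /andP[x0 xr] xGa; have x1 : 0 < 1 - x by lra.
  apply: (@le_trans _ _ (intg (fun t => K `^ p^-1 * (1 - t) `^ (- q^-1 - 1)) 0 x)).
    apply: le_intg.
    - exact: cont_on_sub cF.
    - by apply: cont_onM; [exact: cont_on_cst|apply: cont_on_onem_powR; lra].
    move=> t /andP[t0 tx]; have t1 : 0 < 1 - t by lra.
    have [/ltW ut0 utK] : 0 < u t /\ u t ^+ 2 <= K / (1 - t) by apply: uK; lra.
    have -> : - q^-1 - 1 = - p^-1 + (al - 1) by rewrite /al; ring.
    rewrite [X in _ <= _ * X]powRD_gt0// [leRHS]mulrA ler_wpM2r ?powR_ge0//.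
    have -> : K `^ p^-1 * (1 - t) `^ (- p^-1) = (K / (1 - t)) `^ p^-1.
      by rewrite powRM ?invr_ge0 ?(ltW t1)// -(powR_inv1 (ltW t1)) -powRrM mulN1r.
    rewrite powRrM (powR_mulrn 2 ut0).
    by rewrite ge0_ler_powR ?nnegrE ?sqr_ge0 ?divr_ge0 ?(ltW t1) ?(ltW p1).
  rewrite intgZ; last by apply: cont_on_onem_powR; lra.
  rewrite /CA -!mulrA ler_wpM2l ?powR_ge0//.
  apply: le_trans (intg_onem_powRN_le q1 x0 _) _; first by lra.
  rewrite invrK mulrC ler_wpM2l ?(ltW q0)// -powRM// ?(ltW Ga0)// powRN.
  have Gai : 0 < (2 * Ga)^-1 by rewrite invr_gt0 mulr_gt0.
  rewrite -[leRHS]invrK lef_pV2 ?posrE ?invr_gt0 ?powR_gt0 ?mulr_gt0//.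
  rewrite -powRN -mulN1r powRrM powR_inv1 ?mulr_ge0 ?(ltW Ga0)//.
  by rewrite ge0_ler_powR ?nnegrE ?(ltW Gai) ?(ltW x1) ?(ltW q1).
(* The splitting point, where the growth bound on [u ^+ 2] is of the order of [Ga]. *)
pose x := 1 - (2 * Ga)^-1.
have Gai : 0 < (2 * Ga)^-1 <= 2^-1.
  by rewrite invr_gt0 mulr_gt0//= lef_pV2 ?posrE ?mulr_gt0// ler_peMr.
have xE : 1 - x = (2 * Ga)^-1 by rewrite /x; ring.
(* [Ga >= 1] puts the splitting point in the outer half, as [energy_growth] demands. *)
have x2 : 2^-1 <= x by rewrite /x; clear -Gai; lra.
have [rx|xr] := leP r x.
  apply: le_trans (partA r _ _) _; [by rewrite r0 lexx|by rewrite -xE lerD2l lerN2|].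
  by rewrite ler_wpM2r ?powR_ge0// lerDl.
have x0r : 0 <= x <= r by clear -x2 xr; lra.
rewrite (intg_split x0r cF).
rewrite [leRHS]mulrDl lerD//; first by apply: partA; rewrite ?xE.
have x1 : 0 < 1 - x by rewrite subr_gt0; exact: lt_trans r1.
pose g := Num.sqrt Ga; have g1 : 1 <= g by rewrite -[leLHS]sqrtr1 ler_wsqrtr.
have gE : g ^+ 2 = Ga by rewrite sqr_sqrtr// ltW.
have [/ltW ux0 uxK] : 0 < u x /\ u x ^+ 2 <= K / (1 - x) by exact: uK.
have uxg : u x <= Num.sqrt (2 * K) * g.
  rewrite -sqrtrM ?mulr_ge0// -[u x]ger0_norm// -sqrtr_sqr ler_wsqrtr//.
  apply: le_trans uxK _; rewrite xE invrK mulrCA mulrA lexx //.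
have us s : x <= s <= r -> u s `^ (2 / p) * (1 - s) `^ (al - 1) <=
    C1 `^ (2 / p) * Ga `^ p^-1 * (1 - x) `^ (al / 2) * (1 - s) `^ (al / 2 - 1).
  move=> /andP[xs sr]; have s1 : 0 < 1 - s by clear -sr r1; lra.
  have s0r : 0 <= s <= r by clear -x2 xs sr; lra.
  have xst t : x <= t <= s -> 0 <= t <= r by clear -x2 sr; lra.
  have H : u s <= C1 * g * ((1 - x) `^ d * (1 - s) `^ (- d)).
    apply: (@energy_growth _ du G) => //.
    - by rewrite -subr_gt0.
    - by move=> t /xst /dudt.
    - by apply: cont_on_sub duc => //; case/andP: x0r.
    - apply: le_trans HG; apply: intg_le_sub => //; first by case/andP: x0r.
        have h : cont_on (fun t => du t * du t * (t * (1 - t))) 0 r.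
          apply: cont_onM; first exact: cont_onM.
          by apply: cont_onM; [exact: cont_on_id|apply: cont_onB; [exact: cont_on_cst|exact: cont_on_id]].
        by rewrite (_ : (fun t => _) = (fun t => du t * du t * (t * (1 - t))))//; apply/funext => t; rewrite expr2.
      by move=> t tr; rewrite mulr_ge0 ?sqr_ge0// mulr_ge0; clear -tr r1; lra.
    - by rewrite gE /Ga; clear; lra.
  have [/ltW us0 _] : 0 < u s /\ u s ^+ 2 <= K / (1 - s) by exact: uK.
  have := ge0_ler_powR (ltW (divr_gt0 (ltr0n R 2) p0)) _ _ H.
  rewrite !nnegrE us0 => /(_ isT); rewrite !mulr_ge0 ?powR_ge0 ?sqrtr_ge0// => /(_ isT).
  rewrite !powRM ?mulr_ge0 ?powR_ge0 ?sqrtr_ge0// -!powRrM.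
  have -> : d * (2 / p) = al / 2 by rewrite /d; field; rewrite gt_eqF.
  have -> : - d * (2 / p) = - (al / 2) by rewrite /d; field; rewrite gt_eqF.
  have -> : g `^ (2 / p) = Ga `^ p^-1.
    by rewrite powRrM powR_mulrn ?sqrtr_ge0// gE.
  move=> /(ler_wpM2r (powR_ge0 (1 - s) (al - 1))) /le_trans; apply.
  have -> : al / 2 - 1 = - (al / 2) + (al - 1) by field.
  by rewrite [X in _ <= _ * X]powRD_gt0// !mulrA.
apply: (@le_trans _ _ (intg (fun s => C1 `^ (2 / p) * Ga `^ p^-1 * (1 - x) `^ (al / 2) *
    (1 - s) `^ (al / 2 - 1)) x r)).
  apply: le_intg => //; first by apply: cont_on_sub cF => //; case/andP: x0r.
  by apply: cont_onM; [exact: cont_on_cst|exact: cont_on_onem_powR].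
have al2 : 0 < al / 2 by rewrite divr_gt0.
rewrite intgZ; last exact: cont_on_onem_powR.
apply: (@le_trans _ _ (C1 `^ (2 / p) * Ga `^ p^-1 * (1 - x) `^ (al / 2) *
  ((1 - x) `^ (al / 2) / (al / 2)))).
  by rewrite ler_wpM2l ?mulr_ge0 ?powR_ge0//; apply: intg_onem_powR_le => //; exact: ltW.
have -> : C1 `^ (2 / p) * Ga `^ p^-1 * (1 - x) `^ (al / 2) * ((1 - x) `^ (al / 2) / (al / 2)) =
   CB * (Ga `^ p^-1 * ((1 - x) `^ (al / 2) * (1 - x) `^ (al / 2))).
  by rewrite /CB; field; rewrite gt_eqF.
rewrite ler_wpM2l// -powRD_gt0// -splitr.
have qE : q^-1 = p^-1 + - al by rewrite /al; ring.
rewrite [X in _ <= _ `^ X]qE [leRHS]powRD_gt0// ler_wpM2l ?powR_ge0//.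
have -> : Ga `^ (- al) = Ga^-1 `^ al.
  by rewrite -(powR_inv1 (ltW Ga0)) -powRrM mulN1r.
rewrite (ge0_ler_powR (ltW al0)) ?nnegrE ?invr_ge0 ?(ltW x1) ?(ltW Ga0)//.
by rewrite xE lef_pV2 ?posrE ?mulr_gt0// ler_peMl ?(ltW Ga0)// ler1n.
Qed.

End hedberg.

(** * Boundedness of the Cesaro operator *)

Section volterra_bound.
Local Open Scope complex_scope.
Context {R : realType}.
Implicit Types (f g k : R[i] -> R[i]) (z w : R[i]) (a b p q r s t L : R).
Notation mu := (@lebesgue_measure R).

Lemma intg_dilate (h : R -> R) r : 0 < r -> cont_on h 0 r ->
  r * intg (fun t => h (t * r)) 0 1 = intg h 0 r.
Proof.
move=> r0 hc.
have dF (x : R) : is_derive x 1 (fun t => t * r) r.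
  have : is_derive x 1 (r \*: (@id R)) (r *: 1) by apply: is_deriveZ.
  rewrite (_ : r \*: id = fun t => t * r); last by apply/funext => t; rewrite /= /GRing.scale /= mulrC.
  by rewrite /GRing.scale /= mulr1.
have F'E : (fun t : R => t * r)^`()%classic = cst r.
  by apply/funext => x; rewrite derive1E; case: (dF x).
have Fc (x : R) : {for x, continuous (fun t => t * r)}.
  by have [d _] := dF x; exact/differentiable_continuous/derivable1_diffP.
have := @integration_by_substitution_increasing R (fun t => t * r) h 0 1 ler01.
rewrite mul0r mul1r F'E => H.
rewrite -[RHS]intgE /Rintegral H.
- rewrite -intgZ -?intgE /Rintegral.
    by congr fine; apply: eq_integral => t _; rewrite /= mulrC.
  move=> t /andP[t0 t1].
  apply: (@continuous_comp _ _ _ (fun t => t * r) h); first exact: Fc.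
  apply: hc; rewrite mulr_ge0 ?(ltW r0)//=.
  by rewrite ler_piMl ?(ltW r0).
- by move=> x y _ _ xy; rewrite ltr_pM2r.
- by move=> x _; exact: cvg_cst.
- exact: is_cvg_cst.
- exact: is_cvg_cst.
- split.
  + by move=> x _; case: (dF x).
  + exact/cvg_at_right_filter/Fc.
  + exact/cvg_at_left_filter/Fc.
- exact: cont_on_within.
Qed.

Lemma circle_pt_dilate r s t : s%:C * circle_pt r t = circle_pt (s * r) t.
Proof. by apply: complex_eq => /=; ring. Qed.

Lemma cont_dilated k r t : analytic_on_disc k -> 0 <= r < 1 ->
  cont_on (fun s => normc (k (circle_pt (s * r) t))) 0 1.
Proof.
move=> ka /andP[r0 r1].
have z1 : normc (circle_pt r t) < 1 by rewrite normc_circle ger0_norm.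
have := ccont_on_normc (ccont_on_segment ka z1).
by under eq_fun do rewrite circle_pt_dilate.
Qed.

Lemma cont_radial k r t : analytic_on_disc k -> r < 1 ->
  cont_on (fun s => normc (k (circle_pt s t))) 0 r.
Proof.
move=> ka r1; apply: ccont_on_normc; apply: (ccont_on_comp (f' := cderiv k)).
  by split=> s _; apply: cvgM; [exact: cvg_id|exact: cvg_cst|exact: cvg_id|exact: cvg_cst].
move=> s /andP[s0 sr]; apply: analytic_cdiff => //.
by rewrite normc_circle ger0_norm// (le_lt_trans sr).
Qed.

Lemma normc_cesaro_le g f r t : analytic_on_disc g -> analytic_on_disc f -> 0 <= r < 1 ->
  normc (cesaro_op g f (circle_pt r t)) <=
  2 * intg (fun s => normc (f (circle_pt (s * r) t)) *
    normc (cderiv g (circle_pt (s * r) t))) 0 1.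
Proof.
move=> ga fa /andP[r0 r1]; have g'a := analytic_cderiv ga.
have z1 : normc (circle_pt r t) < 1 by rewrite normc_circle ger0_norm.
rewrite cesaro_opE//.
apply: le_trans (normc_cintg (ccont_on_segment (analyticM fa g'a) z1)) _.
by under eq_intg do rewrite ComplexField.Normc.normcM circle_pt_dilate.
Qed.

Lemma normc_volterra_le g f r t : analytic_on_disc g -> analytic_on_disc f -> 0 < r < 1 ->
  normc (volterra_op g f (circle_pt r t)) <=
  2 * intg (fun s => normc (f (circle_pt s t)) * normc (cderiv g (circle_pt s t))) 0 r.
Proof.
move=> ga fa /andP[r0 r1]; have g'a := analytic_cderiv ga.
have z1 : normc (circle_pt r t) < 1 by rewrite normc_circle gtr0_norm.
rewrite volterra_cesaro// ComplexField.Normc.normcM normc_circle gtr0_norm//.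
rewrite -intg_dilate//; last by apply: cont_onM; exact: cont_radial.
rewrite mulrCA ler_wpM2l ?(ltW r0)//.
by apply: normc_cesaro_le => //; rewrite ltW.
Qed.

Lemma powR_add_le (x y a : R) : 0 <= a -> 0 <= x -> 0 <= y ->
  (x + y) `^ a <= 2 `^ a * (x `^ a + y `^ a).
Proof.
move=> a0 x0 y0; wlog xy : x y x0 y0 / x <= y => [H|].
  have [/H|/ltW yx] := leP x y; first exact.
  by rewrite addrC [X in _ * X]addrC; exact: H.
apply: (@le_trans _ _ ((2 * y) `^ a)).
  by rewrite ge0_ler_powR ?nnegrE ?addr_ge0 ?mulr_ge0//; lra.
by rewrite powRM// ler_wpM2l ?powR_ge0// lerDr powR_ge0.
Qed.

Lemma polar_weight_powR_le f p s t : 0 < p ->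
  polar_weight f s t `^ (p / 2) <= 2 `^ (p / 2) * (normc (f (circle_pt s t)) `^ p + 1).
Proof.
move=> p0; apply: le_trans (powR_add_le _ _ _) _; rewrite ?sqr_ge0 ?divr_ge0 ?(ltW p0)//.
rewrite powR1 -powR_mulrn ?normc_ge0// -powRrM.
by rewrite (_ : 2 * (p / 2) = p)//; field.
Qed.

Lemma cesaro_bound g p q L : analytic_on_disc g -> 1 <= p -> p < q -> 0 <= L ->
  (forall z, normc z < 1 ->
     normc (cderiv g z) <= L * (1 - normc z) `^ (p^-1 - q^-1 - 1)) ->
  exists2 M, 0 <= M & forall f, analytic_on_disc f ->
    (forall r, 0 <= r < 1 -> pmean p f r <= 2 * pi) ->
    forall r, 0 <= r < 1 -> pmean q (cesaro_op g f) r <= 2 * pi * M.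
Proof.
move=> ga p1 pq L0 gL; have p0 : 0 < p := lt_le_trans ltr01 p1.
have q0 : 0 < q := lt_trans p0 pq; have pi0 := @ltr0_2pi R; have pi1 := ltW pi0.
have g'a := analytic_cderiv ga.
pose P2 : R := 2 `^ (p / 2).
have P20 : 0 <= P2 by exact: powR_ge0.
(* [u^2] is at most [P2 (|f|^p + 1)], and the growth bound taken at radius [(1 + r) / 2] gives
   [|f|^p <= 4^p * 4 / (1 - s)]. *)
pose K := P2 * (4 `^ p * 4 + 1).
have K0 : 0 <= K by rewrite mulr_ge0// addr_ge0// mulr_ge0// powR_ge0.
have [C C0 HC] := hedberg p0 pq K0.
have [B B0 HB] := analytic_taylor ga (ltac:(lra) : 0 <= (2^-1 : R) < 1).
(* [MA] serves the radii below 1/2: there [|f|^p <= 4^p * 8] by the growth bound at radius 3/4, and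
   [B] bounds [g']. In [MB], the 4 is a factor 2 from the complex integral times the [1/r <= 2]
   between [V_g] and [T_g], and [1 + 2 * P2] bounds the mean of [1 + G]. *)
pose MA := (2 * (((4 `^ p * 8) `^ p^-1) * B)) `^ q.
pose MB := (4 * L * C) `^ q * (1 + 2 * P2).
exists (MA + MB); first by rewrite addr_ge0// ?powR_ge0// mulr_ge0 ?powR_ge0// addr_ge0// mulr_ge0.
move=> f fa fN r /andP[r0 r1]; have Ta := analytic_cesaro ga fa.
have r01 : 0 <= r < 1 by rewrite r0.
have cT := cont_on_normc_powR (a := 0) (b := 2 * pi) Ta q0 r01.
have [r2|r2] := ltP r 2^-1.
  apply: (@le_trans _ _ (2 * pi * MA)); last first.
    by rewrite ler_wpM2l// lerDl mulr_ge0 ?powR_ge0// addr_ge0// mulr_ge0.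
  rewrite mulrC -[2 * pi]subr0; apply: intg_ub => // t _.
  have z1 : normc (circle_pt r t) < 1 by rewrite normc_circle ger0_norm.
  rewrite /MA ge0_ler_powR ?nnegrE ?normc_ge0 ?(ltW q0)//.
    by rewrite mulr_ge0// mulr_ge0// powR_ge0.
  apply: le_trans (normc_cesaro_le t ga fa r01) _; rewrite ler_wpM2l//.
  rewrite -[leRHS]mulr1 -[X in _ <= _ * X](subr0 1); apply: intg_ub => //.
    by apply: cont_onM; exact: cont_dilated.
  move=> s /andP[s0 s1].
  have w2 : normc (circle_pt (s * r) t) <= 2^-1.
    by rewrite normc_circle ger0_norm ?mulr_ge0// (le_trans _ (ltW r2))// ler_piMl.
  rewrite ler_pM ?normc_ge0//; last by have [] := HB _ w2.
  have r34 : (3 / 4 : R) < 1 by clear; lra.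
  have G := analytic_growth fa p1 r34 (le_lt_trans w2 (ltac:(clear; lra) : 2^-1 < 3 / 4 :> R))
    (fN _ (ltac:(clear; lra) : 0 <= (3 / 4 : R) < 1)).
  have -> : normc (f (circle_pt (s * r) t)) = (normc (f (circle_pt (s * r) t)) `^ p) `^ p^-1.
    by rewrite -powRrM mulfV ?gt_eqF// powRr1// normc_ge0.
  rewrite ge0_ler_powR ?nnegrE ?powR_ge0 ?invr_ge0 ?(ltW p0)//.
  apply: le_trans G _; rewrite ler_wpM2l ?powR_ge0//.
  by rewrite ler_pdivrMr; clear -w2; lra.
have rr0 : 0 < r by apply: lt_le_trans r2; rewrite invr_gt0.
apply: (@le_trans _ _ (2 * pi * MB)); last first.
  by rewrite ler_wpM2l// lerDr powR_ge0.
(* The energy is taken up to [rho > r] because its weight vanishes at its own radius. On [[0, r]]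
   one has [rho - s >= (1 - s) / 2], so it controls the weight [1 - s] of [hedberg]. *)
pose rho := (1 + r) / 2.
have [h1 h2] : r < rho /\ rho < 1 by rewrite /rho; clear -r1; lra.
have rho0 : 0 <= rho := ltW (le_lt_trans r0 h1).
have disc s : 0 <= s <= rho -> -1 < s < 1 by clear -h2; lra.
have discr s : 0 <= s <= r -> -1 < s < 1 by clear -r1; lra.
have rho01 : 0 <= rho < 1 by rewrite rho0.
pose G t := intg (fun s => polar_energy f p rho s t) 0 rho.
have G_ge0 t : 0 <= G t.
  apply: intg_ge0 => s /andP[s0 s1]; rewrite mulr_ge0 ?sqr_ge0// mulr_ge0// mulr_ge0// subr_ge0//.
have cE t a b : -1 < a -> b < 1 -> cont_on (fun s => polar_energy f p rho s t) a b.
  move=> a0 b0 s /andP[s0 s1].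
  by apply: continuous2_fst; apply: cont_polar_energy => //; rewrite (lt_le_trans a0 s0) (le_lt_trans s1 b0).
have cG : cont_on G 0 (2 * pi).
  move=> t _; apply: cont_on_param_intg => //.
    by move=> s sr; apply: cont_polar_energy => //; exact: disc.
  by move=> y; apply: cE => //; rewrite ltrN10.
have point t : normc (cesaro_op g f (circle_pt r t)) <= 4 * L * C * (1 + G t) `^ q^-1.
  have z1 : normc (circle_pt r t) < 1 by rewrite normc_circle ger0_norm.
  have V := normc_volterra_le t ga fa (introT andP (conj rr0 r1)).
  rewrite volterra_cesaro// ComplexField.Normc.normcM normc_circle ger0_norm// in V.
  pose u s := polar_weight f s t `^ (p / 4).
  have uE s x : u s `^ x = polar_weight f s t `^ (p / 4 * x) by rewrite /u -powRrM.
  have wc s : 0 <= polar_weight f s t := ltW (polar_weight_gt0 _ _ _).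
  have H := HC u (fun s => polar_deriv f p s t) r (G t) (introT andP (conj r2 r1)).
  have {}H : intg (fun s => u s `^ (2 / p) * (1 - s) `^ (p^-1 - q^-1 - 1)) 0 r <=
      C * (1 + G t) `^ q^-1.
    apply: H.
    - by move=> s sr; apply: is_derive_polar => //; exact: discr.
    - by move=> s sr; apply: cont_polar_deriv => //; exact: discr.
    - move=> s /andP[s0 sr]; split; first by rewrite powR_gt0 ?polar_weight_gt0.
      rewrite -(powR_mulrn 2 (powR_ge0 _ _)) uE (_ : p / 4 * 2 = p / 2); last by field.
      apply: le_trans (polar_weight_powR_le _ _ _ p0) _.
      rewrite /K -mulrA ler_wpM2l// mulrDl mul1r.
      have s1 : 0 < 1 - s by rewrite subr_gt0 (le_lt_trans sr).
      have srho' : s < rho := le_lt_trans sr h1.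
      have srho : normc (circle_pt s t) = s by rewrite normc_circle ger0_norm.
      have Gr := analytic_growth (z := circle_pt s t) fa p1 h2 (ltac:(by rewrite srho)) (fN _ rho01).
      rewrite srho in Gr.
      apply: lerD; last by rewrite -[leLHS]invr1 lef_pV2 ?posrE// gerBl.
      apply: le_trans Gr _; rewrite -mulrA ler_wpM2l ?powR_ge0//.
      rewrite ler_pdivrMr ?subr_gt0//.
      by rewrite mulrAC ler_pdivlMr// /rho; clear -sr; lra.
    - apply: (@le_trans _ _ (intg (fun s => polar_energy f p rho s t) 0 r)); last first.
        apply: intg_le_sub => //; [exact: ltW|by apply: cE; rewrite ?ltrN10|].
        by move=> s /andP[s0 s1]; rewrite mulr_ge0 ?sqr_ge0// mulr_ge0// mulr_ge0// subr_ge0.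
      have cd : cont_on (fun s => polar_deriv f p s t) 0 r.
        by move=> s sr; apply: cont_polar_deriv => //; exact: discr.
      apply: le_intg => //; [|by apply: cE; rewrite ?ltrN10|].
        have h : cont_on (fun s => polar_deriv f p s t * polar_deriv f p s t * (s * (1 - s))) 0 r.
          apply: cont_onM; first exact: cont_onM.
          by apply: cont_onM; [exact: cont_on_id|apply: cont_onB; [exact: cont_on_cst|exact: cont_on_id]].
        by rewrite (_ : (fun s => _) =
          (fun s => polar_deriv f p s t * polar_deriv f p s t * (s * (1 - s))))//;
          apply/funext => s; rewrite expr2.
      move=> s /andP[s0 sr]; rewrite /polar_energy mulrC ler_wpM2r ?sqr_ge0//.
      by rewrite /rho; clear -s0 sr r1; nra.
  have bnd : intg (fun s => normc (f (circle_pt s t)) * normc (cderiv g (circle_pt s t))) 0 r <=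
      L * (C * (1 + G t) `^ q^-1).
    have cu : cont_on (fun s => u s `^ (2 / p)) 0 r.
      move=> s sr.
      apply: (@continuous_comp _ _ _ u (fun y : R => y `^ (2 / p))).
        have [d _] := is_derive_polar fa p t (discr s sr).
        exact/differentiable_continuous/derivable1_diffP.
      have [d _] := is_derive1_powR (2 / p) (powR_gt0 (p / 4) (polar_weight_gt0 f s t)).
      exact/differentiable_continuous/derivable1_diffP.
    apply: le_trans (ler_wpM2l L0 H); rewrite -intgZ; last first.
      by apply: cont_onM; [exact: cu|exact: cont_on_onem_powR].
    apply: le_intg.
      + by apply: cont_onM; exact: cont_radial.
      + apply: cont_onM; first exact: cont_on_cst.
        by apply: cont_onM; [exact: cu|exact: cont_on_onem_powR].
      move=> s /andP[s0 sr].
      rewrite mulrCA ler_pM ?normc_ge0//.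
        (* [u^(2/p)] is the square root of [|f|^2 + 1], hence at least [|f|]. *)
        rewrite uE (_ : p / 4 * (2 / p) = 2^-1); last by field; rewrite gt_eqF.
        rewrite powR12_sqrt// -[leLHS]ger0_norm ?normc_ge0// -sqrtr_sqr ler_wsqrtr//.
        by rewrite lerDl.
      have := gL (circle_pt s t); rewrite normc_circle ger0_norm//; apply; exact: le_lt_trans r1.
  move: V bnd r2; move: (normc (cesaro_op _ _ _)) (normc_ge0 (cesaro_op g f (circle_pt r t))).
  move: (intg _ _ _) (_ `^ _) => I E T T0 V bnd r2.
  have : 2^-1 * T <= r * T by rewrite ler_wpM2r.
  by move: V bnd; clear; lra.
apply: (@le_trans _ _ (intg (fun t => (4 * L * C) `^ q * (1 + G t)) 0 (2 * pi))).
  apply: le_intg => //.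
    by apply: cont_onM; [exact: cont_on_cst|apply: cont_onD => //; exact: cont_on_cst].
  move=> t _; have LC0 : 0 <= 4 * L * C by rewrite !mulr_ge0.
  have G1 : 0 <= 1 + G t by rewrite addr_ge0.
  have := ge0_ler_powR (ltW q0) _ _ (point t).
  rewrite !nnegrE normc_ge0 mulr_ge0 ?powR_ge0// => /(_ isT isT) /le_trans; apply.
  by rewrite powRM ?powR_ge0// -powRrM mulVf ?gt_eqF// powRr1.
rewrite intgZ; last by apply: cont_onD => //; exact: cont_on_cst.
rewrite intgD//; last exact: cont_on_cst.
rewrite intg_cst// mul1r subr0 /MB mulrCA ler_wpM2l ?powR_ge0//.
have HS := hardy_stein fa p0 rho01.
have cw : cont_on (fun t => normc (f (circle_pt rho t)) `^ p) 0 (2 * pi).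
  exact: cont_on_normc_powR.
have WB : intg (fun t => polar_weight f rho t `^ (p / 2)) 0 (2 * pi) <= P2 * (2 * pi + 2 * pi).
  apply: (@le_trans _ _ (intg (fun t => P2 * (normc (f (circle_pt rho t)) `^ p + 1)) 0 (2 * pi))).
    apply: le_intg.
    - by move=> t _; apply: cont_polar_weight => //; rewrite (lt_le_trans _ rho0)// ltrN10.
    - apply: cont_onM; first exact: cont_on_cst.
      by apply: cont_onD => //; exact: cont_on_cst.
    - by move=> t _; exact: polar_weight_powR_le.
  rewrite intgZ; last by apply: cont_onD => //; exact: cont_on_cst.
  rewrite intgD//; last exact: cont_on_cst.
  rewrite intg_cst// mul1r subr0 ler_wpM2l// lerD2r; exact: fN.
have : intg G 0 (2 * pi) <= P2 * (2 * pi + 2 * pi).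
  apply: le_trans HS _; apply: le_trans WB.
  by rewrite ler_piMl ?(ltW h2)//; apply: intg_ge0 => t _; exact: powR_ge0.
by clear; lra.
Qed.

End volterra_bound.

(** * A gap series outside the Hardy spaces *)

Section gap_series.
Local Open Scope complex_scope.
Context {R : realType}.
Implicit Types (f g : R[i] -> R[i]) (z w : R[i]) (a b p r s t : R) (m n k N M : nat).

(** The intervals of radius [K / 2^N] around [x N] meet pairwise, so the supremum of their left
    endpoints lies in all of them; the rate comes with the limit. *)
Lemma real_limit_geometric (x : nat -> R) K :
  (forall N M, (N <= M)%N -> `|x M - x N| <= K / 2 ^+ N) ->
  exists l, forall N, `|l - x N| <= K / 2 ^+ N.
Proof.
move=> H; pose lo N := x N - K / 2 ^+ N; pose hi N := x N + K / 2 ^+ N.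
have K0 N : 0 <= K / 2 ^+ N by have := H N N (leqnn N); rewrite subrr normr0.
have lohi i j : lo i <= hi j.
  have [ij|/ltnW ji] := leqP i j.
    by have := H _ _ ij; have := K0 j; rewrite /lo /hi ler_norml; lra.
  by have := H _ _ ji; have := K0 i; rewrite /lo /hi ler_norml; lra.
exists (sup (range lo)) => N; rewrite ler_distl; apply/andP; split.
  apply: ub_le_sup; last by exists N.
  by exists (hi 0%N) => _ [i _ <-]; exact: lohi.
by apply: ge_sup; [exists (lo 0%N), 0%N|move=> _ [i _ <-]; exact: lohi].
Qed.

Lemma geometric_small (K e : R) : 0 <= K -> 0 < e -> exists N, K / 2 ^+ N <= e.
Proof.
move=> K0 e0; exists (Num.bound (K / e)).
rewrite ler_pdivrMr ?exprn_gt0// mulrC -ler_pdivrMr//.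
apply: le_trans (ltW (archi_boundP _)) _; first by rewrite divr_ge0// ltW.
by rewrite -natrX ler_nat ltnW// ltn_expl.
Qed.

(** Comparing [n] copies of [s^n] with a geometric sum gives [n s^n (1 - s) <= 1]. With
    [y = n (1 - s)] this reads [s^n <= 1/y], and [1/y <= y^(-b)] when [y > 1]; for [y <= 1] the
    right-hand side is at least 1. *)
Lemma exprn_weight_le s n b : 0 <= s < 1 -> (0 < n)%N -> 0 <= b <= 1 ->
  s ^+ n <= n%:R `^ (- b) * (1 - s) `^ (- b).
Proof.
move=> /andP[s0 s1] n0 /andP[b0 b1]; have s1' : 0 < 1 - s by lra.
have n0' : 0 < n%:R :> R by rewrite ltr0n.
have H : n%:R * s ^+ n * (1 - s) <= 1.
  have /(_ n) : forall n, n%:R * s ^+ n * (1 - s) <= 1 - s ^+ n.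
    elim=> [|j IH]; first by rewrite !mul0r expr0 subrr.
    have sj : 0 <= s ^+ j by rewrite exprn_ge0.
    have h1 := ler_wpM2l s0 IH.
    have h2 : s * s ^+ j * (1 - s) <= 1 * (1 - s).
      by rewrite ler_wpM2r ?(ltW s1')// mulr_ile1 ?exprn_ile1// ltW.
    rewrite -natr1 exprS; lra.
  by move=> /le_trans; apply; rewrite gerBl exprn_ge0.
have y0 : 0 < n%:R * (1 - s) by rewrite mulr_gt0.
rewrite -powRM ?(ltW n0') ?(ltW s1')//; set y := n%:R * (1 - s) in y0 *.
have [y1|y1] := leP y 1.
  apply: (@le_trans _ _ 1); first by rewrite exprn_ile1// ltW.
  rewrite powRN -[leLHS]invr1 lef_pV2 ?posrE ?powR_gt0//.
  by have := ge0_ler_powR b0 _ _ y1; rewrite powR1; apply; rewrite nnegrE// ltW.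
apply: (@le_trans _ _ y^-1).
  by rewrite -[leRHS]mul1r ler_pdivlMr// /y mulrA [s ^+ n * _]mulrC.
rewrite powRN lef_pV2 ?posrE ?powR_gt0//.
by rewrite -[leRHS]powRr1 ?(ltW y0)// ler_powR// ltW.
Qed.

(** The power [-1/m] of this exponent is [4^(-k)]: by [exprn_weight_le], the term with coefficient
    [2^k] is then at most [2^(-k)] times [gap_weight]. *)
Definition gap_exp m k := ((4 ^ m) ^ k)%N.

Definition gap_sum m N z : R[i] := \sum_(k < N) (2 ^+ k)%:C * z ^+ gap_exp m k.

Definition gap_weight m z : R := (1 - normc z) `^ (- m%:R^-1).

Lemma gap_term_le m k z : (0 < m)%N -> normc z < 1 ->
  normc ((2 ^+ k)%:C * z ^+ gap_exp m k) <= gap_weight m z / 2 ^+ k.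
Proof.
move=> m0 z1; rewrite normcC_scale ?exprn_ge0// normcX.
have m0' : 0 < m%:R :> R by rewrite ltr0n.
have := @exprn_weight_le (normc z) (gap_exp m k) m%:R^-1.
rewrite normc_ge0 z1 expn_gt0 expn_gt0 /= invr_ge0 (ltW m0') => /(_ isT isT).
rewrite invf_le1// ler1n => /(_ m0) H.
apply: (@le_trans _ _ (2 ^+ k * ((gap_exp m k)%:R `^ (- m%:R^-1) * (1 - normc z) `^ (- m%:R^-1)))).
  by rewrite ler_wpM2l// exprn_ge0.
have -> : (gap_exp m k)%:R `^ (- m%:R^-1) = (4 ^+ k)^-1 :> R.
  rewrite powRN; congr (_^-1); rewrite /gap_exp -expnM mulnC expnM natrX natrX.
  rewrite -powR_mulrn ?exprn_ge0// -powRrM mulfV ?gt_eqF// powRr1 ?exprn_ge0//.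
rewrite /gap_weight mulrA mulrC ler_wpM2l ?powR_ge0//.
rewrite (_ : 4 = 2 * 2 :> R); last by ring.
by rewrite exprMn invfM mulrA divff ?mul1r// gt_eqF ?exprn_gt0.
Qed.

Lemma gap_sum_cauchy m N M z : (0 < m)%N -> normc z < 1 -> (N <= M)%N ->
  normc (gap_sum m M z - gap_sum m N z) <= 2 * gap_weight m z / 2 ^+ N.
Proof.
move=> m0 z1 /subnK <-; set j := (M - N)%N.
have w0 : 0 <= gap_weight m z by exact: powR_ge0.
(* Subtracting the tail that is still to come strengthens the bound enough for an induction on
   [j]. *)
suff : normc (gap_sum m (j + N) z - gap_sum m N z) <=
    2 * gap_weight m z / 2 ^+ N - 2 * gap_weight m z / 2 ^+ (j + N).
  by move=> /le_trans; apply; rewrite gerBl divr_ge0 ?exprn_ge0// mulr_ge0.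
elim: j => [|j IH]; first by rewrite add0n !subrr ComplexField.Normc.normc0.
rewrite addSn /gap_sum big_ord_recr /= -/(gap_sum m (j + N) z) -/(gap_sum m N z).
rewrite addrAC; apply: le_trans (normcD _ _) _.
have := gap_term_le (j + N) m0 z1; move: IH.
have -> : 2 * gap_weight m z / 2 ^+ (j + N).+1 = gap_weight m z / 2 ^+ (j + N).
  by rewrite exprS invfM mulrACA mulfV// mul1r.
rewrite -[2 * gap_weight m z / 2 ^+ (j + N)]mulrA; lra.
Qed.

(** The sum is characterised by its rate of convergence alone: [N = 0] gives the growth bound, large
    [N] uniform approximation on smaller discs. The constant 4 adds the rates of the real and the
    imaginary part. *)
Lemma exists_gap_series m : (0 < m)%N -> exists f : R[i] -> R[i],
  forall z, normc z < 1 -> forall N, normc (f z - gap_sum m N z) <= 4 * gap_weight m z / 2 ^+ N.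
Proof.
move=> m0; suff /choice[f fP] : forall z, exists w, normc z < 1 -> forall N,
  normc (w - gap_sum m N z) <= 4 * gap_weight m z / 2 ^+ N by exists f.
move=> z.
(* Outside the disc the value 0 is a placeholder. *)
have [z1|] := boolP (normc z < 1); last by exists 0.
have [u uP] := @real_limit_geometric (fun N => complex.Re (gap_sum m N z))
  (2 * gap_weight m z) (fun N M NM => ltac:(rewrite -ReB;
    exact: le_trans (ler_Re_normc _) (gap_sum_cauchy m0 z1 NM))).
have [v vP] := @real_limit_geometric (fun N => complex.Im (gap_sum m N z))
  (2 * gap_weight m z) (fun N M NM => ltac:(rewrite -ImB;
    exact: le_trans (ler_Im_normc _) (gap_sum_cauchy m0 z1 NM))).
exists (u +i* v) => _ N; apply: le_trans (normc_le_ReIm _) _; rewrite ReB ImB /=.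
have := uP N; have := vP N; rewrite -!mulrA; lra.
Qed.

Lemma analytic_gap_sum m N : analytic_on_disc (@gap_sum m N).
Proof.
elim: N => [|N IH].
  apply: (analytic_ext (f := fun=> 0)) => [z _|]; first by rewrite /gap_sum big_ord0.
  exact: analytic_cst.
pose c : R[i] := (2 ^+ N)%:C.
have ta : analytic_on_disc (fun z : R[i] => c * z ^+ gap_exp m N).
  exact: (@analyticM R (fun=> c) (fun z => z ^+ gap_exp m N) (@analytic_cst R c) (@analyticX R (gap_exp m N))).
apply: (analytic_ext (f := fun z => gap_sum m N z + c * z ^+ gap_exp m N)) => [z _|].
  by rewrite /gap_sum big_ord_recr.
exact: (analyticD IH ta).
Qed.

Lemma gap_weight_le m z rho : normc z <= rho -> rho < 1 ->
  gap_weight m z <= (1 - rho) `^ (- m%:R^-1).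
Proof.
move=> zr r1; have r1' : 0 < 1 - rho by lra.
have z1' : 0 < 1 - normc z by lra.
rewrite /gap_weight !powRN lef_pV2 ?posrE ?powR_gt0//.
rewrite ge0_ler_powR ?nnegrE ?invr_ge0 ?ler0n ?(ltW r1') ?(ltW z1')//; lra.
Qed.

(** Valid at every point, whereas [analyticX] stops at the open disc: monomials are averaged over
    the unit circle below. *)
Lemma cdiffX n z : cdiff (fun w => w ^+ n) z (cderiv (fun w => w ^+ n) z).
Proof.
have [d dP] : exists d, cdiff (fun w => w ^+ n) z d.
  elim: n => [|n [d IH]]; first by exists 0; exact: cdiff_cst.
  exists (1 * z ^+ n + z * d).
  apply: (cdiff_near (f := fun w => w * w ^+ n) (del := 1)) => //.
    by move=> h _; rewrite exprS.
  exact: (cdiffM (cdiff_id z) IH).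
by rewrite (cderivE dP).
Qed.

Lemma circle_pt_unit t : circle_pt 1 t * (circle_pt 1 t)^* = 1 :> R[i].
Proof. by have := @circle_pt_inv R 1 t (oner_neq0 R); rewrite invr1. Qed.

(** Once the common power is cancelled, a power of the point or of its conjugate is left; if its
    degree is positive, the mean value property makes its integral 0. *)
Lemma cintg_circle_monomial r n m : 0 < r ->
  cintg (fun t => circle_pt r t ^+ n * (circle_pt 1 t)^* ^+ m) 0 (2 * pi) =
  if n == m then (2 * pi * r ^+ n)%:C else 0.
Proof.
move=> r0; have pi1 := ltW (@ltr0_2pi R).
have unit j t : circle_pt r t ^+ j * (circle_pt 1 t)^* ^+ j = (r ^+ j)%:C.
  by rewrite -exprMn circle_pt_real -mulrA circle_pt_unit mulr1 -rmorphXn.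
have mono s j : 0 < s -> (0 < j)%N -> cintg (fun t => circle_pt s t ^+ j) 0 (2 * pi) = 0.
  move=> s0 j0; rewrite (mean_value (f := fun w => w ^+ j) s0 (fun w _ => cdiffX j w)).
  by rewrite expr0n gtn_eqF// mulr0.
have cc s j : ccont_on (fun t => circle_pt s t ^+ j) 0 (2 * pi).
  exact/ccont_on_exp/ccont_on_circle.
case: (ltngtP n m) => nm.
- rewrite (eq_cintg (k := fun t => (r ^+ n)%:C * (circle_pt 1 t ^+ (m - n))^*)).
    rewrite cintgZ; last exact: ccont_on_conj.
    by rewrite cintg_conj// mono ?subn_gt0// conjc0 mulr0.
  by move=> t _; rewrite -{1}(subnKC (ltnW nm)) exprD mulrA unit [X in _ = _ * X]rmorphXn.
- rewrite (eq_cintg (k := fun t => (r ^+ m)%:C * circle_pt r t ^+ (n - m))).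
    by rewrite cintgZ// mono ?subn_gt0// mulr0.
  by move=> t _; rewrite -{1}(subnK (ltnW nm)) exprD -mulrA unit mulrC.
- rewrite nm (eq_cintg (k := fun=> (r ^+ m)%:C)); last by move=> t _; exact: unit.
  by rewrite cintg_cst// subr0 -rmorphM.
Qed.

Lemma cintg_gap_sum m N k r : (0 < m)%N -> 0 < r ->
  cintg (fun t => gap_sum m N (circle_pt r t) * (circle_pt 1 t)^* ^+ gap_exp m k) 0 (2 * pi) =
  if (k < N)%N then (2 * pi * (2 ^+ k * r ^+ gap_exp m k))%:C else 0.
Proof.
move=> m0 r0; have pi1 := ltW (@ltr0_2pi R).
have ce : ccont_on (fun t => (circle_pt 1 t)^* ^+ gap_exp m k) 0 (2 * pi).
  exact/ccont_on_exp/ccont_on_conj/ccont_on_circle.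
have cm j : ccont_on (fun t => circle_pt r t ^+ j * (circle_pt 1 t)^* ^+ gap_exp m k) 0 (2 * pi).
  by apply: ccont_onM => //; exact/ccont_on_exp/ccont_on_circle.
have cs n : ccont_on (fun t => gap_sum m n (circle_pt r t)) 0 (2 * pi).
  elim: n => [|n IH].
    have -> : (fun t => gap_sum m 0 (circle_pt r t)) = (fun=> 0).
      by apply/funext => t; rewrite /gap_sum big_ord0.
    exact: ccont_on_cst.
  have -> : (fun t => gap_sum m n.+1 (circle_pt r t)) =
    (fun t => gap_sum m n (circle_pt r t) + (2 ^+ n)%:C * circle_pt r t ^+ gap_exp m n).
    by apply/funext => t; rewrite /gap_sum big_ord_recr.
  apply: ccont_onD => //; apply: ccont_onM; first exact: ccont_on_cst.
  exact/ccont_on_exp/ccont_on_circle.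
elim: N => [|N IH].
  rewrite (eq_cintg (k := fun=> 0)) ?cintg_cst ?mulr0// => t _.
  by rewrite /gap_sum big_ord0 mul0r.
rewrite (eq_cintg (k := fun t => gap_sum m N (circle_pt r t) * (circle_pt 1 t)^* ^+ gap_exp m k +
  (2 ^+ N)%:C * (circle_pt r t ^+ gap_exp m N * (circle_pt 1 t)^* ^+ gap_exp m k))); last first.
  by move=> t _; rewrite /gap_sum big_ord_recr mulrDl mulrA.
rewrite cintgD; [|exact: ccont_onM|by apply: ccont_onM => //; exact: ccont_on_cst].
rewrite IH cintgZ// cintg_circle_monomial// /gap_exp eqn_exp2l ?(ltn_exp2l 0)//.
rewrite ltnS [in RHS]leq_eqVlt [N == k]eq_sym; case: eqP => [->|_] /=.
  by rewrite ltnn add0r -rmorphM mulrCA.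
by rewrite mulr0 addr0.
Qed.

(** Provides a radius at which the term of degree [n] keeps half of its size. The [n.+1] in [x]
    covers [n = 0]. *)
Lemma bernoulli_half n : exists2 r : R, 0 < r < 1 & 2^-1 <= r ^+ n.
Proof.
pose x : R := (2 * n.+1%:R)^-1.
have n0 : 0 < n.+1%:R :> R by rewrite ltr0n.
have x0 : 0 < x by rewrite invr_gt0 mulr_gt0.
have xn : n.+1%:R * x = 2^-1 by rewrite /x invfM mulrCA mulfV ?mulr1// gt_eqF.
have x1 : x <= 2^-1 by rewrite -xn ler_peMl ?(ltW x0)// ler1n.
have H j : 1 - j%:R * x <= (1 - x) ^+ j.
  elim: j => [|j IH]; first by rewrite mul0r subr0 expr0.
  have jx : 0 <= j%:R * x * x by rewrite !mulr_ge0// ltW.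
  rewrite -natr1 exprS; nra.
exists (1 - x); first by lra.
apply: le_trans (H n); move: xn; rewrite -natr1; lra.
Qed.

(** Integration against the conjugate power isolates the coefficient [2^k], while bounded means of
    [|f|^p] bound that integral independently of [k]. *)
Lemma gap_series_not_hardy m p f : (0 < m)%N -> 1 <= p -> analytic_on_disc f ->
  (forall z, normc z < 1 -> forall N, normc (f z - gap_sum m N z) <= 4 * gap_weight m z / 2 ^+ N) ->
  ~ hardy p f.
Proof.
move=> m0 p1 fa fS; have p0 : 0 < p := lt_le_trans ltr01 p1.
move=> /(hardyP f p0)[_ [B B0 fB]]; have pi0 := @ltr0_2pi R; have pi1 := ltW pi0.
have E k : 2 ^+ k <= 4 * (2 + B `^ p).
  have [r /andP[r0 r1] rk] := bernoulli_half (gap_exp m k).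
  have r01 : 0 <= r < 1 by rewrite ltW.
  have w0 : 0 <= 4 * (1 - r) `^ (- m%:R^-1) by rewrite mulr_ge0// powR_ge0.
  have [N0 N0P] := geometric_small w0 ltr01.
  (* [k.+1] terms make the coefficient of index [k] present; [N0] terms bring the partial sum within
     1 of [f] on the circle. *)
  pose N := maxn k.+1 N0.
  have NP t : normc (f (circle_pt r t) - gap_sum m N (circle_pt r t)) <= 1.
    have n1 : normc (circle_pt r t) <= r by rewrite normc_circle gtr0_norm.
    apply: le_trans (fS _ (le_lt_trans n1 r1) N) _; apply: le_trans N0P.
    apply: ler_pM; rewrite ?invr_ge0 ?exprn_ge0 ?mulr_ge0 ?powR_ge0//.
      by rewrite ler_wpM2l// gap_weight_le.
    by rewrite lef_pV2 ?posrE ?exprn_gt0// ler_weXn2l ?leq_maxr// ler1n.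
  have ce : ccont_on (fun t => (circle_pt 1 t)^* ^+ gap_exp m k) 0 (2 * pi).
    exact/ccont_on_exp/ccont_on_conj/ccont_on_circle.
  have ne t : normc ((circle_pt 1 t)^* ^+ gap_exp m k) = 1.
    by rewrite normcX normc_conj normc_circle normr1 expr1n.
  have cf : ccont_on (fun t => f (circle_pt r t)) 0 (2 * pi).
    exact: (ccont_on_circle_comp 0 (2 * pi) fa r01).
  have cS : ccont_on (fun t => gap_sum m N (circle_pt r t)) 0 (2 * pi).
    exact: (ccont_on_circle_comp 0 (2 * pi) (@analytic_gap_sum m N) r01).
  have I1 : normc (cintg (fun t => f (circle_pt r t) * (circle_pt 1 t)^* ^+ gap_exp m k) 0 (2 * pi)) <=
      2 * (2 * pi + 2 * pi * B `^ p).
    apply: le_trans (normc_cintg (ccont_onM cf ce)) _; rewrite ler_wpM2l//.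
    have cp := cont_on_normc_powR (a := 0) (b := 2 * pi) fa p0 r01.
    apply: (@le_trans _ _ (intg (fun t => 1 + normc (f (circle_pt r t)) `^ p) 0 (2 * pi))).
      apply: le_intg; first exact/ccont_on_normc/ccont_onM.
        by apply: cont_onD => //; exact: cont_on_cst.
      move=> t _; rewrite ComplexField.Normc.normcM ne mulr1.
      (* For [p >= 1] the bound [|f| <= 1 + |f|^p] does the work of Holder's inequality. *)
      have [f1|f1] := leP (normc (f (circle_pt r t))) 1.
        by rewrite (le_trans f1)// lerDl powR_ge0.
      by rewrite (le_trans (le1r_powR (ltW f1) p1))// lerDr.
    rewrite intgD//; last exact: cont_on_cst.
    by rewrite intg_cst// mul1r subr0 lerD2l; exact: fB.
  have I2 : normc (cintg (fun t => f (circle_pt r t) * (circle_pt 1 t)^* ^+ gap_exp m k) 0 (2 * pi) -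
      cintg (fun t => gap_sum m N (circle_pt r t) * (circle_pt 1 t)^* ^+ gap_exp m k) 0 (2 * pi)) <=
      2 * 1 * (2 * pi - 0).
    have c1 := ccont_onM cf ce; have c2 := ccont_onM cS ce.
    rewrite -cintgB//; apply: normc_cintg_bound => //.
      have := ccont_onD c1 (ccont_onM (ccont_on_cst (-1) 0 (2 * pi)) c2).
      by under [X in ccont_on X]eq_fun do rewrite mulN1r.
    by move=> t _; rewrite -mulrBl ComplexField.Normc.normcM ne mulr1; exact: NP.
  rewrite cintg_gap_sum// leq_maxl in I2.
  have := normc_triangle ((2 * pi * (2 ^+ k * r ^+ gap_exp m k))%:C)
    (cintg (fun t => f (circle_pt r t) * (circle_pt 1 t)^* ^+ gap_exp m k) 0 (2 * pi)).
  rewrite -[X in _ <= X](normcN) opprB.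
  rewrite normc_real ger0_norm; last by rewrite mulr_ge0// mulr_ge0 ?exprn_ge0// ltW.
  move: I1 I2; move: (normc (cintg _ _ _)) (normc (cintg _ _ _ - _)) => x y I1 I2 I3.
  have : 2 * pi * (2 ^+ k * 2^-1) <= 2 * pi * (2 ^+ k * r ^+ gap_exp m k).
    by rewrite ler_wpM2l// ler_wpM2l// exprn_ge0.
  move=> I4; have : 2 * pi * (2 ^+ k * 2^-1) <= 2 * pi * (2 * (2 + B `^ p)) by lra.
  by rewrite ler_pM2l//; lra.
have [N NP] := geometric_small (mulr_ge0 (ler0n R 4) (addr_ge0 (ler0n R 2) (powR_ge0 B p))) (ltac:(by rewrite invr_gt0) : 0 < (2^-1 : R)).
rewrite ler_pdivrMr ?exprn_gt0// in NP.
have := E N; have : 0 < 2 ^+ N :> R by rewrite exprn_gt0.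
lra.
Qed.

End gap_series.

(** * Optimal domains *)

Section optimal_domains.
Local Open Scope complex_scope.
Context {R : realType}.
Implicit Types (f g h : R[i] -> R[i]) (z w : R[i]) (p q r s t L N : R).

(** Here [p] is a constant factor; the exponent is [q]. *)
Lemma le_pmean f h p q r : 0 < q -> analytic_on_disc f -> analytic_on_disc h -> 0 <= r < 1 ->
  (forall t, normc (f (circle_pt r t)) <= p * normc (h (circle_pt r t))) -> 0 <= p ->
  pmean q f r <= p `^ q * pmean q h r.
Proof.
move=> q0 fa ha r01 H p0.
rewrite -intgZ; last exact: cont_on_normc_powR.
apply: le_intg; [exact: cont_on_normc_powR| |].
  by apply: cont_onM; [exact: cont_on_cst|exact: cont_on_normc_powR].
move=> t _; rewrite -powRM ?normc_ge0// ge0_ler_powR ?nnegrE ?normc_ge0 ?(ltW q0)//.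
by rewrite mulr_ge0 ?normc_ge0.
Qed.

Lemma pmean_volterra_le g f q r : 0 < q -> analytic_on_disc g -> analytic_on_disc f ->
  0 <= r < 1 -> pmean q (volterra_op g f) r <= pmean q (cesaro_op g f) r.
Proof.
move=> q0 ga fa r01; rewrite -[leRHS]mul1r -[X in X * _](_ : 1 `^ q = 1); last by rewrite powR1.
apply: (le_pmean q0 (analytic_volterra ga fa) (analytic_cesaro ga fa) r01) => // t.
have /andP[r0 r1] := r01; rewrite mul1r volterra_cesaro//; last first.
  by rewrite normc_circle ger0_norm.
rewrite ComplexField.Normc.normcM ler_piMl ?normc_ge0// normc_circle ger0_norm//.
exact: ltW.
Qed.

(** Since [V_g f = z T_g f], the two moduli agree up to a factor 2 for [|z| >= 1/2]; on the smaller
    disc [T_g f] is bounded because it is analytic. The norm bound [2 * N + B] covers both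
    ranges. *)
Lemma optimal_domain_volterra_cesaro g q : 0 < q -> analytic_on_disc g ->
  optimal_domain (volterra_op g) (hardy q) = optimal_domain (cesaro_op g) (hardy q).
Proof.
move=> q0 ga; have pi1 := ltW (@ltr0_2pi R).
apply/seteqP; split=> f [fa /(hardyP _ q0)[_ [N N0 H]]]; (split; first exact: fa);
    apply/(hardyP _ q0).
  have Ta := analytic_cesaro ga fa; have Va := analytic_volterra ga fa.
  split; first exact: Ta.
  have [B B0 HB] := analytic_taylor Ta (ltac:(lra) : 0 <= (2^-1 : R) < 1).
  exists (2 * N + B); first by lra.
  move=> r r01; have /andP[r0 r1] := r01; have [r2|r2] := ltP r 2^-1.
    apply: (@le_trans _ _ (2 * pi * B `^ q)); last first.
      by rewrite ler_wpM2l// ge0_ler_powR ?nnegrE ?addr_ge0 ?mulr_ge0 ?(ltW q0)// lerDr mulr_ge0.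
    rewrite mulrC -[2 * pi]subr0; apply: intg_ub => //; first exact: (cont_on_normc_powR Ta q0 r01).
    move=> t _; rewrite ge0_ler_powR ?nnegrE ?normc_ge0 ?(ltW q0)//.
    by have [] // := HB (circle_pt r t) (ltac:(rewrite normc_circle ger0_norm//; lra)).
  apply: (@le_trans _ _ (2 `^ q * pmean q (volterra_op g f) r)).
    apply: (le_pmean q0 Ta Va r01) => // t; rewrite volterra_cesaro//; last first.
      by rewrite normc_circle ger0_norm.
    rewrite ComplexField.Normc.normcM normc_circle ger0_norm// mulrA.
    by rewrite ler_peMl ?normc_ge0//; lra.
  apply: (@le_trans _ _ (2 * pi * (2 * N) `^ q)).
    by rewrite powRM// mulrCA ler_wpM2l ?powR_ge0//; exact: H.
  by rewrite ler_wpM2l// ge0_ler_powR ?nnegrE ?addr_ge0 ?mulr_ge0 ?(ltW q0)// lerDl.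
split; first exact: analytic_volterra.
exists N; first exact: N0.
by move=> r r01; apply: le_trans (H r r01); exact: pmean_volterra_le.
Qed.

Lemma cesaro_op_scale g f (c : R[i]) z : analytic_on_disc g -> analytic_on_disc f ->
  normc z < 1 -> cesaro_op g (fun w => c * f w) z = c * cesaro_op g f z.
Proof.
move=> ga fa z1; have cfa := analyticM (@analytic_cst R c) fa.
rewrite !cesaro_opE// -cintgZ; last exact: ccont_on_segment (analyticM fa (analytic_cderiv ga)) z1.
by apply: eq_cintg => t _; rewrite mulrA.
Qed.

(** Any positive bound [N] serves in place of the norm, so the rescaling by [1/N] never divides by
    zero. *)
Lemma cesaro_hardy_bound g p q L : analytic_on_disc g -> 1 <= p -> p < q -> 0 <= L ->
  (forall z, normc z < 1 ->
     normc (cderiv g z) <= L * (1 - normc z) `^ (p^-1 - q^-1 - 1)) ->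
  exists2 A, 0 <= A & forall f N, analytic_on_disc f -> 0 < N ->
    (forall r, 0 <= r < 1 -> pmean p f r <= 2 * pi * N `^ p) ->
    forall r, 0 <= r < 1 -> pmean q (cesaro_op g f) r <= 2 * pi * (A * N) `^ q.
Proof.
move=> ga p1 pq L0 gL; have p0 : 0 < p := lt_le_trans ltr01 p1.
have q0 : 0 < q := lt_trans p0 pq; have pi1 := ltW (@ltr0_2pi R).
have [M M0 HM] := cesaro_bound ga p1 pq L0 gL.
exists (M `^ q^-1); first exact: powR_ge0.
move=> f N fa N0 fN r r01; pose c : R[i] := (N^-1)%:C; pose h w := c * f w.
have Ni0 : 0 <= N^-1 by rewrite invr_ge0 ltW.
have ha : analytic_on_disc h by exact: (analyticM (@analytic_cst R c) fa).
have hN s : 0 <= s < 1 -> pmean p h s <= 2 * pi.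
  move=> s01; apply: (@le_trans _ _ (N^-1 `^ p * pmean p f s)).
    by apply: (le_pmean p0 ha fa s01) => // t; rewrite /h normcC_scale.
  apply: le_trans (ler_wpM2l (powR_ge0 _ _) (fN s s01)) _.
  by rewrite mulrCA -powRM ?(ltW N0)// mulVf ?gt_eqF// powR1 mulr1.
apply: (@le_trans _ _ (N `^ q * pmean q (cesaro_op g h) r)).
  apply: (le_pmean q0 (analytic_cesaro ga fa) (analytic_cesaro ga ha) r01 _ (ltW N0)) => t.
  have /andP[r0 r1] := r01.
  rewrite cesaro_op_scale//; last by rewrite normc_circle ger0_norm.
  by rewrite normcC_scale// mulrA mulfV ?gt_eqF// mul1r.
apply: le_trans (ler_wpM2l (powR_ge0 _ _) (HM h ha hN r r01)) _.
rewrite powRM ?powR_ge0 ?(ltW N0)// -powRrM mulVf ?gt_eqF// powRr1//.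
by rewrite mulrCA [N `^ q * M]mulrC.
Qed.

Lemma lipschitz_cderiv_le g al : lipschitz_space al g -> exists2 L : R, 0 <= L &
  forall z, normc z < 1 -> normc (cderiv g z) <= L * (1 - normc z) `^ (al - 1).
Proof.
move=> [ga]; set S := ereal_sup _ => Sfin.
have ub z : normc z < 1 -> ((lipschitz_weight al g z)%:E <= S)%E.
  by move=> z1; apply: ereal_sup_ubound; exists z.
have S0 : (0 <= S)%E.
  apply: le_trans (ub 0 _); last by rewrite ComplexField.Normc.normc0.
  by rewrite lee_fin mulr_ge0 ?powR_ge0 ?normc_ge0.
exists (fine S); first exact: fine_ge0.
move=> z z1; have := ub z z1.
have Sf : S \is a fin_num by rewrite ge0_fin_numE.
rewrite -(fineK Sf) lee_fin /lipschitz_weight.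
have z1' : 0 < 1 - normc z by rewrite subr_gt0.
by rewrite -[al - 1]opprB powRN ler_pdivlMr ?powR_gt0// mulrC.
Qed.

(** Near the boundary the weight is below 1. On the remaining disc [g'] is bounded, and [al <= 1]
    bounds the factor [(1 - |z|)^(1 - al)] by 1. *)
Lemma little_lipschitz_space_sub al g : al <= 1 -> little_lipschitz_space al g ->
  lipschitz_space al g.
Proof.
move=> al1 [ga H]; split; first exact: ga.
have [d d0 Hd] := H 1 ltr01.
pose rho := Num.max 0 (1 - d / 2).
have rho0 : 0 <= rho by rewrite le_max lexx.
have rho1 : rho < 1 by rewrite gt_max ltr01 /=; lra.
have [C C0 HC] := analytic_taylor ga (introT andP (conj rho0 rho1)).
apply: le_lt_trans (ltry (Num.max 1 C)); apply: ge_ereal_sup => _ [z z1 <-].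
rewrite lee_fin le_max; have [zr|rz] := leP (normc z) rho.
  have [_ gC _] := HC z zr; apply/orP; right.
  rewrite -[leRHS]mul1r ler_pM ?powR_ge0 ?normc_ge0//.
  have n0 := normc_ge0 z.
  have h0 : 0 <= 1 - normc z by move: z1; rewrite /unit_disc /=; lra.
  have h1 : 1 - normc z <= 1 by lra.
  have al0 : 0 <= 1 - al by lra.
  by have := ge0_ler_powR al0 _ _ h1; rewrite powR1; apply; rewrite nnegrE.
apply/orP; left; apply/ltW/Hd; rewrite z1 andbT.
by apply: le_lt_trans rz; rewrite le_max; apply/orP; right; lra.
Qed.

(** Only finiteness is at stake, so the crude inequality [powR_add_le] does the work of
    Minkowski's. *)
Lemma hardy_linear_subspace p : 0 < p -> linear_subspace (@hardy R p).
Proof.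
move=> p0; have pi1 := ltW (@ltr0_2pi R); split.
  apply/(hardyP _ p0); split; first exact: analytic_cst.
  exists 1 => // r _; rewrite /pmean.
  rewrite (eq_intg (f := fun=> 0)) => [|t _]; last first.
    by rewrite ComplexField.Normc.normc0 powR0// gt_eqF.
  by rewrite intg_cst// mul0r mulr_ge0// powR_ge0.
move=> c f h /(hardyP _ p0)[fa [N N0 fN]] /(hardyP _ p0)[ha [M M0 hM]].
apply/(hardyP _ p0); have cfa := analyticM (@analytic_cst R c) fa.
have sa := analyticD cfa ha; split; first exact: sa.
pose B := 2 `^ p * ((normc c * N) `^ p + M `^ p).
have B0 : 0 <= B by rewrite mulr_ge0 ?addr_ge0 ?powR_ge0.
exists (B `^ p^-1); first exact: powR_ge0.
move=> r r01; rewrite -powRrM mulVf ?gt_eqF// powRr1//.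
have cf := cont_on_normc_powR (a := 0) (b := 2 * pi) fa p0 r01.
have ch := cont_on_normc_powR (a := 0) (b := 2 * pi) ha p0 r01.
have c0 := normc_ge0 c.
apply: (@le_trans _ _ (intg (fun t => 2 `^ p * (normc c `^ p * normc (f (circle_pt r t)) `^ p +
    normc (h (circle_pt r t)) `^ p)) 0 (2 * pi))).
  have k u : cont_on (fun=> u : R) 0 (2 * pi) by exact: cont_on_cst.
  apply: le_intg; [exact: (cont_on_normc_powR sa p0 r01)| |].
    by apply: cont_onM => //; apply: cont_onD => //; exact: cont_onM.
  move=> t _; apply: (@le_trans _ _ ((normc c * normc (f (circle_pt r t)) +
      normc (h (circle_pt r t))) `^ p)).
    rewrite ge0_ler_powR ?nnegrE ?normc_ge0 ?addr_ge0 ?mulr_ge0 ?normc_ge0 ?(ltW p0)//.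
    by rewrite (le_trans (normcD _ _))// ComplexField.Normc.normcM.
  rewrite -powRM ?normc_ge0//; apply: powR_add_le; rewrite ?mulr_ge0 ?normc_ge0//.
  exact: ltW.
have k u : cont_on (fun=> u : R) 0 (2 * pi) by exact: cont_on_cst.
rewrite intgZ; last by apply: cont_onD => //; exact: cont_onM.
rewrite intgD//; last exact: cont_onM.
rewrite intgZ// /B mulrCA ler_wpM2l ?powR_ge0// [leRHS]mulrDr lerD//; last exact: hM.
by rewrite powRM// mulrCA ler_wpM2l ?powR_ge0//; exact: fN.
Qed.

Lemma gap_series_in_optimal_domain g f m al q L C : analytic_on_disc g -> analytic_on_disc f ->
  0 < q -> (0 < m)%N -> m%:R^-1 < al -> 0 <= L -> 0 <= C ->
  (forall z, normc z < 1 -> normc (cderiv g z) <= L * (1 - normc z) `^ (al - 1)) ->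
  (forall z, normc z < 1 -> normc (f z) <= C * gap_weight m z) ->
  optimal_domain (volterra_op g) (hardy q) f.
Proof.
move=> ga fa q0 m0 mal L0 C0 gL fC; split; first exact: fa.
have pi1 := ltW (@ltr0_2pi R).
have Va := analytic_volterra ga fa; apply/(hardyP _ q0); split; first exact: Va.
set b := m%:R^-1 in mal.
have alb : 0 < al - b by rewrite subr_gt0.
pose D := 2 * (C * L * (al - b)^-1).
have D0 : 0 <= D by rewrite !mulr_ge0// invr_ge0 ltW.
exists D => // r r01; have /andP[r0 r1] := r01.
rewrite mulrC -[X in _ <= _ * X]subr0; apply: intg_ub => //.
  exact: (cont_on_normc_powR Va q0 r01).
move=> t _; rewrite ge0_ler_powR ?nnegrE ?normc_ge0 ?(ltW q0)//.
(* The centre is treated apart, as [normc_volterra_le] assumes a positive radius. *)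
move: r0; rewrite le_eqVlt => /predU1P[r0|r0].
  have z1 : normc (circle_pt r t) < 1 by rewrite normc_circle -r0 normr0.
  rewrite volterra_cesaro// ComplexField.Normc.normcM normc_circle -r0 normr0 mul0r//.
have rr : 0 < r < 1 by rewrite r0.
apply: le_trans (normc_volterra_le t ga fa rr) _; rewrite ler_wpM2l//.
(* The growth exponents of [f] and [g'] add up to [al - b - 1 > -1], which is integrable up to the
   boundary, with a bound free of [r]. *)
apply: (@le_trans _ _ (intg (fun s => C * L * (1 - s) `^ (al - b - 1)) 0 r)).
  apply: le_intg.
  - exact: (cont_onM (@cont_radial R f r t fa r1) (@cont_radial R _ r t (analytic_cderiv ga) r1)).
  - by apply: cont_onM; [exact: cont_on_cst|exact: cont_on_onem_powR].
  move=> s /andP[s0 sr]; have s1 : normc (circle_pt s t) < 1.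
    by rewrite normc_circle ger0_norm// (le_lt_trans sr).
  have -> : al - b - 1 = - b + (al - 1) by ring.
  rewrite powRD_gt0; last by lra.
  rewrite mulrACA; apply: ler_pM; rewrite ?normc_ge0//.
    by have := fC _ s1; rewrite /gap_weight normc_circle ger0_norm.
  by have := gL _ s1; rewrite normc_circle ger0_norm.
rewrite intgZ; last exact: cont_on_onem_powR.
rewrite ler_wpM2l ?mulr_ge0//; apply: le_trans (intg_onem_powR_le alb (ltW r0) r1) _.
by rewrite subr0 powR1 mul1r.
Qed.

End optimal_domains.

(** * Inclusion in the optimal domains, its continuity and its strictness *)

Lemma le_powR_nneg (R : realType) (x y p : R) : 0 <= p -> 0 <= x -> x <= y -> x `^ p <= y `^ p.
Proof. by move=> p0 x0 xy; rewrite ge0_ler_powR ?nnegrE// (le_trans x0). Qed.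

Lemma exists_invn_lt (R : realType) (a : R) : 0 < a -> exists2 m, (0 < m)%N & m%:R^-1 < a.
Proof.
move=> a0; exists (Num.bound a^-1).+1 => //.
rewrite -[ltRHS]invrK ltf_pV2 ?posrE ?invr_gt0 ?ltr0n//.
apply: lt_trans (archi_boundP _) _; first by rewrite invr_ge0 ltW.
by rewrite ltr_nat.
Qed.

Theorem proposition3p19 (R : realType) (g : R[i] -> R[i]) (p q : R)
    (hg : analytic_on_disc g) (hp : 1 <= p) (hpq : p < q) :
  (p^-1 - q^-1 <= 1 -> lipschitz_space (p^-1 - q^-1) g ->
     [/\ optimal_domain (volterra_op g) (hardy q)
           = optimal_domain (cesaro_op g) (hardy q),
         continuous_inclusion (hardy p) (hardy_norm p)
           (optimal_domain (volterra_op g) (hardy q))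
           (optimal_norm (volterra_op g) (hardy_norm q))
       & continuous_inclusion (hardy p) (hardy_norm p)
           (optimal_domain (cesaro_op g) (hardy q))
           (optimal_norm (cesaro_op g) (hardy_norm q))])
  /\
  (p^-1 - q^-1 < 1 -> little_lipschitz_space (p^-1 - q^-1) g ->
     optimal_domain (volterra_op g) (hardy q)
       = optimal_domain (cesaro_op g) (hardy q) /\
     proper_subspace (hardy p) (optimal_domain (volterra_op g) (hardy q))).
Proof.
have p0 : 0 < p := lt_le_trans ltr01 hp; have q0 : 0 < q := lt_trans p0 hpq.
have al0 : 0 < p^-1 - q^-1 by rewrite subr_gt0 ltf_pV2.
(* The half turns the non-strict bound supplied by [hardy_norm_le] into a strict one, and [A + 1]
   allows [A = 0]. *)
have small (e A : R) : 0 < e -> 0 <= A -> A * (e / 2 / (A + 1)) < e.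
  move=> e0 A0; have A1 : 0 < A + 1 by lra.
  by rewrite mulrA ltr_pdivrMr//; nra.
have domE := optimal_domain_volterra_cesaro q0 hg.
have bound := fun L => @cesaro_hardy_bound R g p q L hg hp hpq.
have sub : lipschitz_space (p^-1 - q^-1) g ->
    hardy p `<=` optimal_domain (cesaro_op g) (hardy q).
  move=> /lipschitz_cderiv_le[L L0 gL]; have [A A0 HA] := bound L L0 gL.
  move=> f /(hardyP _ p0)[fa [N N0 fN]]; split; first exact: fa.
  apply/(hardyP _ q0); split; first exact: analytic_cesaro.
  (* [N] may be 0, and the scaling argument asks for a positive bound. *)
  have N1 : 0 < N + 1 by rewrite ltr_wpDl.
  exists (A * (N + 1)); first exact: (mulr_ge0 A0 (ltW N1)).
  have fN1 r : 0 <= r < 1 -> pmean p f r <= 2 * pi * (N + 1) `^ p.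
    move=> r01; apply: le_trans (fN r r01) (ler_wpM2l (ltW (@ltr0_2pi R)) _).
    by apply: (le_powR_nneg (ltW p0) N0); rewrite lerDl ler01.
  exact: (HA f _ fa N1 fN1).
split=> [_ gl|_ gl].
  have [L L0 gL] := lipschitz_cderiv_le gl; have [A A0 HA] := bound L L0 gL.
  (* One argument for both operators: it asks only that the circle means of [T f] be dominated by
     those of [cesaro_op g f]. *)
  have cont (T : (R[i] -> R[i]) -> R[i] -> R[i]) :
      (forall f, analytic_on_disc f -> analytic_on_disc (T f)) ->
      (forall f r, analytic_on_disc f -> 0 <= r < 1 ->
         pmean q (T f) r <= pmean q (cesaro_op g f) r) ->
      forall f0, hardy p f0 -> forall e : R, 0 < e -> exists2 d : R, 0 < d &
        forall f, hardy p f -> (hardy_norm p (f \- f0)%R < d%:E)%E ->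
          (optimal_norm T (hardy_norm q) (f \- f0)%R < e%:E)%E.
    move=> Ta TC f0 [f0a _] e e0; have A1 : 0 < A + 1 by rewrite ltr_wpDl.
    have d0 : 0 < e / 2 / (A + 1) by rewrite !divr_gt0.
    exists (e / 2 / (A + 1)); first exact: d0.
    move=> f [fa _] fd.
    have ha : analytic_on_disc (f \- f0)%R.
      apply: (analytic_ext (f := fun z => f z + (-1) * f0 z)).
        by move=> z _; rewrite mulN1r.
      exact: (analyticD fa (analyticM (@analytic_cst R (-1)) f0a)).
    have AN : 0 <= A * (e / 2 / (A + 1)) by exact: (mulr_ge0 A0 (ltW d0)).
    apply: (@le_lt_trans _ _ (A * (e / 2 / (A + 1)))%:E); last first.
      by rewrite lte_fin; exact: (small e A e0 A0).
    apply/(hardy_norm_le (Ta _ ha) q0 AN).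
    move=> r r01; apply: le_trans (TC _ _ ha r01) _; apply: (HA _ _ ha d0 _ r r01).
    exact: (iffLR (hardy_norm_le ha p0 (ltW d0)) (ltW fd)).
  split; [exact: domE|split|split].
  - by rewrite domE; exact: sub.
  - apply: cont; first by move=> f; exact: analytic_volterra.
    by move=> f r fa r01; exact: pmean_volterra_le.
  - exact: sub.
  - apply: cont; first by move=> f; exact: analytic_cesaro.
    by move=> f r _ _; exact: lexx.
have al1 : p^-1 - q^-1 <= 1.
  have := invr_gt0 q; rewrite q0; have : p^-1 <= 1 by rewrite invf_le1.
  lra.
have gl' := little_lipschitz_space_sub al1 gl.
split; first exact: domE.
split; first exact: hardy_linear_subspace.
split; first by rewrite domE; exact: sub.
have [L L0 gL] := lipschitz_cderiv_le gl'.
have [m m0 mal] := exists_invn_lt al0.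
have [f fS] := @exists_gap_series R m m0.
have fC z : normc z < 1 -> normc (f z) <= 4 * gap_weight m z.
  move=> z1; have := fS z z1 0%N.
  by rewrite /gap_sum big_ord0 subr0 expr0 divr1; exact: id.
have fa : analytic_on_disc f.
  apply: analytic_uniform_limit => rho /andP[rho0 rho1] e e0 {sub bound domE}.
  have w0 : 0 <= 4 * (1 - rho) `^ (- m%:R^-1) by exact: (mulr_ge0 (ler0n R 4) (powR_ge0 _ _)).
  have [N NP] := geometric_small w0 e0.
  exists (gap_sum m N); first exact: analytic_gap_sum.
  move=> z zr; apply: le_trans (fS z (le_lt_trans zr rho1) N) _; apply: le_trans NP.
  by rewrite ler_wpM2r ?invr_ge0 ?exprn_ge0// ler_wpM2l// gap_weight_le.
(* The reverse inclusion would put the gap series in the Hardy space. *)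
move=> /(_ f) H; apply: (gap_series_not_hardy m0 hp fa fS); apply: H.
exact: (gap_series_in_optimal_domain hg fa q0 m0 mal L0 (ler0n R 4) gL fC).
Qed.
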